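(* Suppose that Assumption 1 and Assumption 2 (both written out in the context) hold with $p^*\ge 1$ and $q^*\ge 1$. Then, for any intermediate sequence $k=k_n$, $$\frac{\hat m(X_{(n:n-k)})-m\circ b(n/k)}{a\circ b(n/k)}\longrightarrow \mu\quad\text{in probability as }n\to\infty,$$ where $\mu=(1-\gamma)\int_0^\infty\int_{-\infty}^\infty xy\,\nu(\mathrm dx,\mathrm dy)$. If moreover $m(x)=\rho x$ (for some $\rho\in\mathbb R$) and either ($\mu=0$ and $a(x)=O(x)$ as $x\to\infty$) or $a(x)=o(x)$ as $x\to\infty$, then $\hat m(X_{(n:n-k)})/X_{(n:n-k)}$ is a consistent estimator of $\rho$, i.e. it converges to $\rho$ in probability.
   Context: Let $(X,Y)$ be a bivariate random vector and $(X_1,Y_1),\dots,(X_n,Y_n)$ i.i.d. copies of it. Let $\gamma\ge 0$, with the conventions $1/\gamma=+\infty$, $-1/\gamma=-\infty$ and $(1+\gamma x)^{-1/\gamma}=\mathrm e^{-x}$ when $\gamma=0$. If $\gamma=0$, the right endpoint of the distribution of $X$ is assumed infinite. Assumption 1. There exist $\gamma\ge0$ and monotone functions $a,b,m,\psi$ (with $a,\psi$ positive) such that the marginal distribution of $X$ is in the domain of attraction of the extreme value distribution with index $\gamma$, and the measures $\nu_n(\cdot)=n\,\mathbb P\big(\big(\frac{X-b(n)}{\psi\circ b(n)},\frac{Y-m\circ b(n)}{a\circ b(n)}\big)\in\cdot\big)$ converge vaguely on $(-1/\gamma,\infty]\times[-\infty,\infty]$ to a Radon measure $\nu$ such that $\nu([0,\infty)\times(-\infty,\infty))=1$,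 the distribution function $\Psi(y)=\nu([0,\infty)\times(-\infty,y])$ is non degenerate, and $(x,y)\mapsto\nu([x,\infty)\times(-\infty,y])$ is continuous on $(-1/\gamma,\infty]\times[-\infty,\infty]$. The function $b$ is chosen as $b=(1/(1-F_X))^{\leftarrow}$ (generalized inverse), $F_X$ being the distribution function of $X$. Assumption 2. There exist $p^*>0$, $q^*>0$ such that for any $\epsilon\in(0,1/\gamma)$, $\lim_{n\to\infty}\int_{-\epsilon}^\infty\int_{-\infty}^\infty|x|^{p^*}|y|^{q^*}\nu_n(\mathrm dx,\mathrm dy)=\int_{-\epsilon}^\infty\int_{-\infty}^\infty|x|^{p^*}|y|^{q^*}\nu(\mathrm dx,\mathrm dy)$. (Assumption 2 implies $\gamma<1/p^*$.) $X_{(n:1)}\le\dots\le X_{(n:n)}$ are the order statistics of $X_1,\dots,X_n$ and $Y_{[n:i]}$ is the $Y$-variable (concomitant) corresponding to $X_{(n:i)}$. An intermediate sequence is a sequence of integers $k=k_n$ with $k_n\to\infty$ and $n/k_n\to\infty$. The estimator of $m$ is $$\hat m(X_{(n:n-k)})=\frac{\sum_{i=1}^kY_{[n:n-i+1]}\{X_{(n:n-i+1)}-X_{(n:n-k)}\}}{\sum_{i=1}^k\{X_{(n:n-i+1)}-X_{(n:n-k)}\}}.$$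
   Formalization: The domain-of-attraction condition is taken with norming constants ψ(b(n)) and b(n), which fixes the scale of ψ; otherwise the claim fails (X~Exp(1), ψ=2, Y~N(1,1) independent, a=1, m=0: μ=1/2 but the limit is 1). γ<1/p* is made an explicit hypothesis. *)

(* Defs.v *)
From HB Require Import structures.
From mathcomp Require Import all_boot all_order all_algebra.
From mathcomp Require Import all_classical all_reals all_analysis.
From mathcomp Require Import measurable_realfun.

Set Implicit Arguments.
Unset Strict Implicit.
Unset Printing Implicit Defensive.

Import Order.TTheory GRing.Theory Num.Theory.
Import numFieldNormedType.Exports.

Local Open Scope classical_set_scope.
Local Open Scope ring_scope.

(* Needed by =O_ (pinfty_nbhs R) and =o_ (pinfty_nbhs R). *)
Canonical pinfty_filterType (R : realType) := FilterType (pinfty_nbhs R) _.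

(* The functions a, m and psi only matter near +oo (they are evaluated at b(t)
   with t large), so they are total functions whose monotonicity and sign are
   prescribed on some half-line only; this allows e.g. a(x) = x. *)
Definition monotone_near_pinfty (R : realType) (f : R -> R) : Prop :=
  exists x0 : R,
    {in `[x0, +oo[ &, {homo f : x y / x <= y}} \/
    {in `[x0, +oo[ &, {homo f : x y /~ x <= y}}.

Definition generalized_inverse (R : realType) (H : R -> \bar R) (t : R) : R :=
  inf [set x : R | (t%:E <= H x)%E].

(* b = (1 / (1 - F_X))^<-. The inverse is that of \bar R, where 0^-1 = +oo.
   For t <= 1 the infimum is over all of R and the value is irrelevant. *)
Definition tail_quantile d (T : measurableType d) (R : realType)
    (P : probability T R) (X : {RV P >-> R}) : R -> R :=
  generalized_inverse (fun x => (1 - cdf X x)^-1)%E.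

(* Extreme value distribution function of index g >= 0; it vanishes where
   1 + g x <= 0. *)
Definition evd (R : realType) (g x : R) : R :=
  if g == 0 then expR (- expR (- x))
  else if 0 < 1 + g * x then expR (- (1 + g * x) `^ (- g^-1)) else 0.

(* X is in the max-domain of attraction of evd g, with norming sequences
   c (scale) and l (location); evd g is continuous, so weak convergence is
   pointwise convergence of distribution functions. *)
Definition in_domain_of_attraction d (T : measurableType d) (R : realType)
    (P : probability T R) (X : {RV P >-> R}) (g : R) (c l : nat -> R) : Prop :=
  forall x : R,
    (fun n => (cdf X (l n + c n * x) ^+ n)%E) @ \oo --> (evd g x)%:E.

(* (-1/g, oo] x [-oo, oo], with 1/g = +oo when g = 0. Measures on this space
   are identified with measures on \bar R * \bar R that vanish off it. *)
Definition ev_space (R : realType) (g : R) : set (\bar R * \bar R) :=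
  [set z | (- (g%:E^-1) < z.1)%E].

Definition radon_on (R : realType) (E : set (\bar R * \bar R))
    (nu : {measure set (\bar R * \bar R) -> \bar R}) : Prop :=
  nu (~` E) = 0%E /\
  forall K : set (\bar R * \bar R), compact K -> K `<=` E -> (nu K < +oo)%E.

Definition vague_cvg_on (R : realType) (E : set (\bar R * \bar R))
    (nu_ : nat -> {measure set (\bar R * \bar R) -> \bar R})
    (nu : {measure set (\bar R * \bar R) -> \bar R}) : Prop :=
  forall f : \bar R * \bar R -> R,
    {within E, continuous f} ->
    (exists K : set (\bar R * \bar R),
      [/\ compact K, K `<=` E & forall z, ~ K z -> f z = 0]) ->
    (fun n => \int[nu_ n]_(z in E) (f z)%:E)%E @ \oo -->
      (\int[nu]_(z in E) (f z)%:E)%E.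

Section rescaled_measure.
Context d (T : measurableType d) (R : realType) (P : probability T R).
Variables (X Y : {RV P >-> R}) (a m psi : R -> R) (n : nat).
Let bn := tail_quantile X n%:R.

Definition rescaled (w : T) : \bar R * \bar R :=
  (((X w - bn) / psi bn)%:E, ((Y w - m bn) / a bn)%:E).

Lemma measurable_rescaled : measurable_fun setT rescaled.
Proof.
apply: measurable_fun_pair; apply/measurable_EFinP;
  apply: measurable_funM => //; exact: measurable_funB.
Qed.

HB.instance Definition _ :=
  @isMeasurableFun.Build _ _ _ _ rescaled measurable_rescaled.

Definition rescaled_measure : {measure set (\bar R * \bar R) -> \bar R} :=
  mscale (n%:R)%:nng (distribution P rescaled).

End rescaled_measure.

Section assumptions.
Context d (T : measurableType d) (R : realType) (P : probability T R).
Variables (X Y : {RV P >-> R}) (g : R) (a m psi : R -> R).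
Variable nu : {measure set (\bar R * \bar R) -> \bar R}.
Let b := tail_quantile X.

(* [x, oo) x (-oo, y] *)
Definition quadrant (x y : \bar R) : set (\bar R * \bar R) :=
  [set z | (x <= z.1 < +oo)%E /\ (-oo < z.2 <= y)%E].

(* The domain of attraction condition is stated with the norming constants
   psi(b(n)) and b(n). This ties the scale of psi to g: multiplying psi by a
   constant would rescale nu in its first variable, hence also
   (1 - g) \int \int x y nu(dx, dy). *)
Record extreme_assumption : Prop := {
  index_ge0 : 0 <= g ;
  endpoint_infinite : g = 0 -> forall x : R, (cdf X x < 1)%E ;
  a_monotone : monotone_near_pinfty a ;
  m_monotone : monotone_near_pinfty m ;
  psi_monotone : monotone_near_pinfty psi ;
  a_positive : \forall x \near +oo, 0 < a x ;
  psi_positive : \forall x \near +oo, 0 < psi x ;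
  X_attracted : in_domain_of_attraction X g
    (fun n => psi (b n%:R)) (fun n => b n%:R) ;
  nu_radon : radon_on (ev_space g) nu ;
  rescaled_cvg : vague_cvg_on (ev_space g) (rescaled_measure X Y a m psi) nu ;
  nu_mass : nu [set z | (0 <= z.1 < +oo)%E /\ (-oo < z.2 < +oo)%E] = 1%E ;
  nu_nondegenerate : ~ exists c : R, forall y : R,
    nu (quadrant 0%E y%:E) = ((c <= y)%R%:R)%:E ;
  nu_continuous :
    {within ev_space g, continuous (fun z => nu (quadrant z.1 z.2))} }.

(* \int_{-e}^oo \int_{-oo}^oo |x|^p |y|^q mu(dx, dy), over finite points. *)
Definition abs_moment (mu : {measure set (\bar R * \bar R) -> \bar R})
    (p q e : R) : \bar R :=
  (\int[mu]_(z in [set z | (- e)%:E <= z.1 < +oo /\ -oo < z.2 < +oo])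
    (`|fine z.1| `^ p * `|fine z.2| `^ q)%R%:E)%E.

(* Convergence of moments means convergence to a finite limit. The bound
   g < 1/p follows from it when a is nondecreasing, but not when a is
   decreasing: for X Pareto with 1 - F(x) = x^(-2/3) (so g = 3/2),
   Y = X^(-2/3) Z with Z > 0 bounded, atomless and independent of X, m = 0 and
   a(x) = x^(-2/3), the moments converge for p = q = 1. *)
Record moment_assumption (p q : R) : Prop := {
  p_gt0 : 0 < p ;
  q_gt0 : 0 < q ;
  index_lt : g * p < 1 ;
  abs_moment_finite : forall e : R, 0 < e -> (e%:E < g%:E^-1)%E ->
    (abs_moment nu p q e < +oo)%E ;
  abs_moment_cvg : forall e : R, 0 < e -> (e%:E < g%:E^-1)%E ->
    (fun n => abs_moment (rescaled_measure X Y a m psi n) p q e) @ \oo -->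
      abs_moment nu p q e }.

End assumptions.

(* (X_ i, Y_ i), i >= 0, are mutually independent, distributed as (X, Y). *)
Definition iid_copies d (T : measurableType d) (R : realType)
    (P : probability T R) (X Y : {RV P >-> R}) (X_ Y_ : nat -> {RV P >-> R})
    : Prop :=
  (forall (i : nat) (B : set (R * R)), measurable B ->
    P [set w | B (X_ i w, Y_ i w)] = P [set w | B (X w, Y w)]) /\
  (forall (s : seq nat) (B : nat -> set (R * R)), uniq s ->
    (forall i, measurable (B i)) ->
    P (\bigcap_(i in [set` s]) [set w | B i (X_ i w, Y_ i w)]) =
    (\prod_(i <- s) P [set w | B i (X_ i w, Y_ i w)])%E).

(* The sample of size n is x 0, .., x n.-1; ranks are numbered from 1. *)
Definition order_stat (R : realType) (x : nat -> R) (n i : nat) : R :=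
  nth 0 (sort <=%R [seq x j | j <- iota 0 n]) i.-1.

(* Ties among the x j are broken by index. This does not affect m_hat, since
   values tied with x_(n:n-k) have weight 0 in it. *)
Definition concomitant (R : realType) (x y : nat -> R) (n i : nat) : R :=
  (nth (0, 0) (sort (fun u v : R * R => u.1 <= v.1)
     [seq (x j, y j) | j <- iota 0 n]) i.-1).2.

Definition m_hat (R : realType) (x y : nat -> R) (n k : nat) : R :=
  (\sum_(1 <= i < k.+1) concomitant x y n (n - i + 1)%N *
     (order_stat x n (n - i + 1)%N - order_stat x n (n - k)%N)) /
  (\sum_(1 <= i < k.+1)
     (order_stat x n (n - i + 1)%N - order_stat x n (n - k)%N)).

Definition cvg_in_probability d (T : measurableType d) (R : realType)
    (P : probability T R) (Z : nat -> T -> R) (l : R) : Prop :=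
  forall e : R, 0 < e ->
    (fun n => P [set w | e < `|Z n w - l|]) @ \oo --> 0%E.

Definition intermediate (R : realType) (k : nat -> nat) : Prop :=
  k @ \oo --> \oo /\ (fun n => n%:R / (k n)%:R : R) @ \oo --> +oo.

Definition limit_mu (R : realType) (g : R)
    (nu : {measure set (\bar R * \bar R) -> \bar R}) : R :=
  (1 - g) *
  \int[nu]_(z in [set z | (0 <= z.1 < +oo)%E /\ (-oo < z.2 < +oo)%E])
    (fine z.1 * fine z.2).

(* Main.v *)
(* Write N for the integer part of n/k, x = (X - b N) / psi (b N) and
   y = (Y - m (b N)) / a (b N), and let tau be the value of x at the threshold
   X_(n:n-k). Then (m_hat - m (b N)) / a (b N) is the quotient of the means over
   the sample, normalized by k, of y (x - tau)^+ and of (x - tau)^+. By a weak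
   law of large numbers for triangular arrays, k^-1 #{i : x_i > c} tends to
   (1 + g c)^(-1/g), hence tau tends to 0; truncating x and y, the same law and
   vague convergence give the limits of the two means. The truncation error in x
   is controlled by the regular variation of b and psi. For the one in y, the
   moments of |x|^p |y|^q beyond a level are asymptotically negligible, but they
   do not dominate |y| near x = 0; so the event x > - d is compared with
   the event x' > 0 for the normalization of index 9N/10, where x' is bounded
   below by a positive constant. Passing between the indices N, N + 1, 9N/10 and
   the real number n/k relies on convergence of types and on the monotonicity of
   a, m and b. *)
Require Import Defs.
From HB Require Import structures.
From mathcomp Require Import all_boot all_order all_algebra.
From mathcomp Require Import all_classical all_reals all_analysis.
From mathcomp Require Import measurable_realfun.
From mathcomp Require Import ring lra zify.

Set Implicit Arguments.
Unset Strict Implicit.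
Unset Printing Implicit Defensive.

Import Order.TTheory GRing.Theory Num.Theory.
Import numFieldNormedType.Exports.

Local Open Scope classical_set_scope.
Local Open Scope ring_scope.

(** * Convergence of types *)

(** Three obstacles shape the proof. Vague convergence takes place on a space that contains the
    points with [x = +oo] or with [y] infinite, so mass could escape there; on [x >= 0] this is
    excluded by comparing the mass 1 of the finite points with the limit 1 of n P(x > 0). The joint
    moments say nothing about [x] where [y] is small, so the excesses of [x] are summed over the
    levels b(2^j n), where g < 1 makes the series geometric. Finally, a o b and m o b come without
    regular variation, and two normalizations are compared by a pigeonhole argument: two events
    inside a third one, with masses adding up to more than its mass, share an outcome [w], and [Y w]
    written in both normalizations relates their constants. For consecutive indices this gives
    convergence of types. For the ratio 9/10 it gives only bounds, which suffice; this ratio is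
    close enough to 1 for the pigeonhole to work. Convergence in probability is expressed as
    convergence along a filter on pairs (index, outcome), which makes the usual calculus of limits
    available for random sequences. *)

Section types.
Variables (R : realType) (I : Type) (F : set_system I).
Context {FF : Filter F}.

(** Weak agreement near [s] of the affine maps t -> u i + c i t and t -> u' i + c' i t. The slack
    [e] sits inside the arguments because the comparison of quantiles of two normalized variables
    yields exactly this. *)
Definition entangled (u c u' c' : I -> R) (s : R) : Prop :=
  \forall e \near 0^'+, \forall i \near F,
    u i + c i * (s - e) < u' i + c' i * (s + e) /\
    u' i + c' i * (s - e) < u i + c i * (s + e).

Lemma entangled_sym u c u' c' s :
  entangled u c u' c' s -> entangled u' c' u c s.
Proof.
move=> h; near=> e.
have : \forall i \near F,
    u i + c i * (s - e) < u' i + c' i * (s + e) /\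
    u' i + c' i * (s - e) < u i + c i * (s + e) by near: e.
by apply: filterS => i [].
Unshelve. all: by end_near. Qed.

Lemma entangled_ratio_lt u c u' c' s1 s2 (e : R) :
  s1 < s2 -> entangled u c u' c' s1 -> entangled u c u' c' s2 ->
  (\forall i \near F, 0 < c i) -> (\forall i \near F, 0 < c' i) ->
  0 < e -> \forall i \near F, c' i / c i < 1 + e.
Proof.
move=> s12 h1 h2 c0 c'0 e0.
have D0 : 0 < s2 - s1 by rewrite subr_gt0.
near (0:R)^'+ => r.
have r0 : 0 < r by near: r; exact: nbhs_right_gt.
(* Solves for [r], with room to spare, the inequality [E'] below. *)
have rD : (4 * e + 8) * r < e * (s2 - s1).
  rewrite mulrC -ltr_pdivlMr; last by lra.
  near: r; apply: nbhs_right_lt; apply: divr_gt0; first exact: mulr_gt0.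
  by lra.
have rD2 : 4 * r < s2 - s1.
  by rewrite mulrC -ltr_pdivlMr//; near: r; apply: nbhs_right_lt; rewrite divr_gt0.
have H1 : \forall i \near F,
    u i + c i * (s1 - r) < u' i + c' i * (s1 + r) /\
    u' i + c' i * (s1 - r) < u i + c i * (s1 + r) by near: r.
have H2 : \forall i \near F,
    u i + c i * (s2 - r) < u' i + c' i * (s2 + r) /\
    u' i + c' i * (s2 - r) < u i + c i * (s2 + r) by near: r.
near=> i.
have ci : 0 < c i by near: i.
have c'i : 0 < c' i by near: i.
rewrite ltr_pdivrMr//.
have [k1 _] : u i + c i * (s1 - r) < u' i + c' i * (s1 + r) /\
    u' i + c' i * (s1 - r) < u i + c i * (s1 + r) by near: i.
have [_ k2] : u i + c i * (s2 - r) < u' i + c' i * (s2 + r) /\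
    u' i + c' i * (s2 - r) < u i + c i * (s2 + r) by near: i.
(* Adding the inequalities at [s1] and at [s2] cancels [u] and [u']. *)
have E : c' i * (s2 - s1 - 2 * r) < c i * (s2 - s1 + 2 * r) by lra.
have er : 0 < e * r by exact: mulr_gt0.
have E' : s2 - s1 + 2 * r <= (1 + e) * (s2 - s1 - 2 * r) by lra.
have E2 : 0 < s2 - s1 - 2 * r by lra.
rewrite -(ltr_pM2r E2); apply: (lt_le_trans E).
rewrite -mulrA [X in _ <= X]mulrCA ler_pM2l//.
Unshelve. all: by end_near. Qed.

(* A quantitative form of Khinchin's convergence of types theorem. *)
Lemma entangled_types u c u' c' s1 s2 :
  s1 < s2 -> entangled u c u' c' s1 -> entangled u c u' c' s2 ->
  (\forall i \near F, 0 < c i) -> (\forall i \near F, 0 < c' i) ->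
  (fun i => c' i / c i) @ F --> (1:R) /\ (fun i => (u' i - u i) / c i) @ F --> (0:R).
Proof.
move=> s12 h1 h2 c0 c'0.
have rat : (fun i => c' i / c i) @ F --> (1:R).
  apply/cvgrPdist_lt => e e0.
  near (0:R)^'+ => r.
  have r0 : 0 < r by near: r; exact: nbhs_right_gt.
  have re : r < e by near: r; exact: nbhs_right_lt.
  (* The relation is symmetric, so both c' / c and its inverse are eventually below [1 + r]. *)
  have A := entangled_ratio_lt s12 h1 h2 c0 c'0 r0.
  have B := entangled_ratio_lt s12 (entangled_sym h1) (entangled_sym h2) c'0 c0 r0.
  near=> i.
  have ci : 0 < c i by near: i.
  have c'i : 0 < c' i by near: i.
  have a1 : c' i / c i < 1 + r by near: i.
  have b1 : c i / c' i < 1 + r by near: i.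
  have x0 : 0 < c' i / c i by exact: divr_gt0.
  have xy : (c' i / c i) * (c i / c' i) = 1.
    by rewrite mulrA divfK ?gt_eqF// divff ?gt_eqF.
  move: (c' i / c i) (c i / c' i) a1 b1 x0 xy => x y a1 b1 x0 xy.
  have : 1 < x * (1 + r) by rewrite -{1}xy ltr_pM2l.
  rewrite distrC => X1; rewrite ltr_norml; apply/andP; split; last by lra.
  have x1 : 1 - r <= x by nra.
  lra.
split=> //.
apply/cvgrPdist_lt => e e0.
near (0:R)^'+ => r.
have r0 : 0 < r by near: r; exact: nbhs_right_gt.
have r1 : r < 1 by near: r; exact: nbhs_right_lt.
(* The 3 is 1 for the slack [r] of the unprimed map plus 2 for [x * r], as [x < 2]. *)
have re : (`|s1| + 3) * r < e.
  rewrite mulrC -ltr_pdivlMr; last by rewrite (@lt_le_trans _ _ 3)// lerDr.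
  by near: r; apply: nbhs_right_lt; rewrite divr_gt0// (@lt_le_trans _ _ 3)// lerDr.
have H1 : \forall i \near F,
    u i + c i * (s1 - r) < u' i + c' i * (s1 + r) /\
    u' i + c' i * (s1 - r) < u i + c i * (s1 + r) by near: r.
have H2 : \forall i \near F, `|1 - c' i / c i| < r.
  by move/cvgrPdist_lt : rat; apply.
near=> i.
have ci : 0 < c i by near: i.
have c'i : 0 < c' i by near: i.
have [k1 k2] : u i + c i * (s1 - r) < u' i + c' i * (s1 + r) /\
    u' i + c' i * (s1 - r) < u i + c i * (s1 + r) by near: i.
have k3 : `|1 - c' i / c i| < r by near: i.
set x := c' i / c i in k3.
have c'E : c' i = x * c i by rewrite /x divfK// gt_eqF.
rewrite sub0r normrN.
set z := (u' i - u i) / c i.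
have uE : u' i = u i + z * c i by rewrite /z divfK ?gt_eqF//; lra.
have l1 : s1 - r < z + x * (s1 + r).
  by rewrite -(ltr_pM2l ci); rewrite c'E uE in k1; lra.
have l2 : z + x * (s1 - r) < s1 + r.
  by rewrite -(ltr_pM2l ci); rewrite c'E uE in k2; lra.
apply: le_lt_trans re.
move: k3; rewrite ltr_norml => /andP[x1 x2].
have y1 : `|(1 - x) * s1| <= r * `|s1|.
  by rewrite normrM ler_wpM2r// ltW// ltr_norml x1.
have := ler_norm ((1 - x) * s1); have := ler_norm (- ((1 - x) * s1)).
rewrite normrN => n1 n2.
have xr : x * r < 2 * r by rewrite ltr_pM2r//; lra.
have xr0 : - (2 * r) < x * r by nra.
by rewrite ler_norml; apply/andP; split; nra.
Unshelve. all: by end_near. Qed.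

End types.

(** * Poisson limit of powers *)

Section poisson.
Variable R : realType.

Lemma cvg_invn : (fun n => n%:R^-1 : R) @ \oo --> (0:R).
Proof.
apply/gtr0_cvgV0; last exact: cvgr_idn.
by apply: filterS (nbhs_infty_gt 0) => n; rewrite ltr0n.
Qed.

Lemma ln_bounds (p : R) : 0 < p <= 1 -> 1 - p <= - ln p /\ p * - ln p <= 1 - p.
Proof.
move=> /andP[p0 p1]; split.
  have := @le_ln1Dx R (p - 1); rewrite [1 + _]addrC subrK => h.
  by have := h ltac:(lra); lra.
have := @le_ln1Dx R (p^-1 - 1); rewrite [1 + _]addrC subrK lnV ?posrE// => h.
have ip : 0 < p^-1 by rewrite invr_gt0.
have {}h := h ltac:(lra).
rewrite -(ler_pM2l p0) in h.
by rewrite mulrBr mulfV ?gt_eqF// mulr1 in h.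
Qed.

(** Logarithms give n (- ln p_n) -> l, which forces p_n -> 1; then 1 - p is squeezed between p (- ln
    p) and - ln p. *)
Lemma poisson_cvg (p : nat -> R) (l : R) : (forall n, 0 <= p n <= 1) -> 0 <= l ->
  (fun n => p n ^+ n) @ \oo --> expR (- l) ->
  (fun n => n%:R * (1 - p n)) @ \oo --> l.
Proof.
move=> p01 l0 h.
have p0 : \forall n \near \oo, 0 < p n.
  have h0 : \forall n \near \oo, 0 < p n ^+ n.
    by apply: (cvgr_gt _ h); exact: expR_gt0.
  near=> n.
  have n0 : (0 < n)%N by near: n; exact: nbhs_infty_gt.
  have h1 : 0 < p n ^+ n by near: n.
  have /andP[+ _] := p01 n; rewrite le_eqVlt => /orP[/eqP E|//].
  by rewrite -E expr0n gt_eqF// ltxx in h1.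
have hl : (fun n => n%:R * - ln (p n)) @ \oo --> l.
  have : (fun n => - ln (p n ^+ n)) @ \oo --> - ln (expR (- l)).
    by apply: cvgN; apply: (cvg_comp _ _ h); apply: continuous_ln; exact: expR_gt0.
  rewrite expRK opprK; apply: cvg_trans; apply: near_eq_cvg.
  near=> n; rewrite lnXn; last by near: n.
  by rewrite mulrN mulr_natl.
have p1 : p @ \oo --> (1:R).
  have h1 : (fun n => 1 - n%:R^-1 * (n%:R * - ln (p n))) @ \oo --> (1:R).
    rewrite -[X in _ --> X](subr0 1) -[in X in _ --> X](mul0r l).
    apply: cvgB; first exact: cvg_cst.
    by apply: cvgM => //; exact: cvg_invn.
  have hc : (fun _ : nat => (1:R)) @ \oo --> (1:R) by exact: cvg_cst.
  apply: (squeeze_cvgr _ h1 hc).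
  near=> n.
  have /andP[_ pn1] := p01 n; rewrite pn1 andbT.
  have pn0 : 0 < p n by near: n.
  have n0 : n%:R != 0 :> R by rewrite pnatr_eq0 -lt0n; near: n; apply: nbhs_infty_gt.
  rewrite mulKf//.
  by have [] := @ln_bounds (p n) ltac:(by rewrite pn0); lra.
have hl' : (fun n => p n * (n%:R * - ln (p n))) @ \oo --> l.
  by rewrite -[X in _ --> X]mul1r; exact: cvgM.
apply: (squeeze_cvgr _ hl' hl).
near=> n.
have pn0 : 0 < p n by near: n.
have /andP[_ pn1] := p01 n.
have [a b] := @ln_bounds (p n) ltac:(by rewrite pn0).
by rewrite mulrCA !ler_wpM2l.
Unshelve. all: by end_near. Qed.

End poisson.

(** * Generalized Pareto tails *)

Section generalized_pareto.
Variable R : realType.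
Implicit Types g x y s : R.

(* The tail of the generalized Pareto distribution: (1 + g x)^(-1/g). *)
Definition gpd g x : R :=
  if g == 0 then expR (- x) else (1 + g * x) `^ (- g^-1).

(** The point where [gpd g] equals [s^-1]; equivalently, the limiting increment of the location, in
    units of the scale, when the index is multiplied by [s]. *)
Definition gpd_quantile g s : R :=
  if g == 0 then ln s else (s `^ g - 1) / g.

Lemma evdE g x : 0 < 1 + g * x -> evd g x = expR (- gpd g x).
Proof. by rewrite /evd /gpd; case: eqP => // _ ->. Qed.

Lemma gpd_gt0 g x : 0 < 1 + g * x -> 0 < gpd g x.
Proof.
by rewrite /gpd => h; case: eqP => _; rewrite ?expR_gt0// powR_gt0.
Qed.

Lemma gpd0 g : gpd g 0 = 1.
Proof. by rewrite /gpd; case: eqP => _; rewrite ?oppr0 ?expR0// mulr0 addr0 powR1. Qed.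

Lemma gpd_quantile_dom g s : 0 < s -> 0 <= g -> 1 + g * gpd_quantile g s = s `^ g.
Proof.
move=> s0 g0; rewrite /gpd_quantile; case: eqP => [->|/eqP gn].
  by rewrite mul0r addr0 powRr0.
by rewrite mulrC divfK// addrC subrK.
Qed.

(** Stability of the family: multiplying the index by [s] is an affine change of variable. This
    identifies the constants in the convergence of types. *)
Lemma gpd_affine g s x : 0 <= g -> 0 < s -> 0 < 1 + g * x ->
  gpd g (gpd_quantile g s + s `^ g * x) = s^-1 * gpd g x.
Proof.
move=> g0 s0 x0; have := gpd_quantile_dom s0 g0.
rewrite /gpd /gpd_quantile; case: eqP => [->|/eqP gn] h.
  by rewrite powRr0 mul1r opprD expRD (expRN (ln s)) lnK.
rewrite mulrDr addrA h -[X in X + _]mulr1 mulrCA -mulrDr.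
rewrite powRM ?powR_ge0// ?ltW// -powRrM mulrN mulfV//.
by rewrite powR_inv1// ltW.
Qed.

Lemma gpd_affine_dom g s x : 0 <= g -> 0 < s -> 0 < 1 + g * x ->
  0 < 1 + g * (gpd_quantile g s + s `^ g * x).
Proof.
move=> g0 s0 x0; rewrite mulrDr addrA gpd_quantile_dom//.
rewrite -[X in X + _]mulr1 mulrCA -mulrDr mulr_gt0// powR_gt0//.
Qed.

Lemma gpd_gpd_quantile g s : 0 <= g -> 0 < s -> gpd g (gpd_quantile g s) = s^-1.
Proof.
move=> g0 s0; have := @gpd_affine g s 0 g0 s0.
by rewrite !mulr0 !addr0 gpd0 mulr1 => -> //.
Qed.

Lemma gpd_lt g x y : 0 <= g -> 0 < 1 + g * x -> x < y -> gpd g y < gpd g x.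
Proof.
move=> g0 x0 xy; rewrite /gpd; case: eqP => [_|/eqP gn]; first by rewrite ltr_expR ltrN2.
have gp : 0 < g by rewrite lt_neqAle eq_sym gn.
have y0 : 1 + g * x < 1 + g * y by rewrite ltrD2l ltr_pM2l.
rewrite !powRN ltf_pV2 ?posrE ?powR_gt0//; last exact: lt_trans y0.
by rewrite gt0_ltr_powR ?invr_gt0// nnegrE ltW//; apply: lt_trans y0.
Qed.

Lemma gpd_quantile1 g : gpd_quantile g 1 = 0.
Proof. by rewrite /gpd_quantile powR1 ln1 subrr mul0r; case: eqP. Qed.

Lemma gpd_quantile_lt g s t : 0 <= g -> 0 < s -> s < t ->
  gpd_quantile g s < gpd_quantile g t.
Proof.
move=> g0 s0 st; have t0 := lt_trans s0 st.
rewrite /gpd_quantile; case: eqP => [_|/eqP gn]; first by rewrite ltr_ln.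
have gp : 0 < g by rewrite lt_neqAle eq_sym gn.
rewrite ltr_pM2r ?invr_gt0// ltrD2r.
by rewrite gt0_ltr_powR// nnegrE ltW.
Qed.

(** Continuity at 0 with a margin inside the domain [0 < 1 + g * x]. With [e = 1] it merely supplies
    some [dl > 0] with [g * dl < 1], that is, a half plane x >= - dl inside [ev_space g]. *)
Lemma gpd_near0 g (e : R) : 0 <= g -> 0 < e ->
  exists dl : R, [/\ 0 < dl, g * dl < 1, gpd g (- dl) < 1 + e & 1 - e < gpd g dl].
Proof.
move=> g0 e0; have e1 : 0 < 1 + e by lra.
have se : 0 < 1 + e / 2 by lra.
have q1 : gpd_quantile g (1 + e / 2)^-1 < 0.
  by rewrite -(gpd_quantile1 g) gpd_quantile_lt// ?invr_gt0// invf_lt1//; lra.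
have q2 : 0 < gpd_quantile g (1 + e / 2).
  by rewrite -(gpd_quantile1 g) gpd_quantile_lt//; lra.
(* [gpd g] takes the values [1 + e / 2] and [(1 + e / 2)^-1] at these two quantiles, and it is
   decreasing. *)
pose dl := Num.min (- gpd_quantile g (1 + e / 2)^-1) (gpd_quantile g (1 + e / 2)).
have d0 : 0 < dl by rewrite lt_min q2 oppr_gt0 q1.
have d1 : dl <= - gpd_quantile g (1 + e / 2)^-1 by rewrite ge_min lexx.
have d2 : dl <= gpd_quantile g (1 + e / 2) by rewrite ge_min lexx orbT.
have dom := @gpd_quantile_dom g (1 + e / 2)^-1 ltac:(by rewrite invr_gt0) g0.
have pp : 0 < (1 + e / 2)^-1 `^ g by rewrite powR_gt0 ?invr_gt0.
have gd : g * dl < 1.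
  have : g * dl <= g * (- gpd_quantile g (1 + e / 2)^-1) by rewrite ler_wpM2l.
  by lra.
have lt_le x y : 0 < 1 + g * x -> x <= y -> gpd g y <= gpd g x.
  by move=> h; rewrite le_eqVlt => /orP[/eqP -> //|/(gpd_lt g0 h)/ltW].
exists dl; split=> //.
  apply: (@le_lt_trans _ _ (1 + e / 2)); last by lra.
  rewrite -[leRHS]invrK -(@gpd_gpd_quantile g) ?invr_gt0//.
  by apply: lt_le; [rewrite dom|lra].
apply: (@lt_le_trans _ _ (1 + e / 2)^-1).
  by rewrite -(ltr_pM2r se) mulVf ?gt_eqF//; nra.
rewrite -(@gpd_gpd_quantile g)//; apply: lt_le => //.
by have := mulr_ge0 g0 (ltW d0); lra.
Qed.

(* [- gpd g x * (1 + g x) / (1 - g)] is a concave primitive of [gpd g]. *)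
Definition gpd_int g x : R := - (gpd g x * (1 + g * x)) / (1 - g).

(** Concavity without differentiation. As [gpd g z * (1 + g * z)] is the power of exponent 1 - 1/g
    of [1 + g * z] (an exponential when [g = 0]), the claim reduces to 1 + t <= exp t and ln t <= t
    - 1. It serves to compare [gpd_int] with Riemann sums of [gpd g]. *)
Lemma gpd_int_tangent g x y : 0 <= g -> g < 1 -> 0 < 1 + g * x -> 0 < 1 + g * y ->
  gpd_int g y - gpd_int g x <= gpd g x * (y - x).
Proof.
move=> g0 g1 x0 y0; have g1' : 0 < 1 - g by rewrite subr_gt0.
rewrite /gpd_int -mulrBl ler_pdivrMr//.
suff : gpd g x * (1 + g * y - (y - x)) <= gpd g y * (1 + g * y).
  rewrite !mulrBr !mulrDr !mulr1; lra.
rewrite /gpd; case: eqP => [->|/eqP gn].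
  rewrite !mul0r addr0 mulr1.
  have -> : - y = - x + (x - y) by lra.
  rewrite expRD ler_wpM2l ?expR_ge0//.
  by have := expR_ge1Dx (x - y); lra.
have gp : 0 < g by rewrite lt_neqAle eq_sym gn.
pose be := g^-1 - 1.
have beg : be * g = 1 - g by rewrite mulrBl mulVf// mul1r.
have be0 : 0 < be by rewrite subr_gt0 invf_gt1.
have E z : 0 < z -> z `^ (- g^-1) = expR (- be * ln z) / z.
  move=> z0; rewrite /powR gt_eqF// -[in RHS](lnK z0) -expRN -expRD expRK.
  by congr expR; rewrite /be; lra.
set A := 1 + g * x in x0 *; set B := 1 + g * y in y0 *.
rewrite !E//; have An : A != 0 by rewrite gt_eqF.
have Bn : B != 0 by rewrite gt_eqF.
have -> : expR (- be * ln B) / B * B = expR (- be * ln B) by rewrite divfK.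
have -> : - be * ln B = - be * ln A + - be * ln (B / A).
  by rewrite -mulrDr ln_div ?posrE//; congr (_ * _); lra.
rewrite expRD -mulrA ler_wpM2l ?expR_ge0//.
have h : ln (B / A) <= B / A - 1.
  have := @le_ln1Dx R (B / A - 1); rewrite [1 + _]addrC subrK; apply.
  by have := divr_gt0 y0 x0; lra.
have := expR_ge1Dx (- be * ln (B / A)).
apply: le_trans.
have h2 : be * ln (B / A) <= be * (B / A - 1) by rewrite ler_pM2l.
suff : A^-1 * (B - (y - x)) = 1 - be * (B / A - 1) by lra.
have -> : B / A - 1 = g * (y - x) / A.
  by apply: (mulIf An); rewrite mulrBl !divfK// mul1r /A /B; lra.
rewrite !mulrA beg; apply: (mulfI An); rewrite mulrA mulfV// mul1r mulrBr mulr1.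
rewrite mulrCA mulfV// mulr1.
by rewrite /A /B; lra.
Qed.

Lemma gpd_int0 g : gpd_int g 0 = - (1 - g)^-1.
Proof. by rewrite /gpd_int gpd0 mulr0 addr0 mulr1 mulN1r. Qed.

Lemma gpd_int_le0 g x : 0 <= g -> g < 1 -> 0 < 1 + g * x -> gpd_int g x <= 0.
Proof.
move=> g0 g1 x0; rewrite /gpd_int mulNr oppr_le0 divr_ge0 ?subr_ge0 ?ltW//.
by rewrite mulr_gt0// gpd_gt0.
Qed.

(** With [gpd_int0], this makes [(1 - g)^-1] the integral of [gpd g] over the positive half line,
    which is the limit of the normalized denominator of the estimator. *)
Lemma gpd_int_cvg0 g (e : R) : 0 <= g -> g < 1 -> 0 < e ->
  exists L0 : R, 0 < L0 /\ forall L, L0 <= L -> - e <= gpd_int g L.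
Proof.
move=> g0 g1 e0; have g1' : 0 < 1 - g by rewrite subr_gt0.
have eg0 : 0 < e * (1 - g) by rewrite mulr_gt0.
suff [L0 [L00 h]] : exists L0 : R, 0 < L0 /\ forall L, L0 <= L ->
    gpd g L * (1 + g * L) <= e * (1 - g).
  exists L0; split=> // L /h hL.
  by rewrite /gpd_int mulNr lerN2 ler_pdivrMr.
rewrite /gpd; case: eqP => [->|/eqP gn].
  exists (Num.max 1 (- ln (e * (1 - 0)))); split; first by rewrite lt_max ltr01.
  move=> L; rewrite ge_max mul0r addr0 mulr1 => /andP[_ h].
  rewrite subr0 mulr1 in h *.
  by rewrite -[leRHS]lnK ?posrE// ler_expR; lra.
have gp : 0 < g by rewrite lt_neqAle eq_sym gn.
pose be := g^-1 - 1.
have be0 : 0 < be by rewrite subr_gt0 invf_gt1.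
set r := e * (1 - g) in eg0 *.
(* The second bound solves (g L)^(-be) = r, that is, the required inequality with the 1 of
   [1 + g * L] dropped. *)
exists (Num.max 1 (r `^ (- be^-1) / g)); split; first by rewrite lt_max ltr01.
move=> L; rewrite ge_max => /andP[L1 h].
have A0 : 0 < 1 + g * L by have := mulr_gt0 gp (lt_le_trans ltr01 L1); lra.
have -> : (1 + g * L) `^ (- g^-1) * (1 + g * L) = (1 + g * L) `^ (- be).
  rewrite -[X in _ * X]powRr1 ?ltW// -powRD; first by congr powR; rewrite /be; lra.
  by rewrite (gt_eqF A0) implybT.
rewrite ler_pdivrMr// in h.
have h2 : r `^ (- be^-1) <= 1 + g * L by lra.
rewrite powRN -[leRHS]invrK lef_pV2 ?posrE ?powR_gt0 ?invr_gt0//.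
have -> : r^-1 = (r `^ (- be^-1)) `^ be.
  by rewrite -powRrM mulNr mulVf ?gt_eqF// powR_inv1// ltW.
by apply: ge0_ler_powR => //; rewrite ?nnegrE ?powR_ge0// ltW.
Qed.

End generalized_pareto.

(** * Expectations *)

Section probability_as_real.
Context d (T : measurableType d) (R : realType) (P : probability T R).
Implicit Types (A B C : set T) (f h : T -> R).

Definition pr A : R := fine (P A).

Lemma prE A : measurable A -> P A = (pr A)%:E.
Proof. by move=> mA; rewrite /pr fineK// fin_num_measure. Qed.

Lemma pr_ge0 A : 0 <= pr A.
Proof. by rewrite /pr fine_ge0// measure_ge0. Qed.

Lemma le_pr A B : measurable A -> measurable B -> A `<=` B -> pr A <= pr B.
Proof.
by move=> mA mB AB; rewrite -lee_fin -!prE// le_measure// inE.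
Qed.

Lemma pr_setU_disj A B : measurable A -> measurable B -> (forall w, A w -> ~ B w) ->
  pr (A `|` B) = pr A + pr B.
Proof.
move=> mA mB AB; apply: EFin_inj.
rewrite EFinD -!prE//; last exact: measurableU.
by apply: measureU => //; apply/seteqP; split=> // w [/AB].
Qed.

Lemma measurable_set_bool (b : T -> bool) : measurable_fun setT b ->
  measurable [set w | b w].
Proof.
move=> mb; rewrite -[X in measurable X]setTI.
by rewrite (_ : [set w | b w] = b @^-1` [set true])//; exact: mb.
Qed.

Lemma measurable_set_lt f h : measurable_fun setT f -> measurable_fun setT h ->
  measurable [set w | f w < h w].
Proof. by move=> mf mh; apply/measurable_set_bool; exact: measurable_fun_ltr. Qed.

Lemma measurable_set_le f h : measurable_fun setT f -> measurable_fun setT h ->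
  measurable [set w | f w <= h w].
Proof. by move=> mf mh; apply/measurable_set_bool; exact: measurable_fun_ler. Qed.

Lemma le_prU A B : measurable A -> measurable B -> pr (A `|` B) <= pr A + pr B.
Proof.
move=> mA mB; rewrite -lee_fin EFinD -!prE//; last exact: measurableU.
exact: measureU2.
Qed.

(** Pigeonhole principle. Every comparison of two normalizations of [Y] rests on an outcome found
    this way. *)
Lemma pr_meet A B C : measurable A -> measurable B -> measurable C ->
  A `<=` C -> B `<=` C -> pr C < pr A + pr B -> exists w, A w /\ B w.
Proof.
move=> mA mB mC AC BC h; apply: contrapT => AB.
have AB0 w : A w -> ~ B w by move=> Aw Bw; apply: AB; exists w.
have : pr (A `|` B) <= pr C.
  by apply: le_pr => //; [exact: measurableU|move=> w [/AC|/BC]].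
by rewrite pr_setU_disj// leNgt h.
Qed.

(** Bounded measurable functions: a class stable under the operations that occur, so that [mean] is
    linear without separate integrability conditions. *)
Definition bmf f : Prop :=
  measurable_fun setT f /\ exists K : R, forall w, `|f w| <= K.

Definition mean f : R := \int[P]_w f w.

Lemma bmf_integrable f : bmf f -> P.-integrable setT (EFin \o f).
Proof.
move=> [mf [K fK]]; apply: measurable_bounded_integrable => //.
  by rewrite (le_lt_trans (probability_le1 _ _))// ltry.
exists K; split; first by rewrite num_real.
by move=> M KM w _ /=; rewrite (le_trans (fK w))// ltW.
Qed.

Lemma bmf_cst (c : R) : bmf (fun=> c).
Proof. by split=> //; exists `|c|. Qed.

Lemma bmfD f h : bmf f -> bmf h -> bmf (fun w => f w + h w).
Proof.
move=> [mf [K fK]] [mh [L hL]]; split; first exact: measurable_funD.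
by exists (K + L) => w; rewrite (le_trans (ler_normD _ _))// lerD.
Qed.

Lemma bmfM f h : bmf f -> bmf h -> bmf (fun w => f w * h w).
Proof.
move=> [mf [K fK]] [mh [L hL]]; split; first exact: measurable_funM.
by exists (K * L) => w; rewrite normrM ler_pM.
Qed.

Lemma bmfZ (c : R) f : bmf f -> bmf (fun w => c * f w).
Proof. by move=> hf; apply: bmfM => //; exact: bmf_cst. Qed.

Lemma bmfB f h : bmf f -> bmf h -> bmf (fun w => f w - h w).
Proof.
move=> hf hh.
rewrite (_ : (fun w => _) = fun w => f w + (-1) * h w); last first.
  by apply/funext => w; rewrite mulN1r.
by apply: bmfD => //; exact: bmfZ.
Qed.

Lemma bmf_sum (I : Type) (r : seq I) (F : I -> T -> R) :
  (forall i, bmf (F i)) -> bmf (fun w => \sum_(i <- r) F i w).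
Proof.
move=> hF; elim: r => [|i r IH].
  by rewrite (_ : (fun w => _) = fun=> 0); [exact: bmf_cst|apply/funext=> w; rewrite big_nil].
rewrite (_ : (fun w => _) = fun w => F i w + \sum_(j <- r) F j w); first exact: bmfD.
by apply/funext => w; rewrite big_cons.
Qed.

Lemma bmf_bool (b : T -> bool) : measurable [set w | b w] -> bmf (fun w => (b w)%:R).
Proof.
move=> mb; split; last by exists 1 => w; case: (b w); rewrite ?normr0 ?normr1.
rewrite (_ : (fun w => _) = \1_[set w | b w]); first exact: measurable_indic.
by apply/funext => w; rewrite indicE mem_setE.
Qed.

Lemma meanD f h : bmf f -> bmf h -> mean (fun w => f w + h w) = mean f + mean h.
Proof. by move=> hf hh; rewrite /mean RintegralD//; exact: bmf_integrable. Qed.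

Lemma meanZ (c : R) f : bmf f -> mean (fun w => c * f w) = c * mean f.
Proof. by move=> hf; rewrite /mean RintegralZl//; exact: bmf_integrable. Qed.

Lemma meanB f h : bmf f -> bmf h -> mean (fun w => f w - h w) = mean f - mean h.
Proof. by move=> hf hh; rewrite /mean RintegralB//; exact: bmf_integrable. Qed.

Lemma mean_cst (c : R) : mean (fun=> c) = c.
Proof. by rewrite /mean Rintegral_cst// [X in fine X](@probability_setT _ _ _ P) mulr1. Qed.

Lemma le_mean f h : bmf f -> bmf h -> (forall w, f w <= h w) -> mean f <= mean h.
Proof. by move=> hf hh fh; apply: le_Rintegral => //; exact: bmf_integrable. Qed.

Lemma mean_ge0 f : (forall w, 0 <= f w) -> 0 <= mean f.
Proof. by move=> f0; apply: Rintegral_ge0. Qed.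

Lemma mean_sum (I : Type) (r : seq I) (F : I -> T -> R) : (forall i, bmf (F i)) ->
  mean (fun w => \sum_(i <- r) F i w) = \sum_(i <- r) mean (F i).
Proof.
move=> hF; elim: r => [|i r IH].
  rewrite big_nil -[RHS](mean_cst 0); congr mean.
  by apply/funext=> w; rewrite big_nil.
rewrite big_cons -IH -meanD//; last exact: bmf_sum.
by congr mean; apply/funext => w; rewrite big_cons.
Qed.

Lemma mean_bool (b : T -> bool) : measurable [set w | b w] ->
  mean (fun w => (b w)%:R) = pr [set w | b w].
Proof.
move=> mb; rewrite /mean /pr /Rintegral -[in RHS](setIT [set w | b w]).
rewrite -integral_indic//; congr fine; apply: eq_integral => w _.
by rewrite indicE mem_setE.
Qed.

(* The expectation of a nonnegative function, possibly infinite. *)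
Definition uexp f : \bar R := (\int[P]_w (f w)%:E)%E.

Lemma uexp_ge0 f : (forall w, 0 <= f w) -> (0 <= uexp f)%E.
Proof. by move=> f0; apply: integral_ge0 => w _; rewrite lee_fin. Qed.

Lemma le_uexp f h : measurable_fun setT f -> measurable_fun setT h ->
  (forall w, 0 <= f w <= h w) -> (uexp f <= uexp h)%E.
Proof.
move=> mf mh fh; apply: ge0_le_integral => //.
- by move=> w _; rewrite lee_fin; have /andP[] := fh w.
- by apply/measurable_EFinP.
- by apply/measurable_EFinP.
- by move=> w _; rewrite lee_fin; have /andP[] := fh w.
Qed.

Lemma uexpD f h : measurable_fun setT f -> measurable_fun setT h ->
  (forall w, 0 <= f w) -> (forall w, 0 <= h w) ->
  uexp (fun w => f w + h w) = (uexp f + uexp h)%E.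
Proof.
move=> mf mh f0 h0; rewrite /uexp -ge0_integralD//.
- by move=> w _; rewrite lee_fin.
- exact/measurable_EFinP.
- by move=> w _; rewrite lee_fin.
- exact/measurable_EFinP.
Qed.

Lemma uexpZ (c : R) f : measurable_fun setT f -> (forall w, 0 <= f w) -> 0 <= c ->
  uexp (fun w => c * f w) = (c%:E * uexp f)%E.
Proof.
move=> mf f0 c0; rewrite /uexp -ge0_integralZl//.
- exact/measurable_EFinP.
- by move=> w _; rewrite lee_fin.
Qed.

Lemma uexp_bmf f : bmf f -> (uexp f) = (mean f)%:E.
Proof.
move=> hf; rewrite /uexp /mean /Rintegral fineK//.
by apply: integrable_fin_num => //; exact: bmf_integrable.
Qed.

Lemma uexp_markov f (e : R) : measurable_fun setT f -> (forall w, 0 <= f w) ->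
  0 < e -> (e%:E * P [set w | (e <= f w)%R] <= uexp f)%E.
Proof.
move=> mf f0 e0.
have m1 : measurable [set w | e <= f w].
  by apply: measurable_set_le.
rewrite -[X in P X]setIT -integral_indic// -ge0_integralZl//.
- apply: ge0_le_integral => //.
  + by move=> w _; rewrite -EFinM lee_fin mulr_ge0// ltW.
  + apply: measurable_funeM; apply/measurable_EFinP; exact: measurable_indic.
  + by apply/measurable_EFinP.
  + move=> w _; rewrite -EFinM lee_fin indicE.
    have [|] := boolP (w \in _); last by rewrite mulr0.
    by rewrite inE /= mulr1.
- by apply/measurable_EFinP; exact: measurable_indic.
- by rewrite lee_fin ltW.
Qed.

End probability_as_real.

(** * The tail of X *)

Section attraction.
Context d (T : measurableType d) (R : realType) (P : probability T R).
Variables (X : {RV P >-> R}) (g : R) (c l : nat -> R).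
Hypothesis g0 : 0 <= g.
Hypothesis Hatt : in_domain_of_attraction X g c l.

Definition tail (x : R) : R := pr P [set w | x < X w].

Lemma measurable_gt (x : R) : measurable [set w | x < X w].
Proof. exact: measurable_set_lt. Qed.

Lemma tail_ge0 x : 0 <= tail x. Proof. exact: pr_ge0. Qed.

Lemma tail_le x y : x <= y -> tail y <= tail x.
Proof.
move=> xy; apply: le_pr; try exact: measurable_gt.
by move=> w /=; exact: le_lt_trans.
Qed.

Lemma lt_of_tail x y : tail y < tail x -> x < y.
Proof. by move=> h; rewrite ltNge; apply: contraTN h => /tail_le; rewrite leNgt. Qed.

Lemma cdfE x : cdf X x = (1 - tail x)%:E.
Proof.
rewrite cdf_1_ccdf /tail EFinB; congr (_ - _)%E.
rewrite -prE; last exact: measurable_gt.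
by congr (P _); apply/funext => w; rewrite /= in_itv /= andbT.
Qed.

Lemma tail_le1 x : tail x <= 1.
Proof. by have := cdf_ge0 X x; rewrite cdfE lee_fin subr_ge0. Qed.

(** The distribution function is 1 - tail, so the convergence of its powers is of the form treated
    by [poisson_cvg]. *)
Lemma tail_cvg (x : R) : 0 < 1 + g * x ->
  (fun n => n%:R * tail (l n + c n * x)) @ \oo --> gpd g x.
Proof.
move=> x0; have h := @Hatt x; rewrite evdE// in h.
have := @poisson_cvg R (fun n => 1 - tail (l n + c n * x)) (gpd g x).
rewrite (_ : (fun n => _ * (1 - _)) = fun n => n%:R * tail (l n + c n * x)).
  apply.
  - by move=> n; rewrite subr_ge0 tail_le1 gerBl tail_ge0.
  - by rewrite ltW// gpd_gt0.
  - have /fine_cvgP[_] := h; apply: cvg_trans; apply: near_eq_cvg; near=> n.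
    by rewrite /= cdfE -EFin_expe.
by apply/funext => n; rewrite opprB addrC subrK.
Unshelve. all: by end_near. Qed.

(** [gpd g] is strictly decreasing, so the tail at [l n + c n * dl] is eventually smaller than at
    [l n]; by monotonicity of the tail the first point lies to the right of the second. *)
Lemma attraction_scale_gt0 : \forall n \near \oo, 0 < c n.
Proof.
have [dl [d0 gd _ _]] := gpd_near0 g0 ltr01.
have dom0 : 0 < 1 + g * 0 by rewrite mulr0 addr0.
have dom1 : 0 < 1 + g * dl by have := mulr_ge0 g0 (ltW d0); lra.
have lt := gpd_lt g0 dom0 d0.
have [m1 m2] := midf_lt lt.
have A : \forall n \near \oo, n%:R * tail (l n + c n * dl) < (gpd g dl + gpd g 0) / 2.
  by apply: (cvgr_lt _ (tail_cvg dom1)).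
have B : \forall n \near \oo, (gpd g dl + gpd g 0) / 2 < n%:R * tail (l n + c n * 0).
  by apply: (cvgr_gt _ (tail_cvg dom0)).
near=> n.
have : n%:R * tail (l n + c n * dl) < n%:R * tail (l n + c n * 0).
  by apply: (@lt_trans _ _ ((gpd g dl + gpd g 0) / 2)); near: n.
have n0 : 0 < n%:R :> R by rewrite ltr0n; near: n; exact: nbhs_infty_gt.
rewrite ltr_pM2l// => /lt_of_tail; rewrite mulr0 addr0 ltrDl.
by rewrite pmulr_lgt0.
Unshelve. all: by end_near. Qed.

(** The norming at index N, transported by [gpd_affine], and the norming at index M produce the same
    limit of M times the tail. Monotonicity of the tail turns equal limits into entanglement, and
    convergence of types concludes. *)
Lemma attraction_types (M N : nat -> nat) (s : R) :
  M @ \oo --> \oo -> N @ \oo --> \oo -> 0 < s ->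
  (fun n => (M n)%:R / (N n)%:R : R) @ \oo --> s ->
  (fun n => c (M n) / c (N n)) @ \oo --> s `^ g /\
  (fun n => (l (M n) - l (N n)) / c (N n)) @ \oo --> gpd_quantile g s.
Proof.
move=> MN NN s0 MNs.
have cN : \forall n \near \oo, 0 < c (N n) by exact: (NN _ attraction_scale_gt0).
have cM : \forall n \near \oo, 0 < c (M n) by exact: (MN _ attraction_scale_gt0).
have sg : 0 < s `^ g by rewrite powR_gt0.
(* The norming at [N n] rewritten as a candidate norming at index [M n], which is about s times
   [N n]. *)
pose u n := l (N n) + c (N n) * gpd_quantile g s.
pose cc n := c (N n) * s `^ g.
have cc0 : \forall n \near \oo, 0 < cc n by apply: filterS cN => n ?; rewrite mulr_gt0.
have t1 x : 0 < 1 + g * x ->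
    (fun n => (M n)%:R * tail (l (M n) + c (M n) * x)) @ \oo --> gpd g x.
  by move=> /tail_cvg h; apply: (cvg_comp _ _ MN h).
have t2 x : 0 < 1 + g * x ->
    (fun n => (M n)%:R * tail (u n + cc n * x)) @ \oo --> gpd g x.
  move=> x0; have h := tail_cvg (gpd_affine_dom g0 s0 x0).
  have {}h := cvg_comp _ _ NN h.
  have : (fun n => (M n)%:R / (N n)%:R *
      ((N n)%:R * tail (l (N n) + c (N n) * (gpd_quantile g s + s `^ g * x)))) @ \oo
      --> s * gpd g (gpd_quantile g s + s `^ g * x) by apply: cvgM.
  rewrite gpd_affine// mulrA mulfV ?gt_eqF// mul1r.
  apply: cvg_trans; apply: near_eq_cvg; near=> n.
  have n0 : (N n)%:R != 0 :> R.
    by rewrite pnatr_eq0 -lt0n; near: n; exact: (NN _ (nbhs_infty_gt 0)).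
  by rewrite mulrA divfK// /u /cc mulrDr -mulrA addrA.
(* For x < y the limits satisfy gpd y < gpd x, and a strictly smaller tail means a point further to
   the right. *)
have key (a1 a2 b1 b2 : nat -> R) :
    (forall x, 0 < 1 + g * x -> (fun n => (M n)%:R * tail (a1 n + a2 n * x)) @ \oo --> gpd g x) ->
    (forall x, 0 < 1 + g * x -> (fun n => (M n)%:R * tail (b1 n + b2 n * x)) @ \oo --> gpd g x) ->
    forall x y, 0 < 1 + g * x -> x < y ->
    \forall n \near \oo, a1 n + a2 n * x < b1 n + b2 n * y.
  move=> ha hb x y x0 xy.
  have y0 : 0 < 1 + g * y by have := ler_wpM2l g0 (ltW xy); lra.
  have [m1 m2] := midf_lt (gpd_lt g0 x0 xy).
  have A : \forall n \near \oo, (M n)%:R * tail (b1 n + b2 n * y) < (gpd g y + gpd g x) / 2.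
    exact: (cvgr_lt _ (hb _ y0)).
  have B : \forall n \near \oo, (gpd g y + gpd g x) / 2 < (M n)%:R * tail (a1 n + a2 n * x).
    exact: (cvgr_gt _ (ha _ x0)).
  near=> n; apply: lt_of_tail.
  have n0 : 0 < (M n)%:R :> R.
    by rewrite ltr0n; near: n; exact: (MN _ (nbhs_infty_gt 0)).
  rewrite -(ltr_pM2l n0).
  by apply: (@lt_trans _ _ ((gpd g y + gpd g x) / 2)); near: n.
have ent x : 0 <= x -> entangled \oo u cc (fun n => l (M n)) (fun n => c (M n)) x.
  have g1 : 0 < g + 1 by exact: ltr_wpDl.
  move=> x0; near=> e.
  have e0 : 0 < e by near: e; exact: nbhs_right_gt.
  have dom : 0 < 1 + g * (x - e).
    have ge : g * e < 1.
      rewrite mulrC; apply: (@le_lt_trans _ _ (e * (g + 1))).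
        by rewrite ler_pM2l// lerDl.
      rewrite -ltr_pdivlMr//.
      by near: e; apply: nbhs_right_lt; rewrite divr_gt0.
    by have := mulr_ge0 g0 x0; lra.
  have xe : x - e < x + e by lra.
  apply: filterS2 (key _ _ _ _ t2 t1 _ _ dom xe) (key _ _ _ _ t1 t2 _ _ dom xe).
  by move=> n.
have [r1 r2] := entangled_types (@ltr01 R) (ent 0 (lexx _)) (ent 1 ler01) cc0 cM.
split.
  rewrite -[X in _ --> X]mul1r.
  have : (fun n => c (M n) / cc n * s `^ g) @ \oo --> 1 * s `^ g.
    by apply: cvgM => //; exact: cvg_cst.
  apply: cvg_trans; apply: near_eq_cvg; near=> n.
  by rewrite /cc invfM !mulrA -mulrA mulVf ?gt_eqF// mulr1.
have : (fun n => (l (M n) - u n) / cc n * s `^ g + gpd_quantile g s) @ \oo -->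
    0 * s `^ g + gpd_quantile g s.
  by apply: cvgD; [apply: cvgM => //; exact: cvg_cst|exact: cvg_cst].
rewrite mul0r add0r; apply: cvg_trans; apply: near_eq_cvg; near=> n.
have n0 : c (N n) != 0 by rewrite gt_eqF//; near: n.
rewrite /cc /u invfM !mulrA -mulrA mulVf ?gt_eqF// mulr1.
by apply: (mulIf n0); rewrite mulrDl !divfK//; lra.
Unshelve. all: by end_near. Qed.

End attraction.

Lemma cvg_pow2M (N : nat -> nat) (j : nat) : N @ \oo --> \oo ->
  (fun n => 2 ^ j * N n)%N @ \oo --> \oo.
Proof.
move=> /cvgnyPge NN; apply/cvgnyPge => A; apply: filterS (NN A) => n h.
by rewrite (leq_trans h)// leq_pmull// expn_gt0.
Qed.

(** * Unboundedness of the location, truncated means of X *)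

Section attraction_moments.
Context d (T : measurableType d) (R : realType) (P : probability T R).
Variables (X : {RV P >-> R}) (g : R) (c l : nat -> R).
Hypothesis g0 : 0 <= g.
Hypothesis Hatt : in_domain_of_attraction X g c l.
Hypothesis l_homo : forall m n, (2 <= m <= n)%N -> l m <= l n.
Hypothesis end_infty : g = 0 -> forall x : R, (cdf X x < 1)%E.

Lemma double_cvg : (fun n => c (2 * n)%N / c n) @ \oo --> 2 `^ g /\
  (fun n => (l (2 * n)%N - l n) / c n) @ \oo --> gpd_quantile g 2.
Proof.
apply: (@attraction_types _ _ _ P X g c l g0 Hatt (fun n => (2 * n)%N) id) => //.
  exact: (@cvg_pow2M id 1).
have h : (fun _ : nat => (2:R)) @ \oo --> (2:R) by exact: cvg_cst.
apply: cvg_trans h; apply: near_eq_cvg; near=> n.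
by rewrite natrM mulfK// pnatr_eq0 -lt0n; near: n; exact: nbhs_infty_gt.
Unshelve. all: by end_near. Qed.

Lemma gpd_quantile2_gt0 : 0 < gpd_quantile g 2.
Proof. by rewrite -(gpd_quantile1 g) gpd_quantile_lt// ltr1n. Qed.

Lemma tail_location : (fun n => n%:R * tail X (l n)) @ \oo --> (1:R).
Proof.
have := @tail_cvg _ _ _ _ X g c l Hatt 0; rewrite mulr0 addr0 gpd0 => h.
have {}h := h ltr01; apply: cvg_trans h.
by apply: near_eq_cvg; near=> n; rewrite mulr0 addr0.
Unshelve. all: by end_near. Qed.

(** For [g = 0], a bound [x] on the location would keep [n * tail X x] bounded although the endpoint
    is infinite. For [g > 0], the scale does not decrease under doubling of a large index, since its
    ratio tends to 2^g > 1, so each doubling moves the location by at least a fixed amount. *)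
Lemma location_unbounded (x : R) : exists N, (2 <= N)%N /\ x < l N.
Proof.
apply: contrapT => /forallNP H.
have lx N : (2 <= N)%N -> l N <= x.
  by move=> N2; rewrite leNgt; apply/negP => xl; apply: (H N).
have [g_eq0|g_neq0] := eqVneq g 0.
  have tx : 0 < tail X x.
    by have := end_infty g_eq0 x; rewrite cdfE lte_fin; lra.
  have h2 : \forall n \near \oo, n%:R * tail X (l n) < 2.
    by apply: (cvgr_lt _ tail_location); rewrite ltr1n.
  near \oo => n.
  have : n%:R * tail X x < 2.
    apply: (@le_lt_trans _ _ (n%:R * tail X (l n))); last by near: n.
    by rewrite ler_wpM2l// tail_le// lx//; near: n; exact: nbhs_infty_ge.
  rewrite ltNge => /negP; apply; rewrite -ler_pdivrMr//.
  by near: n; exact: nbhs_infty_ger.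
have gp : 0 < g by rewrite lt_neqAle eq_sym g_neq0.
have [dc dl] := double_cvg.
have h1 : 1 < (2:R) `^ g.
  rewrite -[X in X < _](_ : 1 `^ g = 1); last by rewrite powR1.
  by rewrite gt0_ltr_powR ?nnegrE ?ltr1n.
have q0 := gpd_quantile2_gt0.
have A : \forall n \near \oo, 1 < c (2 * n)%N / c n by apply: (cvgr_gt _ dc).
have B : \forall n \near \oo, gpd_quantile g 2 / 2 < (l (2 * n)%N - l n) / c n.
  by apply: (cvgr_gt _ dl); lra.
have [N0 _ HN] : \forall n \near \oo, [/\ (2 <= n)%N, 0 < c n, 1 < c (2 * n)%N / c n &
    gpd_quantile g 2 / 2 < (l (2 * n)%N - l n) / c n].
  near=> n; split.
  - by near: n; exact: nbhs_infty_ge.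
  - near: n; exact: (attraction_scale_gt0 g0 Hatt).
  - by near: n.
  - by near: n.
have [N02 cN0 _ _] := HN N0 (leqnn _).
have ge j : (N0 <= 2 ^ j * N0)%N by rewrite leq_pmull// expn_gt0.
have ind j : c N0 <= c (2 ^ j * N0)%N /\
    l N0 + j%:R * (gpd_quantile g 2 / 2 * c N0) <= l (2 ^ j * N0)%N.
  elim: j => [|j [IH1 IH2]]; first by rewrite expn0 mul1n mul0r addr0.
  have [n2 cn h3 h4] := HN _ (ge j).
  rewrite expnS -mulnA; move: h3 h4; rewrite ltr_pdivlMr// ltr_pdivlMr// mul1r.
  move=> h3 h4; split; first by rewrite (le_trans IH1)// ltW.
  rewrite mulrSr mulrDl mul1r addrA.
  have : gpd_quantile g 2 / 2 * c N0 <= gpd_quantile g 2 / 2 * c (2 ^ j * N0)%N.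
    by rewrite ler_wpM2l// divr_ge0// ltW.
  by lra.
have e0 : 0 < gpd_quantile g 2 / 2 * c N0 by rewrite mulr_gt0// divr_gt0.
near \oo => j.
have [_ lj] := ind j.
have := lx _ (leq_trans N02 (ge j)).
have : (x - l N0) / (gpd_quantile g 2 / 2 * c N0) < j%:R.
  by near: j; exact: nbhs_infty_gtr.
by rewrite ltr_pdivrMr//; lra.
Unshelve. all: by end_near. Qed.

Lemma location_cvg : l @ \oo --> +oo.
Proof.
apply/cvgryPge => A; have [N [N2 AN]] := location_unbounded A.
exists N => // n /= Nn; apply: le_trans (ltW AN) _.
by apply: l_homo; rewrite N2.
Qed.

Definition standard (n : nat) (w : T) : R := (X w - l n) / c n.

Lemma measurable_standard n : measurable_fun setT (standard n).
Proof. by apply: measurable_funM => //; apply: measurable_funB. Qed.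

Lemma standard_cvg (x : R) : 0 < 1 + g * x ->
  (fun n => n%:R * pr P [set w | x < standard n w]) @ \oo --> gpd g x.
Proof.
move=> x0; have h := @tail_cvg _ _ _ _ X g c l Hatt _ x0.
apply: cvg_trans h; apply: near_eq_cvg; near=> n.
have cn : 0 < c n by near: n; exact: (attraction_scale_gt0 g0 Hatt).
rewrite /tail; congr (_ * pr P _); apply/funext => w /=.
by rewrite /standard ltr_pdivlMr// ltrBrDl mulrC.
Unshelve. all: by end_near. Qed.

Lemma min_step (x D : R) (n : nat) : 0 < D ->
  Num.min (Num.max 0 x) (n%:R * D) + D * (n.+1%:R * D < x)%R%:R
    <= Num.min (Num.max 0 x) (n.+1%:R * D) <=
  Num.min (Num.max 0 x) (n%:R * D) + D * (n%:R * D < x)%R%:R.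
Proof.
move=> D0; rewrite mulrSr mulrDl mul1r.
have nD : 0 <= n%:R * D by rewrite mulr_ge0// ltW.
move: (n%:R * D) nD => z z0.
rewrite /Num.min /Num.max; apply/andP.
case: (ltP 0 x) => h0; case: (ltP z x) => h1; case: (ltP (z + D) x) => h2;
  rewrite /= ?mulr1n ?mulr0n ?mulr1 ?mulr0;
  by repeat (case: ifPn; rewrite -?leNgt => ?); split; lra.
Qed.

(** A truncated positive part lies between two sums of indicators with mesh [D], so its mean is read
    off tail probabilities at finitely many points. *)
Lemma staircase (x D : R) (n : nat) : 0 < D ->
  D * (\sum_(i < n) (i.+1%:R * D < x)%R%:R) <= Num.min (Num.max 0 x) (n%:R * D) <=
  D * (\sum_(i < n) (i%:R * D < x)%R%:R).
Proof.
move=> D0; elim: n => [|n /andP[IH1 IH2]].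
  by rewrite !big_ord0 mulr0 mul0r min_r ?lexx// le_max lexx.
rewrite !big_ord_recr /= !mulrDr.
by have /andP[h1 h2] := min_step x n D0; apply/andP; split; lra.
Qed.

(** Integration of the tail through Riemann sums: the staircases bound the mean, and the tangent
    inequality places [gpd_int g L - gpd_int g 0] between the limits [S'] and [S] of the bounds. *)
Lemma cvg_truncated_mean (L : R) : g < 1 -> 0 < L ->
  (fun n => n%:R * mean P (fun w => Num.min (Num.max 0 (standard n w)) L)) @ \oo -->
  gpd_int g L - gpd_int g 0.
Proof.
move=> g1 L0; apply/cvgrPdist_lt => e e0.
near \oo => k.
have k0 : (0 < k)%N by near: k; exact: nbhs_infty_gt.
have k0' : 0 < k%:R :> R by rewrite ltr0n.
pose D := L / k%:R.
have D0 : 0 < D by rewrite divr_gt0.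
have De : D < e / 2.
  rewrite /D ltr_pdivrMr// mulrC -ltr_pdivrMr//; last by lra.
  by near: k; exact: nbhs_infty_gtr.
have LD : L = k%:R * D by rewrite mulrC divfK// gt_eqF.
have dom (i : nat) : 0 < 1 + g * (i%:R * D).
  by rewrite ltr_wpDr// mulr_ge0// mulr_ge0// ltW.
pose S := D * \sum_(i < k) gpd g (i%:R * D).
pose S' := D * \sum_(i < k) gpd g (i.+1%:R * D).
have hS : gpd_int g L - gpd_int g 0 <= S.
  rewrite /S LD mulr_sumr -[X in _ - gpd_int g X](mul0r D).
  rewrite -(telescope_sumr (fun i : nat => gpd_int g (i%:R * D)) (leq0n k)) big_mkord.
  apply: ler_sum => i _.
  apply: le_trans (gpd_int_tangent g0 g1 (dom i) (dom i.+1)) _.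
  by rewrite mulrSr mulrDl mul1r addrAC subrr add0r mulrC.
have hS' : S' <= gpd_int g L - gpd_int g 0.
  rewrite /S' LD mulr_sumr -[X in _ - gpd_int g X](mul0r D).
  rewrite -(telescope_sumr (fun i : nat => gpd_int g (i%:R * D)) (leq0n k)) big_mkord.
  apply: ler_sum => i _.
  have := gpd_int_tangent g0 g1 (dom i.+1) (dom i).
  rewrite [in X in X -> _](_ : i%:R * D - i.+1%:R * D = - D); first by lra.
  by rewrite mulrSr mulrDl mul1r; lra.
(* The difference telescopes to [D] times 1 - gpd g L. *)
have SS' : S - S' <= D.
  rewrite /S /S' -mulrBr -[leRHS]mulr1 ler_pM2l// -sumrB.
  rewrite -(big_mkord xpredT (fun i => gpd g (i%:R * D) - gpd g (i.+1%:R * D))).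
  have -> : \sum_(0 <= i < k) (gpd g (i%:R * D) - gpd g (i.+1%:R * D)) =
      - \sum_(0 <= i < k) (gpd g (i.+1%:R * D) - gpd g (i%:R * D)).
    by rewrite -sumrN; apply: eq_bigr => i _; rewrite opprB.
  rewrite (telescope_sumr (fun i : nat => gpd g (i%:R * D)) (leq0n k)) mul0r gpd0 opprB.
  by rewrite lerBlDr lerDl ltW// gpd_gt0.
have mind n (x : R) : measurable [set w | x < standard n w].
  by apply: measurable_set_lt => //; exact: measurable_standard.
have bsum (J : nat -> R) n : bmf (fun w => D * \sum_(i < k) (J i < standard n w)%R%:R).
  by apply: bmfZ; apply: bmf_sum => i; apply: bmf_bool.
have msum (J : nat -> R) n : mean P (fun w => D * \sum_(i < k) (J i < standard n w)%R%:R) =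
    D * \sum_(i < k) pr P [set w | J i < standard n w].
  rewrite meanZ; last by apply: bmf_sum => i; apply: bmf_bool.
  rewrite mean_sum; last by move=> i; apply: bmf_bool.
  by congr (_ * _); apply: eq_bigr => i _; rewrite mean_bool.
have btr n : bmf (fun w => Num.min (Num.max 0 (standard n w)) L).
  split.
    apply: measurable_minr => //; apply: measurable_maxr => //.
    exact: measurable_standard.
  exists L => w; rewrite ger0_norm; first by rewrite ge_min lexx orbT.
  by rewrite le_min (ltW L0) andbT le_max lexx.
have cs (J : nat -> R) : (forall i, 0 < 1 + g * J i) ->
    (fun n => D * \sum_(i < k) n%:R * pr P [set w | J i < standard n w]) @ \oo -->
    D * \sum_(i < k) gpd g (J i).
  move=> hJ; apply: cvgM; first exact: cvg_cst.
  by apply: cvg_big => [|i _]; [exact: add_continuous|exact: standard_cvg].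
have c1 : \forall n \near \oo,
    D * (\sum_(i < k) n%:R * pr P [set w | i%:R * D < standard n w]) < S + e / 2.
  by apply: (cvgr_lt _ (cs _ dom)); rewrite ltrDl divr_gt0.
have c2 : \forall n \near \oo,
    S' - e / 2 < D * \sum_(i < k) n%:R * pr P [set w | i.+1%:R * D < standard n w].
  apply: (cvgr_gt _ (cs (fun i => i.+1%:R * D) (fun i => dom i.+1))).
  by rewrite ltrBlDr ltrDl divr_gt0.
near=> n.
have d1 : D * (\sum_(i < k) n%:R * pr P [set w | i%:R * D < standard n w]) < S + e / 2.
  by near: n.
have d2 : S' - e / 2 < D * \sum_(i < k) n%:R * pr P [set w | i.+1%:R * D < standard n w].
  by near: n.
have u1 : n%:R * mean P (fun w => Num.min (Num.max 0 (standard n w)) L) <=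
    D * (\sum_(i < k) n%:R * pr P [set w | i%:R * D < standard n w]).
  rewrite -mulr_sumr mulrCA ler_wpM2l// -(msum (fun i => i%:R * D)).
  apply: (le_mean _ (btr n) (bsum (fun i => i%:R * D) n)) => w; rewrite LD.
  by have /andP[] := staircase (standard n w) k D0.
have u2 : D * (\sum_(i < k) n%:R * pr P [set w | i.+1%:R * D < standard n w]) <=
    n%:R * mean P (fun w => Num.min (Num.max 0 (standard n w)) L).
  rewrite -mulr_sumr mulrCA ler_wpM2l// -(msum (fun i => i.+1%:R * D)).
  apply: (le_mean _ (bsum (fun i => i.+1%:R * D) n) (btr n)) => w; rewrite LD.
  by have /andP[] := staircase (standard n w) k D0.
rewrite distrC ltr_distl; apply/andP; split; lra.
Unshelve. all: by end_near. Qed.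

End attraction_moments.

(** * Excesses of X over a high level *)

Section excess.
Context d (T : measurableType d) (R : realType) (P : probability T R).
Variables (X : {RV P >-> R}) (g : R) (c l : nat -> R).
Hypothesis g0 : 0 <= g.
Hypothesis g1 : g < 1.
Hypothesis Hatt : in_domain_of_attraction X g c l.
Hypothesis l_homo : forall m n, (2 <= m <= n)%N -> l m <= l n.
Hypothesis end_infty : g = 0 -> forall x : R, (cdf X x < 1)%E.

(** [rho] is the midpoint between 2^g, the limit of c(2n) / c(n), and 2. As [g < 1], it bounds that
    ratio eventually while [rho / 2 < 1] makes the dyadic series below geometric. [C] exceeds the
    limiting increment of the location under doubling. *)
Let rho : R := (2 `^ g + 2) / 2.
Let C : R := gpd_quantile g 2 + 1.

Let rho_gt1 : 1 <= rho.
Proof.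
have : 1 <= (2:R) `^ g by have := @ler_powR R 2 (ler1n R 2) 0 g g0; rewrite powRr0.
by rewrite /rho; lra.
Qed.

Let pow2_lt : (2:R) `^ g < 2.
Proof.
rewrite /powR gt_eqF// -[ltRHS]lnK ?posrE// ltr_expR gtr_pMl// ln_gt0//.
by rewrite ltr1n.
Qed.

Let rho_lt2 : rho < 2.
Proof. by have := pow2_lt; rewrite /rho; lra. Qed.

Let C_gt0 : 0 < C.
Proof. by rewrite /C addr_gt0// gpd_quantile2_gt0. Qed.

Let doubling (n : nat) : Prop := [/\ (2 <= n)%N, 0 < c n, c (2 * n)%N <= rho * c n,
  l (2 * n)%N - l n <= C * c n & n%:R * tail X (l n) <= 2].

Let near_doubling : \forall n \near \oo, doubling n.
Proof.
have [dc dl] := double_cvg g0 Hatt.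
have A : \forall n \near \oo, c (2 * n)%N / c n < rho.
  by apply: (cvgr_lt _ dc); have := pow2_lt; rewrite /rho; lra.
have B : \forall n \near \oo, (l (2 * n)%N - l n) / c n < C.
  by apply: (cvgr_lt _ dl); rewrite /C ltrDl.
have D : \forall n \near \oo, n%:R * tail X (l n) < 2.
  by apply: (cvgr_lt _ (tail_location Hatt)); rewrite ltr1n.
near=> n.
have cn : 0 < c n by near: n; exact: (attraction_scale_gt0 g0 Hatt).
split=> //.
- by near: n; exact: nbhs_infty_ge.
- by rewrite -ler_pdivrMr// ltW//; near: n.
- by rewrite -ler_pdivrMr// ltW//; near: n.
- by apply: ltW; near: n.
Unshelve. all: by end_near. Qed.

Section dyadic.
Variables (N0 : nat).
Hypothesis HN : forall n, (N0 <= n)%N -> doubling n.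

Let geN (n j : nat) : (N0 <= n)%N -> (N0 <= 2 ^ j * n)%N.
Proof. by move=> h; rewrite (leq_trans h)// leq_pmull// expn_gt0. Qed.

Let scale_dyadic n j : (N0 <= n)%N -> c (2 ^ j * n)%N <= rho ^+ j * c n.
Proof.
move=> nN; elim: j => [|j IH]; first by rewrite expn0 mul1n mul1r.
have [_ _ h _ _] := HN (geN j nN).
rewrite expnS -mulnA exprS -mulrA (le_trans h)// ler_wpM2l//.
by rewrite (le_trans ler01).
Qed.

Let location_dyadic n j : (N0 <= n)%N ->
  l (2 ^ j * n)%N - l n <= \sum_(0 <= i < j) C * c (2 ^ i * n)%N.
Proof.
move=> nN; elim: j => [|j IH]; first by rewrite expn0 mul1n subrr big_nil.
have [_ _ _ h _] := HN (geN j nN).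
by rewrite big_nat_recr//= expnS -mulnA; lra.
Qed.

(** The excess of [x] over [l n] is paid for by the increments between consecutive dyadic levels,
    each charged only if [x] has passed the lower one. *)
Let excess_dyadic n j (x : R) : (N0 <= n)%N -> x <= l (2 ^ j * n)%N ->
  Num.max 0 (x - l n) <=
    \sum_(0 <= i < j) C * c (2 ^ i * n)%N * (l (2 ^ i * n)%N < x)%R%:R.
Proof.
move=> nN; elim: j => [|j IH] xl.
  by rewrite big_nil ge_max lexx subr_le0; rewrite expn0 mul1n in xl.
have [lx|lx] := leP x (l (2 ^ j * n)%N).
  rewrite big_nat_recr//= (le_trans (IH lx))// lerDl mulr_ge0// mulr_ge0 ?(ltW C_gt0)//.
  by have [_ /ltW] := HN (geN j nN).
have E : \sum_(0 <= i < j.+1) C * c (2 ^ i * n)%N * (l (2 ^ i * n)%N < x)%R%:R =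
    \sum_(0 <= i < j.+1) C * c (2 ^ i * n)%N.
  rewrite !big_mkord; apply: eq_bigr => i _.
  rewrite (_ : (l _ < x) = true) ?mulr1//; apply: le_lt_trans lx.
  have [n2 _ _ _ _] := HN (geN i nN).
  by apply: l_homo; rewrite n2 leq_mul2r leq_exp2l// -ltnS ltn_ord orbT.
have [n2 _ _ _ _] := HN nN.
have ln : l n <= l (2 ^ j * n)%N.
  by apply: l_homo; rewrite n2 leq_pmull// expn_gt0.
rewrite E max_r; last by rewrite subr_ge0 (le_trans ln)// ltW.
by apply: le_trans (location_dyadic j.+1 nN); rewrite lerB.
Qed.

Let K0 : R := 2 * C / (1 - rho / 2).

Let ratio_lt1 : rho / 2 < 1.
Proof. by rewrite ltr_pdivrMr// mul1r rho_lt2. Qed.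

Let ratio_ge0 : 0 <= rho / 2.
Proof. by rewrite divr_ge0// (le_trans ler01 rho_gt1). Qed.

(** The level l(2^j n) is exceeded with probability at most 2 / (2^j n), and the increment charged
    there is at most C rho^j c(n). The series has ratio [rho / 2], whence the constant [K0]. *)
Let excess_bound n : (N0 <= n)%N ->
  (n%:R%:E * uexp P (fun w => Num.max 0 (X w - l n))%R <= (K0 * c n)%:E)%E.
Proof.
move=> nN; have [n2 cn _ _ _] := HN nN.
have n0 : 0 < n%:R :> R by rewrite ltr0n ltnW.
pose f j w : R := C * c (2 ^ j * n)%N * (l (2 ^ j * n)%N < X w)%R%:R.
have f0 j w : 0 <= f j w.
  by have [_ ? _ _ _] := HN (geN j nN); rewrite mulr_ge0// mulr_ge0// ltW.
have bf j : bmf (f j) by apply: bmfZ; apply: bmf_bool; exact: measurable_gt.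
have step1 : (uexp P (fun w => Num.max 0 (X w - l n))%R <=
    \int[P]_w \sum_(0 <= j <oo) (f j w)%:E)%E.
  apply: ge0_le_integral => //.
  - by move=> w _; rewrite lee_fin le_max lexx.
  - by apply/measurable_EFinP; apply: measurable_maxr => //; exact: measurable_funB.
  - apply: ge0_emeasurable_sum => [j w _ _|j _]; first by rewrite lee_fin f0.
    by apply/measurable_EFinP; have [] := bf j.
  - move=> w _; have /cvgryPge/(_ (X w)) [j0 _ hj0] :=
      location_cvg g0 Hatt l_homo end_infty.
    have /hj0 xl : (j0 <= 2 ^ j0 * n)%N.
      rewrite (@leq_trans (2 ^ j0))//; first by rewrite ltnW// ltn_expl.
      by rewrite leq_pmulr// ltnW.
    apply: (@le_trans _ _ (\sum_(0 <= j < j0) (f j w)%:E)%E).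
      by rewrite sumEFin lee_fin; apply: excess_dyadic.
    by apply: nneseries_lim_ge => j _; rewrite lee_fin.
apply: le_trans (lee_wpmul2l _ step1) _; first by rewrite lee_fin ltW.
rewrite integral_nneseries//; last 2 first.
- by move=> j; apply/measurable_EFinP; have [] := bf j.
- by move=> j w _; rewrite lee_fin f0.
rewrite -nneseriesZl//; last by move=> j _; exact: (uexp_ge0 P (f0 j)).
apply: lime_le.
  apply: is_cvg_nneseries => j _ _; rewrite mule_ge0 ?lee_fin ?(ltW n0)//.
  exact: (uexp_ge0 P (f0 j)).
apply: nearW => k.
apply: (@le_trans _ _ (\sum_(0 <= j < k) (2 * C * c n * (rho / 2) ^+ j)%:E)%E).
  apply: lee_sum => j _; rewrite -/(uexp P (f j)) (uexp_bmf P (bf j)).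
  rewrite meanZ; last by apply: bmf_bool; exact: measurable_gt.
  rewrite mean_bool; last exact: measurable_gt.
  rewrite -EFinM lee_fin -/(tail X _).
  have [_ _ _ _ h] := HN (geN j nN).
  have h2 := scale_dyadic j nN.
  have p0 : 0 < (2:R) ^+ j by rewrite exprn_gt0.
  have {}h : n%:R * tail X (l (2 ^ j * n)%N) <= 2 / 2 ^+ j.
    by rewrite ler_pdivlMr// -natrX mulrAC -natrM mulnC.
  rewrite expr_div_n.
  have -> : n%:R * (C * c (2 ^ j * n)%N * tail X (l (2 ^ j * n)%N)) =
      n%:R * tail X (l (2 ^ j * n)%N) * (C * c (2 ^ j * n)%N) by ring.
  apply: (@le_trans _ _ (2 / 2 ^+ j * (C * (rho ^+ j * c n)))).
    apply: ler_pM => //.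
    - by rewrite mulr_ge0// tail_ge0.
    - by have [_ ? _ _ _] := HN (geN j nN); rewrite mulr_ge0 ?(ltW C_gt0)// ltW.
    - by rewrite ler_wpM2l// ltW.
  by rewrite le_eqVlt; apply/orP; left; apply/eqP; ring.
rewrite sumEFin lee_fin -mulr_sumr big_mkord.
have r1 : 0 < 1 - rho / 2 by rewrite subr_gt0 ratio_lt1.
have -> : K0 * c n = 2 * C * c n * (1 - rho / 2)^-1 by rewrite /K0 mulrAC.
apply: ler_wpM2l; first by rewrite mulr_ge0 ?(ltW cn)// mulr_ge0 ?(ltW C_gt0).
have geo : (1 - rho / 2) * (\sum_(i < k) (rho / 2) ^+ i) = 1 - (rho / 2) ^+ k.
  by have := subrX1 (rho / 2) k; lra.
rewrite -(ler_pM2l r1) mulfV ?gt_eqF// geo gerBl.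
exact: (exprn_ge0 k ratio_ge0).
Qed.

(** [excess_bound] at index 2^J n. That level lies at most C J 2^J scale units above [l n]; the
    change of index contributes 2^(-J) and the change of scale at most rho^J. *)
Let excess_shift n J : (N0 <= n)%N ->
  (n%:R%:E * uexp P (fun w => Num.max 0 (standard X c l n w - (C * (J%:R * 2 ^+ J))))%R
    <= (K0 * (rho / 2) ^+ J)%:E)%E.
Proof.
move=> nN; have [n2 cn _ _ _] := HN nN.
pose k := (2 ^ J * n)%N; have kN : (N0 <= k)%N := geN J nN.
have [k2 ck _ _ _] := HN kN.
have p2 : 0 < (2:R) ^+ J by rewrite exprn_gt0.
have lk : l k - l n <= C * (J%:R * 2 ^+ J) * c n.
  apply: le_trans (location_dyadic J nN) _; rewrite big_mkord.
  apply: (@le_trans _ _ (\sum_(i < J) C * (2 ^+ J * c n))).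
    apply: ler_sum => i _; rewrite ler_wpM2l ?(ltW C_gt0)//.
    apply: le_trans (scale_dyadic i nN) _; rewrite ler_wpM2r ?(ltW cn)//.
    apply: (@le_trans _ _ (2 ^+ i)).
      by rewrite lerXn2r ?nnegrE ?(ltW rho_lt2)// (le_trans ler01).
    by rewrite ler_weXn2l ?ler1n// ltnW.
  rewrite sumr_const card_ord -mulr_natl.
  by rewrite le_eqVlt; apply/orP; left; apply/eqP; ring.
have mX : measurable_fun setT (fun w => Num.max 0 (X w - l k)).
  by apply: measurable_maxr => //; exact: measurable_funB.
have E : (uexp P (fun w => Num.max 0 (standard X c l n w - (C * (J%:R * 2 ^+ J))))%R <=
    uexp P (fun w => (c n)^-1 * Num.max 0 (X w - l k))%R)%E.
  apply: le_uexp.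
  - by apply: measurable_maxr => //; apply: measurable_funB => //; exact: measurable_standard.
  - by apply: measurable_funM.
  - move=> w; rewrite le_max lexx /=.
    rewrite -(ler_pM2l cn) mulVKf ?gt_eqF// maxr_pMr ?(ltW cn)// mulr0.
    rewrite ge_max !le_max lexx /=; apply/orP; right.
    by rewrite mulrBr mulrC divfK ?gt_eqF//; lra.
apply: le_trans (lee_wpmul2l _ E) _; first by rewrite lee_fin.
rewrite uexpZ//; last 2 first.
- by move=> w; rewrite le_max lexx.
- by rewrite invr_ge0 ltW.
rewrite muleA -EFinM.
have -> : n%:R / c n = ((2 ^+ J) * c n)^-1 * k%:R.
  rewrite /k natrM natrX invfM -mulrA mulrCA mulrA mulrC -!mulrA mulKf ?gt_eqF//.
rewrite EFinM -muleA.
apply: le_trans (lee_wpmul2l _ (excess_bound kN)) _.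
  by rewrite lee_fin invr_ge0 mulr_ge0 ?ltW.
rewrite -EFinM lee_fin.
rewrite ler_pdivrMl ?mulr_gt0// expr_div_n.
have -> : 2 ^+ J * c n * (K0 * (rho ^+ J / 2 ^+ J)) = K0 * (rho ^+ J * c n).
  by move: (2 ^+ J) (rho ^+ J) (gt_eqF p2) => q r /negbT qn; field.
apply: ler_wpM2l; last exact: scale_dyadic.
by rewrite /K0 divr_ge0// ?mulr_ge0 ?(ltW C_gt0)// subr_ge0 ltW// ratio_lt1.
Qed.

Lemma excess_dyadic_small (e : R) : 0 < e -> exists L : R, 0 < L /\
  forall n, (N0 <= n)%N ->
  (n%:R%:E * uexp P (fun w => Num.max 0 (standard X c l n w - L))%R <= e%:E)%E.
Proof.
move=> e0.
have h : (fun J => K0 * (rho / 2) ^+ J) @ \oo --> (0:R).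
  rewrite -[X in _ --> X](mulr0 K0); apply: cvgM; first exact: cvg_cst.
  by apply: cvg_expr; rewrite ger0_norm// ratio_lt1.
have h2 : \forall J \near \oo, K0 * (rho / 2) ^+ J < e by apply: (cvgr_lt _ h).
near \oo => J.
have J0 : (0 < J)%N by near: J; exact: nbhs_infty_gt.
exists (C * (J%:R * 2 ^+ J)); split.
  by rewrite mulr_gt0 ?C_gt0// mulr_gt0 ?ltr0n// exprn_gt0.
move=> n nN; apply: le_trans (excess_shift J nN) _.
by rewrite lee_fin ltW//; near: J.
Unshelve. all: by end_near. Qed.

End dyadic.

(** Uniform integrability of the positive part of the standardized variable. It is derived from the
    marginal law of X, because joint moments do not control [x] where [y] is small. *)
Lemma excess_small (e : R) : 0 < e -> exists L : R, 0 < L /\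
  \forall n \near \oo,
  (n%:R%:E * uexp P (fun w => Num.max 0 (standard X c l n w - L))%R <= e%:E)%E.
Proof.
move=> e0; have [N0 _ HN] := near_doubling.
have [L [L0 hL]] := excess_dyadic_small HN e0.
by exists L; split=> //; exists N0 => // n /=; exact: hL.
Qed.

End excess.

(** * Compactness and truncation in the extended reals *)

Section extended_reals.
Variable R : realType.

(** Balls of [\bar R] are measured after [contract], and [contract (expand r)] is [r] clipped to
    [-1, 1], which is 1-Lipschitz in [r]. *)
Lemma expand_continuous : continuous (@expand R).
Proof.
move=> r; apply/cvg_ballP => e e0; near=> s.
rewrite /ball /= /ereal_ball.
have [c1 [hc1 hc2]] : exists c : R -> R, (forall r, contract (expand r) = c r) /\
    (forall r s, `|c r - c s| <= `|r - s|).
  exists (fun r => Num.max (-1) (Num.min 1 r)); split.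
    clear; move=> r; have [r1|r1] := leP 1 r.
      by rewrite expand1// max_r//; lra.
    have [r2|r2] := leP (-1) r.
      by rewrite expandK// inE; rewrite ler_norml r2 ltW.
    by rewrite expandN1// ltW.
  clear; move=> r s; have := ler_norm (s - r); rewrite -normrN opprB.
  have := ler_norm (r - s); rewrite ler_norml /Num.max /Num.min => *.
  apply/andP; case: (ltP 1 r) => ?; case: (ltP 1 s) => ?;
  by repeat (case: ifPn; rewrite -?leNgt => ?); split; lra.
rewrite !hc1; apply: le_lt_trans (hc2 r s) _.
by near: s; apply: (@cvgr_dist_lt _ R _ (nbhs r) _ id r) => //; exact: cvg_id.
Unshelve. all: by end_near. Qed.

Lemma compact_ereal : compact [set: \bar R].
Proof.
rewrite (_ : [set: \bar R] = @expand R @` `[-1, 1]%classic).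
  apply: continuous_compact; last exact: segment_compact.
  by apply: continuous_subspaceT; exact: expand_continuous.
apply/seteqP; split=> // x _; exists (contract x); last exact: contractK.
by have := contract_le1 x; rewrite ler_norml /= in_itv.
Qed.

Definition clamp (lo hi x : R) : R := Num.max lo (Num.min hi x).

(** Constant near each infinity, hence continuous on [\bar R]. Composing real functions with it
    produces continuous test functions on the extended plane. *)
Definition eclamp (lo hi : R) (x : \bar R) : R :=
  fine (maxe lo%:E (mine hi%:E x)).

Lemma eclampE lo hi x : eclamp lo hi x%:E = clamp lo hi x.
Proof. by rewrite /eclamp -EFin_min -EFin_max. Qed.

Lemma clamp_continuous lo hi : continuous (clamp lo hi).
Proof.
move=> x; apply: continuous_max; first exact: cvg_cst.
by apply: continuous_min => //; exact: cvg_cst.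
Qed.

Lemma clamp_itv lo hi x : lo <= hi -> lo <= clamp lo hi x <= hi.
Proof. by move=> h; rewrite /clamp le_max lexx ge_max h ge_min lexx. Qed.

Lemma eclamp_itv lo hi x : lo <= hi -> lo <= eclamp lo hi x <= hi.
Proof.
move=> h; case: x => [r| |]; first by rewrite eclampE clamp_itv.
  by rewrite /eclamp min_l ?leey// -EFin_max /= max_r// h lexx.
by rewrite /eclamp min_r ?leNye// max_l ?leNye//= h lexx.
Qed.

Lemma eclamp_lo lo hi x : lo <= hi -> (x <= lo%:E)%E -> eclamp lo hi x = lo.
Proof.
move=> h; case: x => [r| //|] .
  by rewrite lee_fin eclampE /clamp => rl; rewrite max_l// ge_min rl orbT.
by rewrite /eclamp min_r ?leNye// max_l ?leNye.
Qed.

Lemma eclamp_hi lo hi x : lo <= hi -> (hi%:E <= x)%E -> eclamp lo hi x = hi.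
Proof.
move=> h; case: x => [r| |//] .
  by rewrite lee_fin eclampE /clamp => rl; rewrite min_l// max_r.
by rewrite /eclamp min_l ?leey// -EFin_max /= max_r.
Qed.

Lemma eclamp_continuous lo hi : lo <= hi -> continuous (eclamp lo hi).
Proof.
move=> h [r| |].
- have hc := @clamp_continuous lo hi r.
  move=> A; rewrite eclampE => hA.
  have : \forall x \near r, A (clamp lo hi x) by exact: (hc A hA).
  by apply: filterS => x; rewrite /= eclampE.
- move=> A; rewrite eclamp_hi ?leey// => /nbhs_singleton Ahi.
  have : \forall x \near (+oo%E : \bar R), (hi%:E <= x)%E.
    by apply: ereal_nbhs_pinfty_ge; rewrite num_real.
  by apply: filterS => x hx /=; rewrite eclamp_hi.
- move=> A; rewrite eclamp_lo ?leNye// => /nbhs_singleton Alo.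
  have : \forall x \near (-oo%E : \bar R), (x <= lo%:E)%E.
    by apply: ereal_nbhs_ninfty_le; rewrite num_real.
  by apply: filterS => x hx /=; rewrite eclamp_lo.
Qed.

Lemma measurable_eclamp lo hi : measurable_fun setT (eclamp lo hi).
Proof.
apply: (@measurableT_comp _ _ _ _ _ _ (@fine R)); first exact: fine_measurable.
apply: measurable_maxe => //; exact: measurable_mine.
Qed.

End extended_reals.

(** * Vague convergence *)

Section tail_quantile_monotone.
Context d (T : measurableType d) (R : realType) (P : probability T R).
Variable X : {RV P >-> R}.

Lemma tail_quantileE (t : R) : 0 < t ->
  [set x : R | (t%:E <= (1 - cdf X x)^-1)%E] = [set x | t * tail X x <= 1].
Proof.
move=> t0; apply/seteqP; split=> x /=; rewrite cdfE -EFinB opprB addrC subrK.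
  have [->|tn0] := eqVneq (tail X x) 0; first by rewrite mulr0 ler01.
  have tp : 0 < tail X x by rewrite lt_neqAle eq_sym tn0 tail_ge0.
  by rewrite inver (negbTE tn0) lee_fin -[_^-1]mul1r ler_pdivlMr.
have [->|tn0] := eqVneq (tail X x) 0; first by rewrite inver eqxx leey.
have tp : 0 < tail X x by rewrite lt_neqAle eq_sym tn0 tail_ge0.
by rewrite inver (negbTE tn0) lee_fin -[_^-1]mul1r ler_pdivlMr.
Qed.

(** A smaller level defines a larger set, hence a smaller infimum. The condition [1 < s] makes that
    set bounded below: near -oo the distribution function is under 1 - 1/s. *)
Lemma tail_quantile_homo (s t : R) : 1 < s -> s <= t ->
  tail_quantile X s <= tail_quantile X t.
Proof.
move=> s1 st; have s0 : 0 < s by exact: lt_trans s1.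
have t0 : 0 < t by exact: lt_le_trans st.
rewrite /tail_quantile /generalized_inverse !tail_quantileE//.
apply: lb_le_inf.
  have /fine_cvgP[_ h] := cvg_cdfy1 X.
  have : \forall x \near +oo, 1 - t^-1 < fine (cdf X x).
    by apply: (cvgr_gt _ h); rewrite gtrBl invr_gt0.
  move=> /filter_ex [x]; rewrite cdfE /= ltrD2l ltrN2 => hx.
  exists x; rewrite /= mulrC -ler_pdivlMr// mul1r.
  exact: ltW.
have /fine_cvgP[_ h] := cvg_cdfNy0 X.
have : \forall x \near -oo, fine (cdf X x) < 1 - s^-1.
  by apply: (cvgr_lt _ h); rewrite subr_gt0 invf_lt1.
move=> /filter_ex [x0]; rewrite cdfE /= ltrD2l ltrN2 => hx.
move=> x /= tx; apply: ge_inf.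
  exists x0 => y /= sy; rewrite leNgt; apply/negP => yx.
  have : s * tail X x0 <= 1.
    by apply: le_trans sy; rewrite ler_wpM2l ?(ltW s0)// tail_le// ltW.
  by rewrite leNgt -ltr_pdivrMl// mulr1 hx.
by apply: le_trans tx; rewrite ler_wpM2r// tail_ge0.
Qed.

End tail_quantile_monotone.

Section vague.
Context d (T : measurableType d) (R : realType) (P : probability T R).
Variables (X Y : {RV P >-> R}) (g : R) (a m psi : R -> R).
Variable nu : {measure set (\bar R * \bar R) -> \bar R}.
Hypothesis H1 : extreme_assumption X Y g a m psi nu.

Let b := tail_quantile X.

Definition x_std (n : nat) (w : T) : R := (X w - b n%:R) / psi (b n%:R).
Definition y_std (n : nat) (w : T) : R := (Y w - m (b n%:R)) / a (b n%:R).

Lemma measurable_x_std n : measurable_fun setT (x_std n).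
Proof. by apply: measurable_funM => //; apply: measurable_funB. Qed.

Lemma measurable_y_std n : measurable_fun setT (y_std n).
Proof. by apply: measurable_funM => //; apply: measurable_funB. Qed.

Lemma b_homo_nat (i j : nat) : (2 <= i <= j)%N -> b i%:R <= b j%:R.
Proof.
by move=> /andP[i2 ij]; apply: tail_quantile_homo; rewrite ?ltr1n ?ler_nat.
Qed.

Lemma x_std_cvg (x : R) : 0 < 1 + g * x ->
  (fun n => n%:R * pr P [set w | x < x_std n w]) @ \oo --> gpd g x.
Proof. exact: (standard_cvg (index_ge0 H1) (X_attracted H1)). Qed.

Lemma measurable_ev_space : measurable (ev_space g : set (\bar R * \bar R)).
Proof.
rewrite (_ : ev_space g = [set x : \bar R | (- g%:E^-1 < x)%E] `*` setT).
  by apply: measurableX => //; rewrite -[X in measurable X]setTI; exact: emeasurable_fun_o_infty.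
by apply/seteqP; split=> z /=; [move=> ?; split|case].
Qed.

Section test_functions.
Variables (dl : R) (f : \bar R * \bar R -> R) (K : R).
Hypothesis gd : g * dl < 1.
Hypotheses (fc : continuous f) (f0 : forall z, 0 <= f z <= K).
Hypothesis fs : forall z, (z.1 <= (- dl)%:E)%E -> f z = 0.
Hypothesis mf : measurable_fun setT f.

Let half := [set z : \bar R * \bar R | ((- dl)%:E <= z.1)%E].

Let half_compact : compact half.
Proof.
rewrite (_ : half = [set x : \bar R | ((- dl)%:E <= x)%E] `*` setT); last first.
  by apply/seteqP; split=> z /=; [move=> ?; split|case].
apply: compact_setX; last exact: compact_ereal.
apply: (subclosed_compact _ (@compact_ereal R)) => //.
exact: closed_ereal_le_ereal.
Qed.

Lemma neg_in_ev_space : (- g%:E^-1 < (- dl)%:E)%E.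
Proof.
rewrite EFinN lteN2 inver; case: eqP => [_|/eqP gn]; first by rewrite ltry.
have gp : 0 < g by rewrite lt_neqAle eq_sym gn (index_ge0 H1).
by rewrite lte_fin -[ltRHS]mul1r ltr_pdivlMr// mulrC.
Qed.

Let half_sub : half `<=` ev_space g.
Proof. by move=> z /=; exact: lt_le_trans neg_in_ev_space. Qed.

Lemma test_integral_fin : (\int[nu]_(z in ev_space g) (f z)%:E)%E \is a fin_num.
Proof.
have [_ h] := nu_radon H1.
have hf := h _ half_compact half_sub.
have mh : measurable half.
  rewrite (_ : half = [set x : \bar R | ((- dl)%:E <= x)%E] `*` setT); last first.
    by apply/seteqP; split=> z /=; [move=> ?; split|case].
  by apply: measurableX => //; rewrite -[X in measurable X]setTI; exact: emeasurable_fun_c_infty.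
rewrite ge0_fin_numE; last by apply: integral_ge0 => z _; rewrite lee_fin; have /andP[] := f0 z.
apply: (@le_lt_trans _ _ (\int[nu]_(z in ev_space g) (K%:E * (\1_half z)%:E))%E).
  apply: ge0_le_integral => //.
  - exact: measurable_ev_space.
  - by move=> z _; rewrite lee_fin; have /andP[] := f0 z.
  - by apply: measurable_funTS; apply/measurable_EFinP.
  - apply: measurable_funTS; apply: measurable_funeM.
    by apply/measurable_EFinP; exact: measurable_indic.
  - move=> z _; rewrite -EFinM lee_fin indicE.
    have [zh|] := boolP (z \in half); first by rewrite mulr1; have /andP[] := f0 z.
    rewrite notin_setE /half /= => /negP; rewrite -ltNge => /ltW /fs ->.
    by rewrite mulr0.
have K0 : 0 <= K by have /andP[h1 h2] := f0 (0%E, 0%E); exact: le_trans h2.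
have mE : measurable (ev_space g : set (\bar R * \bar R)) by exact: measurable_ev_space.
have mi : measurable_fun (ev_space g) (EFin \o (\1_half : \bar R * \bar R -> R)).
  by apply: measurable_funTS; apply/measurable_EFinP; exact: measurable_indic.
rewrite ge0_integralZl//.
rewrite integral_indic//.
apply: lte_mul_pinfty => //.
apply: le_lt_trans hf; apply: le_measure; rewrite ?inE//; first exact: measurableI.
Qed.

Let fr n w : R := f ((x_std n w)%:E, (y_std n w)%:E).

Let bmf_fr n : bmf (fr n).
Proof.
split.
  apply: (measurableT_comp mf).
  by apply: measurable_fun_pair; apply/measurable_EFinP;
    [exact: measurable_x_std|exact: measurable_y_std].
by exists K => w; have /andP[? ?] := f0 ((x_std n w)%:E, (y_std n w)%:E); rewrite ger0_norm.
Qed.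

Let rescaled_integral n :
  (\int[rescaled_measure X Y a m psi n]_(z in ev_space g) (f z)%:E)%E =
  (n%:R * mean P (fr n))%:E.
Proof.
have mE : measurable (ev_space g : set (\bar R * \bar R)) by exact: measurable_ev_space.
have f0' z : 0 <= f z by have /andP[] := f0 z.
rewrite ge0_integral_mscale//; last 2 first.
- by apply: measurable_funTS; apply/measurable_EFinP.
- by move=> z _; rewrite lee_fin.
rewrite EFinM; congr (_ * _)%E.
rewrite ge0_integral_pushforward//; last 2 first.
- by apply: measurable_funTS; apply/measurable_EFinP.
- by move=> z _; rewrite lee_fin.
rewrite -uexp_bmf// /uexp integral_mkcond; apply: eq_integral => w _.
rewrite /patch; case: ifPn => //; rewrite notin_setE /= => h.
rewrite /fr fs//= leNgt; apply/negP => h2; apply: h.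
exact: lt_trans neg_in_ev_space _.
Qed.

(** The support of [f] lies in the half plane x >= - dl, which is compact because infinite points
    are included; so [f] is an admissible test function without any decay at infinity. *)
Lemma test_cvg :
  (fun n => n%:R * mean P (fun w => f ((x_std n w)%:E, (y_std n w)%:E))) @ \oo -->
  fine (\int[nu]_(z in ev_space g) (f z)%:E)%E.
Proof.
have fE : {within ev_space g, continuous f} by exact: continuous_subspaceT.
have := rescaled_cvg H1 fE.
rewrite -(fineK test_integral_fin) => h.
have {}h := h _.
have /h /fine_cvgP[_] : exists K0, [/\ compact K0, K0 `<=` ev_space g & forall z, ~ K0 z -> f z = 0].
  exists half; split=> // z /negP; rewrite /half /= -ltNge => /ltW; exact: fs.
apply: cvg_trans; apply: near_eq_cvg; near=> n.
by rewrite /= rescaled_integral.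
Unshelve. all: by end_near. Qed.

End test_functions.
End vague.

(** * Portmanteau bounds and absence of mass at infinity *)

Section portmanteau.
Context d (T : measurableType d) (R : realType) (P : probability T R).
Variables (X Y : {RV P >-> R}) (g : R) (a m psi : R -> R).
Variable nu : {measure set (\bar R * \bar R) -> \bar R}.
Hypothesis H1 : extreme_assumption X Y g a m psi nu.

Notation xs := (x_std X psi).
Notation ys := (y_std X Y a m).
Notation E := (ev_space g : set (\bar R * \bar R)).

(** With [u lo1 = 0] and [- dl <= lo1], such a product vanishes left of - dl and is an admissible
    test function. *)
Definition product_fun (u v : R -> R) (lo1 hi1 lo2 hi2 : R) (z : \bar R * \bar R) : R :=
  u (eclamp lo1 hi1 z.1) * v (eclamp lo2 hi2 z.2).

Section product_tests.
Variables (dl lo1 hi1 lo2 hi2 K1 K2 : R) (u v : R -> R).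
Hypotheses (gd : g * dl < 1) (dlo : - dl <= lo1).
Hypotheses (lh1 : lo1 <= hi1) (lh2 : lo2 <= hi2).
Hypotheses (uc : continuous u) (vc : continuous v).
Hypotheses (u0 : forall x, lo1 <= x <= hi1 -> 0 <= u x <= K1)
           (v0 : forall x, lo2 <= x <= hi2 -> 0 <= v x <= K2).
Hypothesis ulo : u lo1 = 0.

Lemma product_fun_itv z : 0 <= product_fun u v lo1 hi1 lo2 hi2 z <= K1 * K2.
Proof.
have /andP[h1 h2] := u0 (eclamp_itv z.1 lh1).
have /andP[h3 h4] := v0 (eclamp_itv z.2 lh2).
by rewrite /product_fun mulr_ge0//= ler_pM.
Qed.

Lemma product_fun_continuous : continuous (product_fun u v lo1 hi1 lo2 hi2).
Proof.
move=> z; apply: cvgM.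
  apply: (@continuous_comp _ _ _ (fun z : \bar R * \bar R => eclamp lo1 hi1 z.1) u z).
    apply: (@continuous_comp _ _ _ fst (eclamp lo1 hi1) z); first exact: cvg_fst.
    exact: eclamp_continuous.
  exact: uc.
apply: (@continuous_comp _ _ _ (fun z : \bar R * \bar R => eclamp lo2 hi2 z.2) v z).
  apply: (@continuous_comp _ _ _ snd (eclamp lo2 hi2) z); first exact: cvg_snd.
  exact: eclamp_continuous.
exact: vc.
Qed.

Lemma measurable_product_fun : measurable_fun setT (product_fun u v lo1 hi1 lo2 hi2).
Proof.
apply: measurable_funM.
  apply: (measurableT_comp (continuous_measurable_fun uc)).
  exact: (measurableT_comp (@measurable_eclamp R lo1 hi1)).
apply: (measurableT_comp (continuous_measurable_fun vc)).
exact: (measurableT_comp (@measurable_eclamp R lo2 hi2)).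
Qed.

Lemma product_fun_supp z : (z.1 <= (- dl)%:E)%E -> product_fun u v lo1 hi1 lo2 hi2 z = 0.
Proof.
move=> h; rewrite /product_fun eclamp_lo ?ulo ?mul0r//.
by rewrite (le_trans h)// lee_fin.
Qed.

Lemma product_fun_fin :
  (\int[nu]_(z in E) (product_fun u v lo1 hi1 lo2 hi2 z)%:E)%E \is a fin_num.
Proof.
exact: (test_integral_fin H1 gd product_fun_itv product_fun_supp measurable_product_fun).
Qed.

Lemma product_cvg :
  (fun n => n%:R * mean P (fun w => u (clamp lo1 hi1 (xs n w)) * v (clamp lo2 hi2 (ys n w))))
    @ \oo --> fine (\int[nu]_(z in E) (product_fun u v lo1 hi1 lo2 hi2 z)%:E)%E.
Proof.
have := test_cvg H1 gd product_fun_continuous product_fun_itv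
  product_fun_supp measurable_product_fun.
apply: cvg_trans; apply: near_eq_cvg; near=> n; congr (_ * mean P _); apply/funext => w.
by rewrite /product_fun !eclampE.
Unshelve. all: by end_near. Qed.

Lemma bmf_product n : bmf (fun w => u (clamp lo1 hi1 (xs n w)) * v (clamp lo2 hi2 (ys n w))).
Proof.
apply: bmfM; split.
- apply: (measurableT_comp (continuous_measurable_fun uc)).
  apply: (measurableT_comp (continuous_measurable_fun (@clamp_continuous R lo1 hi1))).
  exact: measurable_x_std.
- exists K1 => w; have /u0/andP[h1 h2] := clamp_itv (xs n w) lh1.
  by rewrite ger0_norm.
- apply: (measurableT_comp (continuous_measurable_fun vc)).
  apply: (measurableT_comp (continuous_measurable_fun (@clamp_continuous R lo2 hi2))).
  exact: measurable_y_std.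
- exists K2 => w; have /v0/andP[h1 h2] := clamp_itv (ys n w) lh2.
  by rewrite ger0_norm.
Qed.

End product_tests.

Definition ramp (s t x : R) : R := (x - s) / (t - s).

Lemma ramp_continuous s t : continuous (ramp s t).
Proof.
by move=> x; apply: cvgM; [apply: cvgB; [exact: cvg_id|exact: cvg_cst]|exact: cvg_cst].
Qed.

Lemma ramp_itv s t x : s < t -> s <= x <= t -> 0 <= ramp s t x <= 1.
Proof.
move=> st /andP[sx xt]; have h : 0 < t - s by rewrite subr_gt0.
rewrite /ramp divr_ge0 ?subr_ge0// ?(le_trans sx)//=.
by rewrite ler_pdivrMr// mul1r lerD2r.
Qed.

Lemma ramp0 s t : ramp s t s = 0. Proof. by rewrite /ramp subrr mul0r. Qed.

Lemma ramp1 s t : s < t -> ramp s t t = 1.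
Proof. by move=> st; rewrite /ramp divff// subr_eq0 gt_eqF. Qed.

Lemma clamp_lo_lt (s t x : R) : s < t -> s < clamp s t x -> s < x.
Proof.
move=> st; rewrite /clamp lt_max ltxx /= lt_min => /andP[].
by [].
Qed.

Lemma ramp_gt0 (s t x : R) : s < t -> 0 < ramp s t (clamp s t x) -> s < x.
Proof.
move=> st; rewrite /ramp pmulr_lgt0 ?invr_gt0 ?subr_gt0//.
exact: clamp_lo_lt.
Qed.

Definition half_plane : set (\bar R * \bar R) := [set z | (0 <= z.1)%E].

Definition finite_half : set (\bar R * \bar R) :=
  [set z | (0 <= z.1 < +oo)%E /\ (-oo < z.2 < +oo)%E].

Lemma measurable_half_plane : measurable (half_plane : set (\bar R * \bar R)).
Proof.
rewrite (_ : (half_plane : set (\bar R * \bar R)) = [set x : \bar R | (0 <= x)%E] `*` setT); last first.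
  by apply/seteqP; split=> z /=; [move=> ?; split|case].
apply: measurableX => //; rewrite -[X in measurable X]setTI.
exact: emeasurable_fun_c_infty.
Qed.

Lemma measurable_finite_half : measurable (finite_half : set (\bar R * \bar R)).
Proof.
rewrite (_ : (finite_half : set (\bar R * \bar R)) = [set` `[0%E, +oo%E[ ] `*` [set` `]-oo%E, +oo%E[ ]).
  by apply: measurableX; exact: emeasurable_itv.
by apply/seteqP; split=> z /=; rewrite !in_itv /=.
Qed.

Lemma half_sub_ev : (half_plane : set (\bar R * \bar R)) `<=` E.
Proof.
move=> z; rewrite /half_plane /ev_space /=; apply: lt_le_trans.
have [dl [d0 gd _ _]] := gpd_near0 (index_ge0 H1) ltr01.
by apply: lt_trans (neg_in_ev_space H1 gd) _; rewrite lte_fin oppr_lt0.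
Qed.

(** The ramp in [x] equals 1 on x >= 0, so the test function dominates the indicator of [C], but it
    also charges the strip - dl < x <= 0. The scaled mass of that strip is small, since the marginal
    tails at - dl and at 0 both have limits within e / 4 of 1. *)
Lemma lower_bound_pre (e : R) (v : R -> R) (lo2 hi2 : R) (C : set (\bar R * \bar R))
    (D : set R) :
  0 < e -> lo2 <= hi2 -> continuous v ->
  (forall x, lo2 <= x <= hi2 -> 0 <= v x <= 1) ->
  measurable C -> C `<=` half_plane ->
  (forall z, C z -> v (eclamp lo2 hi2 z.2) = 1) ->
  measurable D -> (forall y, 0 < v (clamp lo2 hi2 y) -> D y) ->
  nu C \is a fin_num /\
  \forall n \near \oo, fine (nu C) - e < n%:R * pr P [set w | 0 < xs n w /\ D (ys n w)].
Proof.
move=> e0 lh vc v0 mC CF Cv mD vD.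
have e4 : 0 < e / 4 by lra.
have g0 := index_ge0 H1.
have [dl [d0 gd hd _]] := gpd_near0 g0 e4.
have lo : - dl < 0 by rewrite oppr_lt0.
have ru x : - dl <= x <= 0 -> 0 <= ramp (- dl) 0 x <= 1 by exact: ramp_itv.
pose f := product_fun (ramp (- dl) 0) v (- dl) 0 lo2 hi2.
have ffin := product_fun_fin gd (lexx _) (ltW lo) lh
  (@ramp_continuous (- dl) 0) vc ru v0 (ramp0 _ _).
have fcv := product_cvg gd (lexx _) (ltW lo) lh
  (@ramp_continuous (- dl) 0) vc ru v0 (ramp0 _ _).
have nuC : (nu C <= \int[nu]_(z in E) (f z)%:E)%E.
  have CE : C `&` E = C by apply/setIidPl => z /CF; exact: half_sub_ev.
  rewrite -[X in nu X]CE -integral_indic//; last exact: measurable_ev_space.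
  apply: ge0_le_integral => //.
  - exact: measurable_ev_space.
  - by apply: measurable_funTS; apply/measurable_EFinP; exact: measurable_indic.
  - apply: measurable_funTS; apply/measurable_EFinP.
    by apply: measurable_product_fun => //; exact: ramp_continuous.
  - move=> z _; rewrite lee_fin indicE; have [zC|_] := boolP (z \in C).
      rewrite inE in zC; rewrite /f /product_fun Cv// eclamp_hi ?ramp1 ?mulr1//.
        exact: ltW.
      exact: CF.
    by have /andP[] := product_fun_itv (ltW lo) lh ru v0 z.
have Cfin : nu C \is a fin_num.
  rewrite ge0_fin_numE ?measure_ge0//; apply: le_lt_trans nuC _.
  by rewrite -ge0_fin_numE// integral_ge0// => z _; rewrite lee_fin;
    have /andP[] := product_fun_itv (ltW lo) lh ru v0 z.
split=> //.
have dom0 : 0 < 1 + g * 0 by rewrite mulr0 addr0.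
have domd : 0 < 1 + g * (- dl) by lra.
have A : \forall n \near \oo, n%:R * pr P [set w | - dl < xs n w] < 1 + e / 4.
  by apply: (cvgr_lt _ (x_std_cvg H1 domd)).
have B : \forall n \near \oo, 1 - e / 4 < n%:R * pr P [set w | 0 < xs n w].
  by apply: (cvgr_gt _ (x_std_cvg H1 dom0)); rewrite gpd0; lra.
have G : \forall n \near \oo, fine (nu C) - e / 4 <
   n%:R * mean P (fun w => ramp (- dl) 0 (clamp (- dl) 0 (xs n w)) * v (clamp lo2 hi2 (ys n w))).
  apply: (cvgr_gt _ fcv); apply: (@lt_le_trans _ _ (fine (nu C))); first by rewrite gtrBl.
  by apply: fine_le.
near=> n.
have n0 : 0 <= n%:R :> R by [].
have m1 : measurable [set w | - dl < xs n w].
  by apply: measurable_set_lt => //; exact: measurable_x_std.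
have m2 : measurable [set w | 0 < xs n w].
  by apply: measurable_set_lt => //; exact: measurable_x_std.
have m3 : measurable [set w | D (ys n w)].
  by rewrite -[X in measurable X]setTI; exact: (measurable_y_std X Y a m n).
have m4 : measurable [set w | - dl < xs n w <= 0].
  rewrite (_ : [set w | _] = [set w | - dl < xs n w] `\` [set w | 0 < xs n w]).
    exact: measurableD.
  apply/seteqP; split=> w /=; first by move=> /andP[h1 h2]; split=> //; rewrite ltNge h2.
  by move=> [-> /negP]; rewrite -leNgt.
have m5 : measurable [set w | 0 < xs n w /\ D (ys n w)] by exact: measurableI.
have k1 : n%:R * pr P [set w | - dl < xs n w] < 1 + e / 4 by near: n.
have k2 : 1 - e / 4 < n%:R * pr P [set w | 0 < xs n w] by near: n.
have k3 : fine (nu C) - e / 4 <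
   n%:R * mean P (fun w => ramp (- dl) 0 (clamp (- dl) 0 (xs n w)) * v (clamp lo2 hi2 (ys n w))).
  by near: n.
have E1 : pr P [set w | - dl < xs n w] =
    pr P [set w | 0 < xs n w] + pr P [set w | - dl < xs n w <= 0].
  rewrite -pr_setU_disj//; last by move=> w /= h /andP[_]; rewrite leNgt h.
  congr pr; apply/seteqP; split=> w /=.
    by move=> h; have [h2|h2] := ltP 0 (xs n w); [left|right; rewrite h].
  by move=> [h|/andP[]//]; exact: lt_trans h.
have E2 : mean P (fun w => ramp (- dl) 0 (clamp (- dl) 0 (xs n w)) * v (clamp lo2 hi2 (ys n w)))
    <= pr P ([set w | 0 < xs n w /\ D (ys n w)] `|` [set w | - dl < xs n w <= 0]).
  set W := _ `|` _.
  have mW : measurable W by exact: measurableU.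
  have Wb : [set w | w \in W] = W by apply/seteqP; split=> w /=; rewrite inE.
  rewrite -[X in pr P X]Wb -mean_bool ?Wb//.
  apply: le_mean.
  - by apply: (bmf_product (ltW lo) lh) => //; [exact: ramp_continuous|exact: ru|exact: v0].
  - by apply: bmf_bool; rewrite Wb.
  - move=> w; have /ru/andP[r0 r1] := clamp_itv (xs n w) (ltW lo).
    have /v0/andP[v00 v1] := clamp_itv (ys n w) lh.
    have [//|wW] := boolP (w \in W); first by rewrite mulr_ile1.
    have [|r00] := ltP 0 (ramp (- dl) 0 (clamp (- dl) 0 (xs n w))); last first.
      by rewrite (_ : ramp _ _ _ = 0) ?mul0r//; apply/le_anti; rewrite r00 r0.
    move=> /(ramp_gt0 lo) xd.
    have [|v01] := ltP 0 (v (clamp lo2 hi2 (ys n w))); last first.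
      by rewrite (_ : v _ = 0) ?mulr0//; apply/le_anti; rewrite v01 v00.
    move=> /vD Dy; exfalso; move: wW => /negP; apply; rewrite inE.
    by have [h2|h2] := ltP 0 (xs n w); [left|right; rewrite /= xd].
have E3 := le_prU P m5 m4.
have {}E2 := ler_wpM2l n0 (le_trans E2 E3).
rewrite mulrDr in E2; rewrite E1 mulrDr in k1.
lra.
Unshelve. all: by end_near. Qed.

(** Case [v = 1] of [lower_bound_pre], compared with the limit 1 of n P(x > 0). *)
Lemma nu_half_le1 : (nu half_plane <= 1)%E.
Proof.
apply/lee_addgt0Pr => e e0.
have [hfin h] := @lower_bound_pre (e / 4) (fun=> 1) 0 0 half_plane setT ltac:(lra) (lexx _)
  (fun x => cvg_cst _) (fun _ _ => ltac:(by rewrite ler01 lexx)) measurable_half_plane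
  (fun z h => h) (fun _ _ => erefl) measurableT (fun _ _ => I).
have B : \forall n \near \oo, n%:R * pr P [set w | 0 < xs n w] < 1 + e / 4.
  have dom0 : 0 < 1 + g * 0 by rewrite mulr0 addr0.
  by apply: (cvgr_lt _ (x_std_cvg H1 dom0)); rewrite gpd0; lra.
near \oo => n.
have k1 : n%:R * pr P [set w | 0 < xs n w] < 1 + e / 4 by near: n.
have : fine (nu half_plane) - e / 4 < n%:R * pr P [set w | 0 < xs n w /\ setT (ys n w)].
  by near: n.
rewrite (_ : [set w | _ /\ _] = [set w | 0 < xs n w]); last first.
  by apply/seteqP; split=> w //= [].
rewrite -(fineK hfin) -EFinD lee_fin; lra.
Unshelve. all: by end_near. Qed.

(** The finite points already carry mass 1, and the whole half plane, infinite points included,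
    carries at most 1. *)
Lemma nu_infinite_half : nu (half_plane `\` finite_half) = 0%E.
Proof.
have FH : finite_half `<=` half_plane by move=> z [/andP[]].
have mF := measurable_finite_half; have mH := measurable_half_plane.
have mass : nu finite_half = 1%E := nu_mass H1.
have U : nu half_plane = (nu finite_half + nu (half_plane `\` finite_half))%E.
  rewrite -measureU//; first by rewrite setDUK.
  - exact: measurableD.
  - by apply/seteqP; split=> // z [h [_ /(_ h)]].
have := nu_half_le1; rewrite U mass -[X in (_ <= X)%E]adde0 leeD2lE// => h.
by apply/eqP; rewrite eq_le h measure_ge0.
Qed.

End portmanteau.

(** * Variation of the normalizing functions *)

Section conditional_limit.
Context d (T : measurableType d) (R : realType) (P : probability T R).
Variables (X Y : {RV P >-> R}) (g : R) (a m psi : R -> R).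
Variable nu : {measure set (\bar R * \bar R) -> \bar R}.
Hypothesis H1 : extreme_assumption X Y g a m psi nu.

Notation xs := (x_std X psi).
Notation ys := (y_std X Y a m).
Notation F := (@finite_half R : set (\bar R * \bar R)).

Definition Psi (y : R) : R := fine (nu (quadrant 0%E y%:E)).

Definition above (y : R) : set (\bar R * \bar R) :=
  [set z | (0 <= z.1 < +oo)%E /\ (y%:E < z.2 < +oo)%E].

Let mq (y : R) : measurable (quadrant 0%E y%:E : set (\bar R * \bar R)).
Proof.
rewrite (_ : quadrant _ _ = [set` `[0%E, +oo%E[ ] `*` [set` `]-oo%E, y%:E] ]).
  by apply: measurableX; exact: emeasurable_itv.
by apply/seteqP; split=> z /=; rewrite !in_itv /=.
Qed.

Let ma (y : R) : measurable (above y).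
Proof.
rewrite (_ : above _ = [set` `[0%E, +oo%E[ ] `*` [set` `]y%:E, +oo%E[ ]).
  by apply: measurableX; exact: emeasurable_itv.
by apply/seteqP; split=> z /=; rewrite !in_itv /=.
Qed.

Let qF (y : R) : quadrant 0%E y%:E `<=` F.
Proof.
move=> z [h1 /andP[h2 h3]]; split=> //; rewrite h2 /=.
by apply: le_lt_trans h3 _; rewrite ltry.
Qed.

Let aF (y : R) : above y `<=` F.
Proof.
move=> z [h1 /andP[h2 h3]]; split=> //; rewrite h3 andbT.
by apply: lt_trans h2; rewrite ltNyr.
Qed.

Let nu_finite_half : nu F = 1%E := nu_mass H1.

Let nu_fin (A : set (\bar R * \bar R)) : measurable A -> A `<=` F -> nu A \is a fin_num.
Proof.
move=> mA AF; rewrite ge0_fin_numE ?measure_ge0//.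
apply: (@le_lt_trans _ _ (nu F)); last by rewrite nu_finite_half ltry.
by apply: le_measure; rewrite ?inE//; exact: measurable_finite_half.
Qed.

Lemma nu_quadrant y : nu (quadrant 0%E y%:E) = (Psi y)%:E.
Proof. by rewrite /Psi fineK//; exact: nu_fin (mq y) (@qF y). Qed.

Lemma nu_above y : nu (above y) = (1 - Psi y)%:E.
Proof.
have : nu F = (nu (quadrant 0%E y%:E) + nu (above y))%E.
  rewrite -measureU//.
    congr (nu _); apply/seteqP; split; last by move=> z [/qF|/aF].
    move=> z [h1 /andP[h2 h3]]; have [h|h] := leP z.2 y%:E; [left|right].
      by split=> //; rewrite h2.
    by split=> //; rewrite h h3.
  by apply/seteqP; split=> // z [[_ /andP[_ h]] [_ /andP[]]]; rewrite ltNge h.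
rewrite nu_finite_half nu_quadrant -(fineK (nu_fin (ma y) (@aF y))) -EFinD.
by move=> h; have h2 := EFin_inj h; congr EFin; lra.
Qed.

Lemma Psi_homo x y : x <= y -> Psi x <= Psi y.
Proof.
move=> xy; rewrite -lee_fin -!nu_quadrant; apply: le_measure; rewrite ?inE//.
move=> z [h1 /andP[h2 h3]]; split=> //; rewrite h2 /=.
by apply: le_trans h3 _; rewrite lee_fin.
Qed.

Lemma low_mass (s t e : R) : s < t -> 0 < e ->
  \forall n \near \oo, Psi s - e < n%:R * pr P [set w | 0 < xs n w /\ ys n w < t].
Proof.
move=> st e0.
have cv : continuous (fun x => 1 - ramp s t x).
  by move=> x; apply: cvgB; [exact: cvg_cst|exact: ramp_continuous].
have [|//|//|||_] := @lower_bound_pre _ _ _ _ _ _ _ _ _ _ _ H1 e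
  (fun x => 1 - ramp s t x) s t (quadrant 0%E s%:E) [set y | y < t] e0 (ltW st) cv _ (mq s) _ _ _.
- by move=> x /(ramp_itv st) /andP[h1 h2]; apply/andP; split; lra.
- by move=> z [/andP[]].
- by move=> z [_ /andP[_ h]]; rewrite eclamp_lo ?(ltW st)// ramp0 subr0.
- rewrite (_ : [set y | y < t] = [set` `]-oo, t[]); first exact: measurable_itv.
  by apply/seteqP; split=> z /=; rewrite in_itv.
- move=> y; rewrite subr_gt0 /ramp ltr_pdivrMr ?subr_gt0// mul1r ltrD2r /clamp.
  by rewrite gt_max st /= gt_min ltxx.
- by [].
Qed.

Lemma high_mass (s t e : R) : s < t -> 0 < e ->
  \forall n \near \oo, 1 - Psi t - e < n%:R * pr P [set w | 0 < xs n w /\ s < ys n w].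
Proof.
move=> st e0.
have [|//|//|||_] := @lower_bound_pre _ _ _ _ _ _ _ _ _ _ _ H1 e
  (ramp s t) s t (above t) [set y | s < y] e0 (ltW st) (@ramp_continuous _ s t) _ (ma t) _ _ _.
- by move=> x /(ramp_itv st).
- by move=> z [/andP[]].
- by move=> z [_ /andP[h _]]; rewrite eclamp_hi ?(ltW st)// ?ramp1// ltW.
- rewrite (_ : [set y | s < y] = [set` `]s, +oo[]); first exact: measurable_itv.
  by apply/seteqP; split=> z /=; rewrite in_itv /= andbT.
- by move=> y; exact: ramp_gt0.
- by rewrite nu_above.
Qed.

Lemma Psi_continuous : continuous Psi.
Proof.
have oE : open (ev_space g : set (\bar R * \bar R)).
  rewrite (_ : ev_space g = fst @^-1` [set x : \bar R | (- g%:E^-1 < x)%E])//.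
  apply: (@open_comp _ _ (@fst (\bar R) (\bar R))); first by move=> z _; exact: cvg_fst.
  exact: open_ereal_gt_ereal.
have := nu_continuous H1; rewrite continuous_open_subspace// => h y.
have zE : ((0%E, y%:E) : \bar R * \bar R) \in ev_space g.
  by rewrite inE; apply: (half_sub_ev H1); rewrite /half_plane /=.
have {}h := h _ zE.
have c1 : (fun _ : R => 0%E : \bar R) x @[x --> y] --> (0%E : \bar R) by exact: cvg_cst.
have c2 : (fun x : R => x%:E) x @[x --> y] --> y%:E.
  by apply: cvg_EFin; [exact: nearW|exact: cvg_id].
have c : {for y, continuous (fun x : R => (0%E, x%:E) : \bar R * \bar R)}.
  by apply: (cvg_pair c1 c2).
have : (fun x : R => nu (quadrant 0%E x%:E)) x @[x --> y] --> nu (quadrant 0%E y%:E).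
  exact: (continuous_comp c h).
rewrite nu_quadrant => /fine_cvgP[_].
by [].
Qed.

Lemma Psi_cvg1 : (fun n : nat => Psi n%:R) @ \oo --> (1:R).
Proof.
have : nu (quadrant 0%E n%:R%:E) @[n --> \oo] --> nu F.
  rewrite (_ : F = \bigcup_n quadrant 0%E n%:R%:E).
    apply: nondecreasing_cvg_mu => //.
      by apply: bigcup_measurable.
    move=> i j ij; apply/subsetPset => z [h1 /andP[h2 h3]]; split=> //; rewrite h2 /=.
    by apply: le_trans h3 _; rewrite lee_fin ler_nat.
  apply/seteqP; split=> [[x y] [/= h1 h2]|z [n _]]; last exact: qF.
  move: h2; case: y => [r _|/andP[]//|/andP[]//].
  exists (Num.truncn `|r|).+1 => //; split=> //=; rewrite ltNyr /= lee_fin.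
  by apply: le_trans (ler_norm _) _; apply: ltW; exact: truncnS_gt.
rewrite nu_finite_half => /fine_cvgP[_]; exact.
Qed.

Lemma Psi_cvg0 : (fun n : nat => Psi (- n%:R)) @ \oo --> (0:R).
Proof.
have : nu (above (- n%:R)) @[n --> \oo] --> nu F.
  rewrite (_ : F = \bigcup_n above (- n%:R)).
    apply: nondecreasing_cvg_mu => //.
      by apply: bigcup_measurable.
    move=> i j ij; apply/subsetPset => z [h1 /andP[h2 h3]]; split=> //; rewrite h3 andbT.
    by apply: le_lt_trans h2; rewrite lee_fin lerN2 ler_nat.
  apply/seteqP; split=> [[x y] [/= h1 h2]|z [n _]]; last exact: aF.
  move: h2; case: y => [r _|/andP[]//|/andP[]//].
  exists (Num.truncn `|r|).+1 => //; split=> //=; rewrite ltry andbT lte_fin ltrNl.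
  apply: le_lt_trans (truncnS_gt _).
  by rewrite -normrN ler_norm.
rewrite nu_finite_half => /fine_cvgP[_] h.
have : (fun n : nat => 1 - (fine \o (fun n : nat => nu (above (- n%:R)))) n) @ \oo --> (1 - 1 : R).
  by apply: cvgB => //; exact: cvg_cst.
rewrite subrr; apply: cvg_trans; apply: near_eq_cvg; near=> n.
by rewrite /= nu_above /=; lra.
Unshelve. all: by end_near. Qed.

Lemma Psi_quantile (th : R) : 0 < th < 1 -> exists s : R,
  (forall y, y < s -> Psi y < th) /\ (forall y, s < y -> th <= Psi y).
Proof.
move=> /andP[t0 t1]; pose S := [set y | th <= Psi y].
have S0 : S !=set0.
  have : \forall n \near \oo, th < Psi n%:R by apply: (cvgr_gt _ Psi_cvg1).
  by move=> /filter_ex [n /ltW hn]; exists n%:R.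
have Sl : has_lbound S.
  have : \forall n \near \oo, Psi (- n%:R) < th by apply: (cvgr_lt _ Psi_cvg0).
  move=> /filter_ex [n hn]; exists (- n%:R) => y /= hy.
  rewrite leNgt; apply/negP => /ltW /Psi_homo h.
  by have := le_lt_trans (le_trans hy h) hn; rewrite ltxx.
exists (inf S); split=> y h.
  by rewrite ltNge; apply/negP => /(ge_inf Sl); rewrite leNgt h.
have [z Sz zy] := inf_adherent (eps := y - inf S) ltac:(by rewrite subr_gt0) (conj S0 Sl).
apply: le_trans Sz _; apply: Psi_homo.
by rewrite ltW//; move: zy; rewrite addrC subrK.
Qed.

(** Convergence of types needs agreement at two distinct points; two quantiles provide them. *)
Lemma Psi_support_points : exists s1 s2 : R, [/\ s1 < s2,
  (forall y, y < s1 -> Psi y < 1 / 3), (forall y, s1 < y -> 1 / 3 <= Psi y),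
  (forall y, y < s2 -> Psi y < 2 / 3) & (forall y, s2 < y -> 2 / 3 <= Psi y)].
Proof.
have [s1 [h1 h1']] := @Psi_quantile (1 / 3) ltac:(by apply/andP; split; lra).
have [s2 [h2 h2']] := @Psi_quantile (2 / 3) ltac:(by apply/andP; split; lra).
exists s1, s2; split=> //; rewrite ltNge; apply/negP => s21.
(* If [s2 <= s1], then [Psi] rises from below 1/3 to at least 2/3 across [s1], while continuity with
   tolerance 1/6 on each side allows an increase of less than 1/3. *)
have /cvgrPdist_lt/(_ (1 / 6) ltac:(lra)) := @Psi_continuous s1.
rewrite near_simpl => /nbhs_ballP[e /= e0 he].
have b1 : `|Psi s1 - Psi (s1 - e / 2)| < 1 / 6.
  by apply: he; rewrite /ball /= opprB addrC subrK ger0_norm; lra.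
have b2 : `|Psi s1 - Psi (s1 + e / 2)| < 1 / 6.
  by apply: he; rewrite /ball /= opprD addrA subrr add0r normrN ger0_norm; lra.
move: b1 b2; rewrite !ltr_norml => /andP[_ b1] /andP[b2 _].
have p1 := h1 (s1 - e / 2) ltac:(lra).
have p2 := h2' (s1 + e / 2) ltac:(lra).
lra.
Qed.

End conditional_limit.

(** * Normalizations at consecutive and at real indices *)

Section normalizations.
Context d (T : measurableType d) (R : realType) (P : probability T R).
Variables (X Y : {RV P >-> R}) (g : R) (a m psi : R -> R).
Variable nu : {measure set (\bar R * \bar R) -> \bar R}.
Hypothesis H1 : extreme_assumption X Y g a m psi nu.

Notation b := (tail_quantile X).
Notation xs := (x_std X psi).
Notation ys := (y_std X Y a m).
Notation Psi := (Psi nu).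

Lemma b_cvg : (fun n : nat => b n%:R) @ \oo --> +oo.
Proof.
apply: (location_cvg (index_ge0 H1) (X_attracted H1)); first exact: b_homo_nat.
exact: endpoint_infinite H1.
Qed.

Lemma scales_gt0 : \forall n \near \oo, 0 < psi (b n%:R) /\ 0 < a (b n%:R).
Proof.
near=> n; split; near: n; [exact: (b_cvg (psi_positive H1))|exact: (b_cvg (a_positive H1))].
Unshelve. all: by end_near. Qed.

Lemma x_std_gt0 n w : 0 < psi (b n%:R) -> (0 < xs n w) = (b n%:R < X w).
Proof. by move=> p0; rewrite /x_std pmulr_lgt0 ?invr_gt0// subr_gt0. Qed.

Lemma x_std_gt0_mono (i j : nat) w : (2 <= i <= j)%N ->
  0 < psi (b i%:R) -> 0 < psi (b j%:R) -> 0 < xs j w -> 0 < xs i w.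
Proof.
by move=> ij pi pj; rewrite !x_std_gt0//; apply: le_lt_trans; exact: b_homo_nat.
Qed.

Lemma y_stdE n w : 0 < a (b n%:R) -> Y w = m (b n%:R) + a (b n%:R) * ys n w.
Proof. by move=> a0; rewrite /y_std mulrC divfK ?gt_eqF// addrC subrK. Qed.

Lemma mass_cvg1 : (fun n => n%:R * pr P [set w | 0 < xs n w]) @ \oo --> (1:R).
Proof.
have dom0 : 0 < 1 + g * 0 by rewrite mulr0 addr0.
by have := x_std_cvg H1 dom0; rewrite gpd0.
Qed.

Lemma measurable_x_gt0 n : measurable [set w | 0 < xs n w].
Proof. by apply: measurable_set_lt => //; exact: measurable_x_std. Qed.

Lemma measurable_xy_lt n (t : R) : measurable [set w | 0 < xs n w /\ ys n w < t].
Proof.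
apply: measurableI; first exact: measurable_x_gt0.
by apply: measurable_set_lt => //; exact: measurable_y_std.
Qed.

Lemma measurable_xy_gt n (t : R) : measurable [set w | 0 < xs n w /\ t < ys n w].
Proof.
apply: measurableI; first exact: measurable_x_gt0.
by apply: measurable_set_lt => //; exact: measurable_y_std.
Qed.

Lemma succ_ratio_cvg : (fun n => n.+1%:R / n%:R : R) @ \oo --> (1:R).
Proof.
have h : (fun n : nat => 1 + n%:R^-1 : R) @ \oo --> (1 + 0 : R).
  by apply: cvgD; [exact: cvg_cst|exact: cvg_invn].
rewrite addr0 in h; apply: cvg_trans h; apply: near_eq_cvg; near=> n.
by rewrite mulrSr mulrDl mul1r divff// pnatr_eq0 -lt0n; near: n; exact: nbhs_infty_gt.
Unshelve. all: by end_near. Qed.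

Lemma succ_cvg : (fun n : nat => n.+1) @ \oo --> \oo.
Proof. by apply/cvgnyPge => A; exists A => // n /= /leqW. Qed.

(** Around a quantile [s], the events y < s + e at one of the two indices and y > s - e at the other
    have masses adding up to more than that of x_n > 0, which contains both. A common outcome [w]
    has [Y w] bounded on the two sides by the two normalizations. *)
Lemma entangled_succ (s th : R) :
  (forall y, y < s -> Psi y < th) -> (forall y, s < y -> th <= Psi y) ->
  entangled \oo (fun n => m (b n%:R)) (fun n => a (b n%:R))
    (fun n => m (b n.+1%:R)) (fun n => a (b n.+1%:R)) s.
Proof.
move=> hl hr; near=> e.
have e0 : 0 < e by near: e; exact: nbhs_right_gt.
have e2 : 0 < e / 2 by rewrite divr_gt0.
(* The surplus of mass around the quantile; three errors of size [ga / 8] do not exhaust it. *)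
pose ga := Psi (s + e / 2) - Psi (s - e / 2).
have ga0 : 0 < ga.
  have := hl (s - e / 2) ltac:(lra); have := hr (s + e / 2) ltac:(lra).
  by rewrite /ga; lra.
have ga8 : 0 < ga / 8 by rewrite divr_gt0.
have LO := @low_mass _ _ _ _ _ _ _ _ _ _ _ H1 (s + e / 2) (s + e) _ ltac:(lra) ga8.
have HI := @high_mass _ _ _ _ _ _ _ _ _ _ _ H1 (s - e) (s - e / 2) _ ltac:(lra) ga8.
have ms : (fun n => n.+1%:R * pr P [set w | 0 < xs n w]) @ \oo --> (1:R).
  have h : (fun n => n.+1%:R / n%:R * (n%:R * pr P [set w | 0 < xs n w])) @ \oo --> (1 * 1:R).
    by apply: cvgM; [exact: succ_ratio_cvg|exact: mass_cvg1].
  rewrite mulr1 in h; apply: cvg_trans h; apply: near_eq_cvg; near=> n.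
  by rewrite mulrA divfK// pnatr_eq0 -lt0n; near: n; exact: nbhs_infty_gt.
have MS : \forall n \near \oo, n.+1%:R * pr P [set w | 0 < xs n w] < 1 + ga / 8.
  by apply: (cvgr_lt _ ms); rewrite ltrDl.
near=> n.
have [p1 a1] : 0 < psi (b n%:R) /\ 0 < a (b n%:R) by near: n; exact: scales_gt0.
have [p2 a2] : 0 < psi (b n.+1%:R) /\ 0 < a (b n.+1%:R).
  by near: n; exact: (succ_cvg scales_gt0).
have sub w : 0 < xs n.+1 w -> 0 < xs n w.
  apply: x_std_gt0_mono => //; rewrite leqnSn andbT; near: n; exact: nbhs_infty_ge.
have l1 : Psi (s + e / 2) - ga / 8 < n%:R * pr P [set w | 0 < xs n w /\ ys n w < s + e].
  by near: n.
have l2 : Psi (s + e / 2) - ga / 8 <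
    n.+1%:R * pr P [set w | 0 < xs n.+1 w /\ ys n.+1 w < s + e].
  by near: n; exact: (succ_cvg LO).
have h1 : 1 - Psi (s - e / 2) - ga / 8 <
    n%:R * pr P [set w | 0 < xs n w /\ s - e < ys n w] by near: n.
have h2 : 1 - Psi (s - e / 2) - ga / 8 <
    n.+1%:R * pr P [set w | 0 < xs n.+1 w /\ s - e < ys n.+1 w].
  by near: n; exact: (succ_cvg HI).
have ms1 : n.+1%:R * pr P [set w | 0 < xs n w] < 1 + ga / 8 by near: n.
have n1 : 0 < n.+1%:R :> R by rewrite ltr0n.
have gaE : Psi (s + e / 2) = Psi (s - e / 2) + ga by rewrite /ga; lra.
have up A : n%:R * pr P A <= n.+1%:R * pr P A.
  by rewrite ler_wpM2r ?pr_ge0// ler_nat.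
split.
- have [w [[_ w1] [_ w2]]] : exists w, [set w | 0 < xs n.+1 w /\ ys n.+1 w < s + e] w /\
      [set w | 0 < xs n w /\ s - e < ys n w] w.
    apply: (@pr_meet _ _ _ P _ _ _ (measurable_xy_lt _ _) (measurable_xy_gt _ _) (measurable_x_gt0 n)).
    + by move=> w [/sub].
    + by move=> w [].
    + rewrite -(ltr_pM2l n1) mulrDr.
      have := up [set w | 0 < xs n w /\ s - e < ys n w]; lra.
  apply: (@lt_trans _ _ (Y w)).
    by rewrite (@y_stdE n)// ltrD2l ltr_pM2l.
  by rewrite (@y_stdE n.+1)// ltrD2l ltr_pM2l.
- have [w [[_ w1] [_ w2]]] : exists w, [set w | 0 < xs n w /\ ys n w < s + e] w /\
      [set w | 0 < xs n.+1 w /\ s - e < ys n.+1 w] w.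
    apply: (@pr_meet _ _ _ P _ _ _ (measurable_xy_lt _ _) (measurable_xy_gt _ _) (measurable_x_gt0 n)).
    + by move=> w [].
    + by move=> w [/sub].
    + rewrite -(ltr_pM2l n1) mulrDr.
      have := up [set w | 0 < xs n w /\ ys n w < s + e]; lra.
  apply: (@lt_trans _ _ (Y w)).
    by rewrite (@y_stdE n.+1)// ltrD2l ltr_pM2l.
  by rewrite (@y_stdE n)// ltrD2l ltr_pM2l.
Unshelve. all: by end_near. Qed.

Lemma succ_types : (fun n => a (b n.+1%:R) / a (b n%:R)) @ \oo --> (1:R) /\
  (fun n => (m (b n.+1%:R) - m (b n%:R)) / a (b n%:R)) @ \oo --> (0:R).
Proof.
have [s1 [s2 [s12 h1 h2 h3 h4]]] := Psi_support_points H1.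
have sc : \forall n \near \oo, 0 < a (b n%:R).
  by apply: filterS scales_gt0 => n [].
apply: (entangled_types s12 (entangled_succ h1 h2) (entangled_succ h3 h4) sc).
exact: (succ_cvg sc).
Qed.

(* For real t, monotonicity traps b, a o b and m o b between consecutive integers. *)
Lemma monotone_between (f : R -> R) : monotone_near_pinfty f ->
  exists x0 : R, forall x y z, x0 <= x -> x <= y -> y <= z ->
    `|f y - f x| <= `|f z - f x|.
Proof.
move=> [x0 [h|h]]; exists x0 => x y z x0x xy yz;
  have x0y := le_trans x0x xy; have x0z := le_trans x0y yz;
  have fxy := h x y; have fyz := h y z;
  rewrite !in_itv /= !andbT in fxy fyz.
- have k1 := fxy x0x x0y xy; have k2 := fyz x0y x0z yz.
  by rewrite !ger0_norm ?subr_ge0//; lra.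
- have k1 := h y x; have k2 := h z y; rewrite !in_itv /= !andbT in k1 k2.
  have {}k1 := k1 x0y x0x xy; have {}k2 := k2 x0z x0y yz.
  by rewrite !ler0_norm ?subr_le0//; lra.
Qed.

(** One integer step changes m o b and a o b by a negligible multiple of a o b ([succ_types]), and
    moving inside the step changes them no more. This reaches the index n/k, whereas the vague
    convergence is along integers. *)
Lemma real_index_types (t : nat -> R) : t @ \oo --> +oo ->
  let N n := Num.truncn (t n) in
  (fun n => a (b (t n)) / a (b (N n)%:R)) @ \oo --> (1:R) /\
  (fun n => (m (b (t n)) - m (b (N n)%:R)) / a (b (N n)%:R)) @ \oo --> (0:R).
Proof.
move=> ty N.
have NN : N @ \oo --> \oo.
  apply/cvgnyPge => A; have /cvgryPge/(_ A%:R) := ty; apply: filterS => n h.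
  by rewrite /N truncn_ge_nat// (le_trans _ h).
have tN : \forall n \near \oo, (2 <= N n)%N /\ (N n)%:R <= t n <= (N n).+1%:R.
  have /cvgryPge/(_ 2) h2 := ty.
  apply: filterS h2 => n h; have t0 : 0 <= t n by rewrite (le_trans _ h).
  split; first by rewrite /N truncn_ge_nat.
  by apply/andP; split; [rewrite /N truncn_le|apply/ltW; exact: truncnS_gt].
have bt : \forall n \near \oo, b (N n)%:R <= b (t n) /\ b (t n) <= b (N n).+1%:R.
  apply: filterS tN => n [N2 /andP[h1 h2]].
  have N1 : 1 < (N n)%:R :> R by rewrite ltr1n.
  by split; apply: tail_quantile_homo => //; exact: lt_le_trans h1.
have bN : (fun n => b (N n)%:R) @ \oo --> +oo by exact: (cvg_comp _ _ NN b_cvg).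
have sc0 : \forall n \near \oo, 0 < a (b n%:R).
  by apply: filterS scales_gt0 => n [].
have sc : \forall n \near \oo, 0 < a (b (N n)%:R) by exact: (NN _ sc0).
have [r1 r2] := succ_types.
have key (f : R -> R) : monotone_near_pinfty f ->
    (fun n => (f (b n.+1%:R) - f (b n%:R)) / a (b n%:R)) @ \oo --> (0:R) ->
    (fun n => (f (b (t n)) - f (b (N n)%:R)) / a (b (N n)%:R)) @ \oo --> (0:R).
  move=> /monotone_between [x0 hx0] h.
  have {}h := cvg_comp _ _ NN h.
  apply/cvgr0Pnorm_lt => e e0.
  have /cvgr0Pnorm_lt/(_ e e0) he := h.
  have /cvgryPge/(_ x0) bx := bN.
  near=> n.
  have [b1 b2] : b (N n)%:R <= b (t n) /\ b (t n) <= b (N n).+1%:R by near: n.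
  have x0b : x0 <= b (N n)%:R by near: n.
  have an : 0 < a (b (N n)%:R) by near: n.
  apply: (@le_lt_trans _ _ `|(f (b (N n).+1%:R) - f (b (N n)%:R)) / a (b (N n)%:R)|).
    by rewrite !normrM ler_wpM2r// hx0.
  by near: n.
split; last by apply: key => //; exact: m_monotone H1.
have : (fun n => (a (b n.+1%:R) - a (b n%:R)) / a (b n%:R)) @ \oo --> (0:R).
  have h : (fun n => a (b n.+1%:R) / a (b n%:R) - 1) @ \oo --> (1 - 1:R).
    by apply: cvgB => //; exact: cvg_cst.
  rewrite subrr in h; apply: cvg_trans h; apply: near_eq_cvg; near=> n.
  rewrite mulrBl divff// gt_eqF//.
  by have [] : 0 < psi (b n%:R) /\ 0 < a (b n%:R) by near: n; exact: scales_gt0.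
move=> /(key _ (a_monotone H1)) h.
have {}h : (fun n => (a (b (t n)) - a (b (N n)%:R)) / a (b (N n)%:R) + 1) @ \oo --> (0 + 1:R).
  by apply: cvgD => //; exact: cvg_cst.
rewrite add0r in h; apply: cvg_trans h; apply: near_eq_cvg; near=> n.
have an : 0 < a (b (N n)%:R) by near: n.
by rewrite mulrBl divff ?gt_eqF// subrK.
Unshelve. all: by end_near. Qed.

(** [Psi] tends to 0 and 1 at the two ends, so the limit law of [y] given x > 0 leaves no mass at
    infinity. *)
Lemma tight (e : R) : 0 < e -> exists M : R, 0 < M /\
  \forall n \near \oo, 1 - e < n%:R * pr P [set w | 0 < xs n w /\ `|ys n w| <= M].
Proof.
move=> e0; have e8 : 0 < e / 8 by rewrite divr_gt0.
have P1 : \forall n \near \oo, 1 - e / 8 < Psi n%:R.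
  by apply: (cvgr_gt _ (Psi_cvg1 H1)); rewrite gtrBl.
have P0 : \forall n \near \oo, Psi (- n%:R) < e / 8.
  by apply: (cvgr_lt _ (Psi_cvg0 H1)).
near \oo => k.
have k1 : 1 - e / 8 < Psi k%:R by near: k.
have k0 : Psi (- k%:R) < e / 8 by near: k.
exists (k%:R + 1); split; first by rewrite ltr_wpDl.
have LO := @low_mass _ _ _ _ _ _ _ _ _ _ _ H1 k%:R (k%:R + 1) _ ltac:(by rewrite ltrDl) e8.
have HI := @high_mass _ _ _ _ _ _ _ _ _ _ _ H1 (- (k%:R + 1)) (- k%:R) _
  ltac:(by rewrite ltrN2 ltrDl) e8.
have MS : \forall n \near \oo, n%:R * pr P [set w | 0 < xs n w] < 1 + e / 8.
  by apply: (cvgr_lt _ mass_cvg1); rewrite ltrDl.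
near=> n.
have l : Psi k%:R - e / 8 < n%:R * pr P [set w | 0 < xs n w /\ ys n w < k%:R + 1].
  by near: n.
have h : 1 - Psi (- k%:R) - e / 8 <
    n%:R * pr P [set w | 0 < xs n w /\ - (k%:R + 1) < ys n w] by near: n.
have ms : n%:R * pr P [set w | 0 < xs n w] < 1 + e / 8 by near: n.
set A := [set w | 0 < xs n w /\ ys n w < k%:R + 1] in l.
set B := [set w | 0 < xs n w /\ - (k%:R + 1) < ys n w] in h.
have mA : measurable A by exact: measurable_xy_lt.
have mB : measurable B by exact: measurable_xy_gt.
have mAB : measurable (A `&` B) by exact: measurableI.
have mM : measurable [set w | 0 < xs n w /\ `|ys n w| <= k%:R + 1].
  apply: measurableI; first exact: measurable_x_gt0.
  apply: measurable_set_le => //.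
  by apply: measurableT_comp => //; exact: measurable_y_std.
have AB : pr P A + pr P B <= pr P [set w | 0 < xs n w] + pr P (A `&` B).
  have -> : pr P A = pr P (A `\` B) + pr P (A `&` B).
    rewrite -pr_setU_disj//; first by rewrite setUC setUIDK.
    - exact: measurableD.
    - by move=> w [_ nB] [].
  have : pr P (A `\` B) + pr P B <= pr P [set w | 0 < xs n w].
    rewrite -pr_setU_disj//; last 2 first.
    - exact: measurableD.
    - by move=> w [].
    apply: le_pr; [by apply: measurableU => //; exact: measurableD|exact: measurable_x_gt0|].
    by move=> w [[[]]|[]].
  by lra.
have ABM : pr P (A `&` B) <= pr P [set w | 0 < xs n w /\ `|ys n w| <= k%:R + 1].
  apply: le_pr => // w [[x0 y1] [_ y2]]; split=> //.
  by rewrite ler_norml; apply/andP; split; exact: ltW.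
have n0 : 0 <= n%:R :> R by [].
have := ler_wpM2l n0 AB; have := ler_wpM2l n0 ABM.
rewrite !mulrDr; lra.
Unshelve. all: by end_near. Qed.

End normalizations.

(** * Comparison with the index 9n/10 *)

Section shift.
Context d (T : measurableType d) (R : realType) (P : probability T R).
Variables (X Y : {RV P >-> R}) (g : R) (a m psi : R -> R).
Variable nu : {measure set (\bar R * \bar R) -> \bar R}.
Hypothesis H1 : extreme_assumption X Y g a m psi nu.

Notation b := (tail_quantile X).
Notation xs := (x_std X psi).
Notation ys := (y_std X Y a m).
Notation Psi := (Psi nu).

(** The limit 10/9 of n / shift n exceeds 1, so b(n) - b(shift n) is of the order of psi, and it is
    below 5/4, so an event of mass near 1 at index [n] keeps mass near or above 4/5 at index
    [shift n]. *)
Definition shift (n : nat) : nat := (9 * n %/ 10)%N.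

Lemma shift_le n : (shift n <= n)%N.
Proof. by rewrite /shift; lia. Qed.

Lemma shift_cvg : shift @ \oo --> \oo.
Proof.
apply/cvgnyPge => A; exists (2 * A).+2 => // n /= h.
by rewrite /shift; lia.
Qed.

Lemma near_shift (A : nat -> Prop) :
  (\forall n \near \oo, A n) -> \forall n \near \oo, A (shift n).
Proof. by move=> h; exact: (shift_cvg h). Qed.

Lemma shift_ratio_cvg : (fun n => n%:R / (shift n)%:R : R) @ \oo --> (10 / 9 : R).
Proof.
have -> : 10 / 9 = (9 / 10)^-1 :> R by rewrite invf_div.
have : (fun n => (shift n)%:R / n%:R : R) @ \oo --> (9 / 10 : R).
  have h : (fun n : nat => 9 / 10 - n%:R^-1 : R) @ \oo --> (9 / 10 - 0 : R).
    by apply: cvgB; [exact: cvg_cst|exact: cvg_invn].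
  have h2 : (fun _ : nat => 9 / 10 : R) @ \oo --> (9 / 10 : R) by exact: cvg_cst.
  rewrite subr0 in h; apply: (squeeze_cvgr _ h h2); near=> n.
  have n0 : 0 < n%:R :> R by rewrite ltr0n; near: n; exact: nbhs_infty_gt.
  rewrite ler_pdivlMr// ler_pdivrMr// mulrBl mulVf ?gt_eqF//.
  have e1 : (9 * n)%:R <= (10 * shift n + 10)%:R :> R by rewrite ler_nat /shift; lia.
  have e2 : (10 * shift n)%:R <= (9 * n)%:R :> R by rewrite ler_nat /shift; lia.
  by move: e1 e2; rewrite natrD !natrM => e1 e2; apply/andP; split; lra.
move=> h; have n0 : 9 / 10 != 0 :> R by apply: lt0r_neq0; lra.
have {}h : (fun n => ((shift n)%:R / n%:R)^-1 : R) @ \oo --> ((9 / 10)^-1 : R).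
  exact: cvgV.
apply: cvg_trans h; apply: near_eq_cvg; near=> n.
by rewrite /= invf_div.
Unshelve. all: by end_near. Qed.

Let C1 : (10 / 9 : R) > 0. Proof. by []. Qed.

Lemma shift_types :
  (fun n => psi (b n%:R) / psi (b (shift n)%:R)) @ \oo --> (10 / 9 : R) `^ g /\
  (fun n => (b n%:R - b (shift n)%:R) / psi (b (shift n)%:R)) @ \oo -->
    gpd_quantile g (10 / 9).
Proof.
exact: (@attraction_types _ _ _ P X g _ _ (index_ge0 H1) (X_attracted H1) id shift
  (10 / 9) (fun _ h => h) shift_cvg C1 shift_ratio_cvg).
Qed.

Let pr_scale (z r k e : R) : 0 < k -> 0 <= z -> r / k < 5 / 4 -> 1 - e < r * z ->
  0 < e -> 4 / 5 - e < k * z.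
Proof.
move=> k0 z0; rewrite ltr_pdivrMr// => rk h e0.
have : r * z <= 5 / 4 * k * z by rewrite ler_wpM2r// ltW.
by rewrite -mulrA; lra.
Qed.

Section two_scales.
Variables (n k : nat) (s t p q e M : R).
Hypotheses (kn : (2 <= k <= n)%N) (st : s < t) (e0 : 0 < e) (e24 : 24 * e = 1).
Hypotheses (p3 : 1 / 3 <= p) (q3 : q < 2 / 3) (M0 : 0 < M).
Hypotheses (sn : 0 < psi (b n%:R) /\ 0 < a (b n%:R))
  (sk : 0 < psi (b k%:R) /\ 0 < a (b k%:R)).
Hypothesis lo : p - e < k%:R * pr P [set w | 0 < xs k w /\ ys k w < s].
Hypothesis hi : 1 - q - e < k%:R * pr P [set w | 0 < xs k w /\ t < ys k w].
Hypothesis tn : 1 - e < n%:R * pr P [set w | 0 < xs n w /\ `|ys n w| <= M].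
Hypothesis tk : 1 - e < k%:R * pr P [set w | 0 < xs k w /\ `|ys k w| <= M].
Hypothesis ms : k%:R * pr P [set w | 0 < xs k w] < 1 + e.
Hypothesis rat : n%:R / k%:R < 5 / 4 :> R.

Let k0 : 0 < k%:R :> R.
Proof. by rewrite ltr0n; have /andP[/ltnW] := kn. Qed.

Let mM j : measurable [set w | 0 < xs j w /\ `|ys j w| <= M].
Proof.
apply: measurableI; first exact: measurable_x_gt0.
apply: measurable_set_le => //.
by apply: measurableT_comp => //; exact: measurable_y_std.
Qed.

(** At index [k] the event |y_n| <= M has mass above 4/5 - e and x_k > 0 has mass below 1 + e. Any
    part of the latter of mass above 1/5 + 2 e therefore meets the former. *)
Let meet B : measurable B -> B `<=` [set w | 0 < xs k w] -> 1 / 5 + 2 * e < k%:R * pr P B ->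
    exists w, `|ys n w| <= M /\ B w.
Proof.
have [pn an] := sn; have [pk ak] := sk.
have sub w : 0 < xs n w -> 0 < xs k w by apply: x_std_gt0_mono.
have h1 := pr_scale k0 (pr_ge0 P _) rat tn e0.
move=> mB sB hB.
have [w [[w1 w2] w3]] : exists w, [set w | 0 < xs n w /\ `|ys n w| <= M] w /\ B w.
  apply: (@pr_meet _ _ _ P _ _ _ (mM n) mB (measurable_x_gt0 X psi k)) => //.
  - by move=> w [/sub].
  - rewrite -(ltr_pM2l k0) mulrDr; move: ms h1 hB; lra.
by exists w.
Qed.

Let K := 2 * M / (t - s).

(** Two outcomes with y_k < s and y_k > t, both with |y_n| <= M, have values of [Y] at least (t - s)
    a(b(k)) and at most 2 M a(b(n)) apart, which bounds the ratio of scales. A third outcome, with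
    |y_n| and |y_k| both at most M, bounds the difference of locations. *)
Lemma two_scale_bounds : a (b k%:R) <= (K + (M + M * K)) * a (b n%:R) /\
  `|m (b n%:R) - m (b k%:R)| <= (K + (M + M * K)) * a (b n%:R).
Proof.
have [pn an] := sn; have [pk ak] := sk.
have [w1 [w1n [_ w1k]]] := meet (measurable_xy_lt X Y a m psi k s) (fun w h => proj1 h)
  ltac:(move: lo e24 p3; lra).
have [w2 [w2n [_ w2k]]] := meet (measurable_xy_gt X Y a m psi k t) (fun w h => proj1 h)
  ltac:(move: hi e24 q3; lra).
have [w3 [w3n [_ w3k]]] := meet (mM k) (fun w h => proj1 h)
  ltac:(move: tk e24; lra).
have ts : 0 < t - s by rewrite subr_gt0.
have K0 : 0 < K by rewrite divr_gt0// mulr_gt0.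
have ratio : a (b k%:R) <= K * a (b n%:R).
  have b1 : - (M * a (b n%:R)) <= a (b n%:R) * ys n w1.
    by rewrite -mulNr mulrC ler_pM2l//; move: w1n; rewrite ler_norml => /andP[].
  have b2 : a (b n%:R) * ys n w2 <= M * a (b n%:R).
    by rewrite mulrC ler_pM2r//; move: w2n; rewrite ler_norml => /andP[].
  have b3 : a (b k%:R) * ys k w1 < a (b k%:R) * s by rewrite ltr_pM2l.
  have b4 : a (b k%:R) * t < a (b k%:R) * ys k w2 by rewrite ltr_pM2l.
  rewrite /K mulrAC ler_pdivlMr// mulrBr.
  move: (y_stdE Y m w1 an) (y_stdE Y m w1 ak) (y_stdE Y m w2 an) (y_stdE Y m w2 ak).
  by move: b1 b2 b3 b4; lra.
have Kan : 0 <= K * a (b n%:R) by rewrite mulr_ge0// ltW.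
have Man : 0 <= M * a (b n%:R) by rewrite mulr_ge0// ltW.
have MKan : 0 <= M * K * a (b n%:R) by apply: mulr_ge0; [apply: mulr_ge0; exact: ltW|exact: ltW].
split; first by rewrite !mulrDl; move: ratio Kan Man MKan; lra.
have -> : m (b n%:R) - m (b k%:R) = a (b k%:R) * ys k w3 - a (b n%:R) * ys n w3.
  by move: (y_stdE Y m w3 an) (y_stdE Y m w3 ak); lra.
apply: le_trans (ler_normB _ _) _.
rewrite (normrM _ (ys k w3)) (normrM _ (ys n w3)) (gtr0_norm an) (gtr0_norm ak).
have c1 : a (b k%:R) * `|ys k w3| <= K * a (b n%:R) * M by rewrite ler_pM// ltW.
have c2 : a (b n%:R) * `|ys n w3| <= a (b n%:R) * M by rewrite ler_wpM2l// ltW.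
by rewrite !mulrDl; move: c1 c2 Kan; lra.
Qed.

End two_scales.

Lemma shift_bounds : exists C : R, 0 < C /\ \forall n \near \oo,
  a (b (shift n)%:R) <= C * a (b n%:R) /\
  `|m (b n%:R) - m (b (shift n)%:R)| <= C * a (b n%:R).
Proof.
have [s1 [s2 [s12 h1 h2 h3 h4]]] := Psi_support_points H1.
have [D [D0 s2E]] : exists D : R, 0 < D /\ s2 = s1 + D.
  by exists (s2 - s1); rewrite subr_gt0 addrC subrK.
(* With [e = 1/24], the mass 1/3 - e of a quantile event exceeds the threshold 1/5 + 2 e of
   [meet]. *)
have [e [c0 e24]] : exists e : R, 0 < e /\ 24 * e = 1.
  by exists (24^-1); split; [rewrite invr_gt0|rewrite mulfV].
have [M [M0 hM]] := tight H1 c0.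
(* The points at D / 6 and D / 3 leave room for a ramp next to each quantile and keep a gap of D / 3
   between the low event and the high one. *)
have LO := @low_mass _ _ _ _ _ _ _ _ _ _ _ H1 (s1 + D / 6) (s1 + D / 3) _ ltac:(lra) c0.
have HI := @high_mass _ _ _ _ _ _ _ _ _ _ _ H1 (s2 - D / 3) (s2 - D / 6) _ ltac:(lra) c0.
have p1 := h2 (s1 + D / 6) ltac:(lra).
have p2 := h3 (s2 - D / 6) ltac:(lra).
have MS : \forall n \near \oo, n%:R * pr P [set w | 0 < xs n w] < 1 + e.
  by apply: (cvgr_lt _ (mass_cvg1 H1)); rewrite ltrDl.
have RA : \forall n \near \oo, n%:R / (shift n)%:R < 5 / 4 :> R.
  apply: (cvgr_lt _ shift_ratio_cvg); lra.
have st : s1 + D / 3 < s2 - D / 3 by lra.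
pose K := 2 * M / (s2 - D / 3 - (s1 + D / 3)).
have K0 : 0 < K by rewrite divr_gt0 ?mulr_gt0// subr_gt0.
exists (K + (M + M * K)); split; first by rewrite addr_gt0// addr_gt0// mulr_gt0.
clear h1 h2 h3 h4 s12 D0.
have k2 := near_shift (nbhs_infty_ge 2).
have sk := near_shift (scales_gt0 H1).
have LO2 := near_shift LO; have HI2 := near_shift HI; have hM2 := near_shift hM.
have MS2 := near_shift MS; have sn := scales_gt0 H1.
have H := filterI k2 (filterI sn (filterI sk (filterI LO2 (filterI HI2
  (filterI hM (filterI hM2 (filterI MS2 RA))))))).
have [N0 _ HN] := H.
exists N0 => // n /HN [f1 [f2 [f3 [f4 [f5 [f6 [f7 [f8 f9]]]]]]]].
have kn : (2 <= shift n <= n)%N by apply/andP; split; [exact: f1|exact: shift_le].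
exact: (two_scale_bounds kn st c0 e24 p1 p2 M0 f2 f3 f4 f5 f6 f7 f8 f9).
Qed.

End shift.

(** * Continuity of powers of the absolute value *)

Section powers.
Variable R : realType.

Lemma norm_powR_continuous (p : R) : 1 <= p -> continuous (fun t : R => `|t| `^ p).
Proof.
move=> p1 t; have p0 : 0 < p by exact: lt_le_trans p1.
have [->|tn0] := eqVneq t 0.
  rewrite /continuous_at normr0 powR0 ?gt_eqF//.
  apply/cvgr0Pnorm_lt => e e0; near=> s.
  have s1 : `|s| < 1.
    by near: s; apply: (@nbhs0_lt R R).
  have se : `|s| < e.
    by near: s; apply: (@nbhs0_lt R R).
  rewrite ger0_norm ?powR_ge0//.
  apply: le_lt_trans se.
  have [->|sn0] := eqVneq s 0; first by rewrite normr0 powR0// gt_eqF.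
  by apply: ge1r_powR => //; rewrite normr_gt0 sn0 ltW.
have at0 : 0 < `|t| by rewrite normr_gt0.
have h : (fun s : R => expR (p * ln `|s|)) @ t --> expR (p * ln `|t|).
  have hn : {for t, continuous (fun s : R => ln `|s|)}.
    apply: (@continuous_comp _ _ _ (fun s : R => `|s|) (@ln R)); first exact: norm_continuous.
    exact: continuous_ln.
  apply: (@continuous_comp _ _ _ (fun s : R => p * ln `|s|) (@expR R)).
    by apply: cvgM => //; exact: cvg_cst.
  exact: continuous_expR.
have E : expR (p * ln `|t|) = `|t| `^ p by rewrite /powR gt_eqF.
rewrite E in h; apply: cvg_trans h; apply: near_eq_cvg.
have : \forall s \near t, 0 < `|s| by apply: (cvgr_gt _ (@norm_continuous R R t)).
apply: filterS => s; rewrite normr_gt0 => s0.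
by rewrite /powR normr_eq0 (negbTE s0).
Unshelve. all: by end_near. Qed.

End powers.

(** * Uniform integrability in y *)

Section moment_tail.
Context d (T : measurableType d) (R : realType) (P : probability T R).
Variables (X Y : {RV P >-> R}) (g : R) (a m psi : R -> R).
Variable nu : {measure set (\bar R * \bar R) -> \bar R}.
Variables p q : R.
Hypothesis H1 : extreme_assumption X Y g a m psi nu.
Hypothesis H2 : moment_assumption X Y g a m psi nu p q.
Hypotheses (p1 : 1 <= p) (q1 : 1 <= q).

Notation xs := (x_std X psi).
Notation ys := (y_std X Y a m).
Notation E := (ev_space g : set (\bar R * \bar R)).

Definition moment_fun (z : \bar R * \bar R) : R :=
  `|fine z.1| `^ p * `|fine z.2| `^ q.

Let Phi (x y : R) : R := `|x| `^ p * `|y| `^ q.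

Definition moment_domain (e : R) : set (\bar R * \bar R) :=
  [set z | ((- e)%:E <= z.1 < +oo)%E /\ (-oo < z.2 < +oo)%E].

Let trunc (j : nat) := product_fun (fun t => `|t| `^ p) (fun t => `|t| `^ q)
  0 j%:R (- j%:R) j%:R.

Let p0 : 0 < p. Proof. exact: lt_le_trans p1. Qed.
Let q0 : 0 < q. Proof. exact: lt_le_trans q1. Qed.

Let jj (j : nat) : (- j%:R : R) <= j%:R.
Proof. by rewrite (@le_trans _ _ 0)// oppr_le0. Qed.

Let up (j : nat) (x : R) : 0 <= x <= j%:R -> 0 <= `|x| `^ p <= j%:R `^ p.
Proof.
move=> /andP[x0 xj]; rewrite powR_ge0/= ge0_ler_powR// ?nnegrE// ?ger0_norm//.
exact: ltW.
Qed.

Let uq (j : nat) (x : R) : - j%:R <= x <= j%:R -> 0 <= `|x| `^ q <= j%:R `^ q.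
Proof.
move=> xj; rewrite powR_ge0/= ge0_ler_powR// ?nnegrE// ?ler_norml//.
exact: ltW.
Qed.

Let u0 : `|0 : R| `^ p = 0.
Proof. by rewrite normr0 powR0// gt_eqF. Qed.

Lemma norm_clamp_le (lo hi t : R) : lo <= 0 -> 0 <= hi -> `|clamp lo hi t| <= `|t|.
Proof.
move=> lo0 hi0; have := ler_norm t; have := ler_norm (- t); rewrite normrN => h1 h2.
have := normr_ge0 t => h3.
rewrite ler_norml /clamp /Num.max /Num.min; case: (ltP hi t) => h4;
  by case: ifPn; rewrite -?leNgt => h5; apply/andP; split; lra.
Qed.

Lemma norm_clamp_bound (lo hi t : R) : lo = - hi -> 0 <= hi -> `|clamp lo hi t| <= hi.
Proof. by move=> -> h; rewrite ler_norml clamp_itv// ge0_cp. Qed.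

Lemma clamp_neg (hi t : R) : t <= 0 -> 0 <= hi -> clamp 0 hi t = 0.
Proof. by move=> t0 h; rewrite /clamp max_l// ge_min t0 orbT. Qed.

Let measurable_moment_fun : measurable_fun setT moment_fun.
Proof.
have h (r : R) : measurable_fun setT (fun z : \bar R => `|fine z| `^ r).
  apply: (@measurableT_comp _ _ _ _ _ _ (fun x : R => x `^ r)); first exact: measurable_powR.
  by apply: measurableT_comp => //; exact: fine_measurable.
by apply: measurable_funM; [exact: (measurableT_comp (h p))|exact: (measurableT_comp (h q))].
Qed.

Let measurable_moment_domain e : measurable (moment_domain e).
Proof.
rewrite (_ : moment_domain e = [set` `[(- e)%:E, +oo%E[ ] `*` [set` `]-oo%E, +oo%E[ ]).
  by apply: measurableX; exact: emeasurable_itv.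
by apply/seteqP; split=> z /=; rewrite !in_itv /=.
Qed.

Let measurable_trunc j : measurable_fun setT (trunc j).
Proof. by apply: measurable_product_fun; exact: norm_powR_continuous. Qed.

Let trunc_itv j z : 0 <= trunc j z <= j%:R `^ p * j%:R `^ q.
Proof. by apply: (product_fun_itv (ler0n R j) (jj j)) => x; [exact: up|exact: uq]. Qed.

Let trunc_fin j : (\int[nu]_(z in E) (trunc j z)%:E)%E \is a fin_num.
Proof.
have [dl [d0 gd _ _]] := gpd_near0 (index_ge0 H1) ltr01.
have dl0 : - dl <= 0 by rewrite oppr_le0 ltW.
exact: (product_fun_fin H1 gd dl0 (ler0n R j) (jj j) (norm_powR_continuous p1)
  (norm_powR_continuous q1) (@up j) (@uq j) u0).
Qed.

Let trunc_cvg j : (fun n => n%:R * mean P (fun w =>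
    `|clamp 0 j%:R (xs n w)| `^ p * `|clamp (- j%:R) j%:R (ys n w)| `^ q))
  @ \oo --> fine (\int[nu]_(z in E) (trunc j z)%:E)%E.
Proof.
have [dl [d0 gd _ _]] := gpd_near0 (index_ge0 H1) ltr01.
have dl0 : - dl <= 0 by rewrite oppr_le0 ltW.
exact: (product_cvg H1 gd dl0 (ler0n R j) (jj j) (norm_powR_continuous p1)
  (norm_powR_continuous q1) (@up j) (@uq j) u0).
Qed.

Let trunc_le (j : nat) (x y : R) :
  `|clamp 0 j%:R x| `^ p * `|clamp (- j%:R) j%:R y| `^ q <= Phi x y.
Proof.
apply: ler_pM; rewrite ?powR_ge0// ge0_ler_powR ?nnegrE// ?(ltW p0) ?(ltW q0)//;
  by apply: norm_clamp_le => //; rewrite oppr_le0.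
Qed.

Let trunc_neg (j : nat) (x y : R) : x <= 0 ->
  `|clamp 0 j%:R x| `^ p * `|clamp (- j%:R) j%:R y| `^ q = 0.
Proof. by move=> x0; rewrite clamp_neg// u0 mul0r. Qed.

Let trunc_half (j : nat) (x y : R) : 2 * j%:R <= `|y| ->
  `|clamp 0 j%:R x| `^ p * `|clamp (- j%:R) j%:R y| `^ q <= Phi x y / 2.
Proof.
move=> jy; rewrite /Phi -mulrA; apply: ler_pM; rewrite ?powR_ge0//.
  by rewrite ge0_ler_powR ?nnegrE ?(ltW p0)//; exact: norm_clamp_le.
apply: (@le_trans _ _ ((`|y| * 2^-1) `^ q)).
  rewrite ge0_ler_powR ?nnegrE ?(ltW q0)// ?mulr_ge0// ?invr_ge0//.
  by apply: le_trans (norm_clamp_bound _ _ _) _ => //; lra.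
rewrite powRM ?invr_ge0// ler_wpM2l ?powR_ge0//.
by apply: ge1r_powR => //; rewrite invr_gt0 ltr0n/= invf_le1// ler1n.
Qed.

(** The moment assumption concerns x >= - ep with [ep > 0], whereas the truncated product is
    supported on x >= 0. Dominated convergence under [nu], with the moment function itself as
    dominant, closes both gaps: the strip to the left of 0 and the truncation. *)
Lemma moment_gap (e : R) : 0 < e -> exists (j : nat) (ep : R),
  [/\ (0 < j)%N, 0 < ep, (ep%:E < g%:E^-1)%E &
  (abs_moment nu p q ep <= \int[nu]_(z in E) (trunc j z)%:E + e%:E)%E].
Proof.
move=> e0.
have [dl [d0 gd _ _]] := gpd_near0 (index_ge0 H1) ltr01.
have dg : (dl%:E < g%:E^-1)%E.
  by have := neg_in_ev_space H1 gd; rewrite EFinN lteN2.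
(* The strip shrinks while the truncation level [n] grows, so that a single limit handles both. *)
pose ep (n : nat) := dl / n.+1%:R.
have ep0 n : 0 < ep n by rewrite divr_gt0.
have epd n : ep n <= dl by rewrite /ep ler_pdivrMr// ler_peMr ?(ltW d0)// ler1n.
pose ind n (z : \bar R * \bar R) : R := ((- ep n)%:E <= z.1)%E%:R.
pose h n z := moment_fun z * ind n z - trunc n z.
have mD := measurable_moment_domain dl.
have mI n : measurable_fun setT (ind n).
  have mA : measurable [set z : \bar R * \bar R | ((- ep n)%:E <= z.1)%E].
    rewrite (_ : [set z | _] = [set x : \bar R | ((- ep n)%:E <= x)%E] `*` setT); last first.
      by apply/seteqP; split=> z /=; [move=> ?; split|case].
    apply: measurableX => //; rewrite -[X in measurable X]setTI.
    exact: emeasurable_fun_c_infty.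
  rewrite (_ : ind n = \1_[set z : \bar R * \bar R | ((- ep n)%:E <= z.1)%E]).
    exact: measurable_indic.
  by apply/funext => z; rewrite indicE mem_setE.
have mh n : measurable_fun setT (h n).
  by apply: measurable_funB => //; apply: measurable_funM.
have finite z : moment_domain dl z -> exists x y : R, z = (x%:E, y%:E) /\ - dl <= x.
  move: z => [[x| |] [y| |]] [/=]; rewrite ?ltxx ?andbF ?leeNy_eq// => /andP[h1 _] _.
  by exists x, y.
have hb n z : moment_domain dl z -> 0 <= h n z <= moment_fun z.
  move=> /finite [x [y [-> xd]]]; rewrite /h /trunc /product_fun !eclampE /moment_fun /ind /=.
  have Pge : 0 <= `|x| `^ p * `|y| `^ q by rewrite mulr_ge0 ?powR_ge0.
  rewrite lee_fin; have [x0|x0] := leP 0 x.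
    have -> : - ep n <= x by rewrite (le_trans _ x0)// oppr_le0 ltW.
    rewrite mulr1 subr_ge0 [X in X && _]trunc_le gerBl.
    by apply: mulr_ge0; exact: powR_ge0.
  rewrite trunc_neg ?(ltW x0)// subr0.
  by case: (- ep n <= x); rewrite /= ?mulr1 ?mulr0 ?lexx ?Pge.
have int : nu.-integrable (moment_domain dl) (EFin \o moment_fun).
  apply/integrableP; split.
    by apply: measurable_funTS; apply/measurable_EFinP.
  apply: le_lt_trans (abs_moment_finite H2 d0 dg).
  rewrite le_eqVlt; apply/orP; left; apply/eqP; apply: eq_integral.
  by move=> v _; rewrite /= ger0_norm// mulr_ge0 ?powR_ge0.
have ptw z : moment_domain dl z -> (fun n => (h n z)%:E) @ \oo --> 0%E.
  move=> /finite [x [y [-> xd]]].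
  rewrite /h /trunc /product_fun /moment_fun /ind /=.
  have h0 : (fun _ : nat => 0%E : \bar R) @ \oo --> 0%E by exact: cvg_cst.
  apply: cvg_trans h0; apply: near_eq_cvg.
  have [x0|x0] := leP 0 x.
    near=> n; rewrite !eclampE lee_fin.
    have -> : - ep n <= x by rewrite (le_trans _ x0)// oppr_le0 ltW.
    have xn : x <= n%:R by near: n; exact: nbhs_infty_ger.
    have yn : `|y| <= n%:R by near: n; exact: nbhs_infty_ger.
    move: yn; rewrite ler_norml => /andP[yn1 yn2].
    by rewrite /clamp !min_r// !max_r// mulr1 subrr.
  have ept : (fun n : nat => dl * n.+1%:R^-1) @ \oo --> (dl * 0 : R).
    by apply: cvgM; [exact: cvg_cst|exact: cvg_harmonic].
  have epn : \forall n \near \oo, ep n < - x.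
    by rewrite mulr0 in ept; apply: (cvgr_lt _ ept); rewrite oppr_gt0.
  near=> n; rewrite !eclampE lee_fin trunc_neg ?(ltW x0)//.
  rewrite (_ : (- ep n <= x) = false) ?mulr0 ?subr0//.
  by apply/negbTE; rewrite -ltNge ltrNr; near: n.
have m1 n : measurable_fun (moment_domain dl) (fun z => (h n z)%:E).
  by apply: measurable_funTS; apply/measurable_EFinP.
have m2 : measurable_fun (moment_domain dl) (cst 0%E : \bar R * \bar R -> \bar R).
  exact: measurable_cst.
have a1 : \forall z \ae nu, moment_domain dl z -> (fun n => (h n z)%:E) @ \oo --> cst 0%E z.
  by apply: aeW => z; exact: ptw.
have a2 : \forall z \ae nu, forall n, moment_domain dl z ->
    (`|(h n z)%:E| <= (EFin \o moment_fun) z)%E.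
  apply: aeW => z n zD; have /andP[h0 h1] := hb n z zD.
  by rewrite /= ger0_norm// lee_fin.
have [_ _ DC] := dominated_convergence mD m1 m2 a1 int a2.
rewrite integral0 in DC.
have hn : \forall n \near \oo, (\int[nu]_(z in moment_domain dl) (h n z)%:E < e%:E)%E.
  have /fine_cvgP[hf h0] := DC.
  have h1 : \forall n \near \oo, fine (\int[nu]_(z in moment_domain dl) (h n z)%:E) < e.
    by apply: (cvgr_lt _ h0).
  apply: filterS2 hf h1 => n f1 f2.
  have f3 : (\int[nu]_(z in moment_domain dl) (h n z)%:E)%E \is a fin_num by exact: f1.
  by rewrite -(fineK f3) lte_fin.
near \oo => n.
have n0 : (0 < n)%N by near: n; exact: nbhs_infty_gt.
exists n, (ep n); split=> //.
  by apply: le_lt_trans dg; rewrite lee_fin.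
have sub : moment_domain (ep n) = moment_domain dl `&` [set z | ((- ep n)%:E <= z.1)%E].
  apply/seteqP; split=> z.
    move=> [/andP[k1 k2] k3]; split=> //; split=> //; rewrite k2 andbT.
    by apply: le_trans k1; rewrite lee_fin lerN2.
  by move=> [[/andP[k1 k2] k3] k4]; split=> //; rewrite k2 andbT.
have -> : abs_moment nu p q (ep n) =
    (\int[nu]_(z in moment_domain dl) ((h n z)%:E + (trunc n z)%:E))%E.
  rewrite /abs_moment -/(moment_domain _) sub integral_mkcondr.
  apply: eq_integral => z; rewrite inE => zD.
  rewrite -EFinD /h subrK /patch /ind.
  case: ifPn; rewrite ?inE ?notin_setE /= => hz; first by rewrite hz mulr1.
  by rewrite (negbTE (introN idP hz)) mulr0.
rewrite (@ge0_integralD _ _ _ nu _ mD (fun z => (h n z)%:E) (fun z => (trunc n z)%:E));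
  last 4 first.
- by move=> z zD; have /andP[] := hb n z zD; rewrite lee_fin.
- exact: m1.
- by move=> z _; rewrite lee_fin; have /andP[] := trunc_itv n z.
- by apply: measurable_funTS; apply/measurable_EFinP.
rewrite addeC leeD//; last by apply: ltW; near: n.
apply: ge0_subset_integral => //.
- exact: measurable_ev_space.
- by apply: measurable_funTS; apply/measurable_EFinP.
- by move=> z _; rewrite lee_fin; have /andP[] := trunc_itv n z.
- move=> z [/andP[k1 _] _]; apply: lt_le_trans k1.
  exact: (neg_in_ev_space H1 gd).
Unshelve. all: by end_near. Qed.

Let rescaled_moment (n : nat) (e : R) :
  abs_moment (rescaled_measure X Y a m psi n) p q e =
  (n%:R%:E * uexp P (fun w => Phi (xs n w) (ys n w) * (- e <= xs n w)%R%:R)%R)%E.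
Proof.
have mD := measurable_moment_domain e.
rewrite /abs_moment -/(moment_domain e) ge0_integral_mscale//; last first.
  by apply: measurable_funTS; apply/measurable_EFinP; exact: measurable_moment_fun.
congr (_ * _)%E.
rewrite ge0_integral_pushforward//; last first.
  by apply: measurable_funTS; apply/measurable_EFinP; exact: measurable_moment_fun.
rewrite /uexp integral_mkcond; apply: eq_integral => w _.
rewrite /patch; case: ifPn; rewrite ?inE ?notin_setE /= /rescaled /= => hw.
  have [/andP[h1 _] _] := hw; rewrite lee_fin in h1.
  by rewrite /x_std h1 mulr1.
rewrite (_ : (- e <= xs n w) = false) ?mulr0//.
apply/negbTE/negP => h; apply: hw; split; last by rewrite ltNyr ltry.
by rewrite lee_fin h ltry.
Qed.

Let measurable_Phi n : measurable_fun setT (fun w => Phi (xs n w) (ys n w)).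
Proof.
have h (r : R) (f : T -> R) : measurable_fun setT f ->
    measurable_fun setT (fun w => `|f w| `^ r).
  move=> mf; apply: (@measurableT_comp _ _ _ _ _ _ (fun x : R => x `^ r)).
    exact: measurable_powR.
  exact: measurableT_comp.
by apply: measurable_funM; apply: h; [exact: measurable_x_std|exact: measurable_y_std].
Qed.

Lemma measurable_bool_fun (b : T -> bool) : measurable [set w | b w] ->
  measurable_fun setT (fun w => (b w)%:R : R).
Proof. by move=> /(@bmf_bool _ _ R) []. Qed.

Let gap_bound (x y s u e : R) : 0 < e -> x < y + e / 8 -> s - e / 8 < u -> y <= s + e / 8 ->
  2 * (x - u) <= e.
Proof. by move=> *; lra. Qed.

(* The moments beyond level M are the gap between the full moments, which
   converge, and the truncated ones, which converge by vague convergence. *)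
Lemma tail_moment (e : R) : 0 < e -> exists M : R, 0 < M /\
  \forall n \near \oo, (n%:R%:E * uexp P (fun w =>
    `|xs n w| `^ p * `|ys n w| `^ q * ((0 < xs n w) && (M <= `|ys n w|))%R%:R)%R <= e%:E)%E.
Proof.
move=> e0; have e8 : 0 < e / 8 by rewrite divr_gt0.
have [j [ep [j0 ep0 epg hj]]] := moment_gap e8.
(* Where |y| >= 2 j, truncation at [j] at least halves the product, as [q >= 1]. So half of the
   moment beyond 2 j is bounded by the gap between the full product and the truncated one. *)
exists (2 * j%:R); split; first by rewrite mulr_gt0// ltr0n.
have afin : abs_moment nu p q ep \is a fin_num.
  rewrite ge0_fin_numE ?(abs_moment_finite H2)//.
  by apply: integral_ge0 => z _; rewrite lee_fin mulr_ge0 ?powR_ge0.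
have AC := abs_moment_cvg H2 ep0 epg.
rewrite -(fineK afin) in AC.
have /fine_cvgP[nfin AC'] := AC.
have A1 : \forall n \near \oo, fine (abs_moment (rescaled_measure X Y a m psi n) p q ep) <
    fine (abs_moment nu p q ep) + e / 8.
  by apply: (cvgr_lt _ AC'); rewrite ltrDl.
have A2 : \forall n \near \oo, fine (\int[nu]_(z in E) (trunc j z)%:E)%E - e / 8 <
    n%:R * mean P (fun w => `|clamp 0 j%:R (xs n w)| `^ p *
      `|clamp (- j%:R) j%:R (ys n w)| `^ q).
  by apply: (cvgr_gt _ (@trunc_cvg j)); rewrite gtrBl.
have {}hj : fine (abs_moment nu p q ep) <= fine (\int[nu]_(z in E) (trunc j z)%:E)%E + e / 8.
  by rewrite -lee_fin EFinD (fineK afin) (fineK (trunc_fin j)); exact: hj.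
have [N0 _ HN] := filterI nfin (filterI A1 A2).
exists N0 => // n /HN [f1 [f2 f3]].
have {}f1 : abs_moment (rescaled_measure X Y a m psi n) p q ep \is a fin_num by exact: f1.
have mb : measurable [set w | (0 < xs n w) && (2 * j%:R <= `|ys n w|)].
  rewrite (_ : [set w | _] = [set w | 0 < xs n w] `&` [set w | 2 * j%:R <= `|ys n w|]).
    apply: measurableI; first exact: measurable_x_gt0.
    apply: measurable_set_le => //.
    by apply: measurableT_comp => //; exact: measurable_y_std.
  by apply/seteqP; split=> w /=; [move=> /andP[]|move=> [-> ->]].
set V := (fun w => `|xs n w| `^ p * `|ys n w| `^ q *
  ((0 < xs n w) && (2 * j%:R <= `|ys n w|))%R%:R).
have mV : measurable_fun setT V.
  by apply: measurable_funM; [exact: measurable_Phi|exact: measurable_bool_fun].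
have V0 w : 0 <= V w by rewrite /V !mulr_ge0 ?powR_ge0.
pose tr := fun w => `|clamp 0 j%:R (xs n w)| `^ p * `|clamp (- j%:R) j%:R (ys n w)| `^ q.
have btr : bmf tr.
  exact: (bmf_product X Y a m psi (ler0n R j) (jj j) (norm_powR_continuous p1)
    (norm_powR_continuous q1) (@up j) (@uq j)).
have tr0 w : 0 <= tr w by rewrite mulr_ge0 ?powR_ge0.
have key : (n%:R%:E * (uexp P tr + uexp P (fun w => 2^-1 * V w)%R) <=
    abs_moment (rescaled_measure X Y a m psi n) p q ep)%E.
  rewrite rescaled_moment; apply: lee_wpmul2l; first by rewrite lee_fin.
  rewrite -uexpD//; last 3 first.
  - by have [] := btr.
  - exact: measurable_funM.
  - by move=> w; rewrite mulr_ge0// invr_ge0.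
  apply: le_uexp.
  - by apply: measurable_funD; [have [] := btr|exact: measurable_funM].
  - apply: measurable_funM; first exact: measurable_Phi.
    apply: measurable_bool_fun; apply: measurable_set_le => //.
    exact: measurable_x_std.
  - move=> w; apply/andP; split.
      by rewrite addr_ge0// mulr_ge0// invr_ge0.
    rewrite /V /tr /Phi; have [x0|x0] := leP (xs n w) 0.
      by rewrite trunc_neg// /= mulr0 mulr0 addr0 !mulr_ge0 ?powR_ge0.
    have -> : - ep <= xs n w by rewrite (le_trans _ (ltW x0))// oppr_le0 ltW.
    rewrite mulr1 /=; have [jy|jy] := leP (2 * j%:R) `|ys n w|.
      rewrite mulr1 [leRHS]splitr [X in _ + X <= _]mulrC lerD2r.
      exact: (@trunc_half j (xs n w) _ jy).
    by rewrite mulr0 mulr0 addr0 trunc_le.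
rewrite uexpZ// (uexp_bmf P btr) -(fineK f1) in key.
have U0 : (0 <= uexp P V)%E by exact: uexp_ge0.
rewrite ge0_muleDr ?lee_fin ?mean_ge0// in key; last first.
  by rewrite mule_ge0// lee_fin invr_ge0.
rewrite -EFinM addeC -leeBrDr// -EFinB in key.
have -> : uexp P V = (2%:E * (2^-1%:E * uexp P V))%E.
  by rewrite muleA -EFinM mulfV// mul1e.
rewrite muleCA; apply: le_trans (lee_wpmul2l _ key) _; first by rewrite lee_fin.
rewrite -EFinM lee_fin; exact: gap_bound e0 f2 f3 hj.
Qed.

End moment_tail.

(** * Tails in y up to the left of x = 0 *)

Section tail_y.
Context d (T : measurableType d) (R : realType) (P : probability T R).
Variables (X Y : {RV P >-> R}) (g : R) (a m psi : R -> R).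
Variable nu : {measure set (\bar R * \bar R) -> \bar R}.
Variables p q : R.
Hypothesis H1 : extreme_assumption X Y g a m psi nu.
Hypothesis H2 : moment_assumption X Y g a m psi nu p q.
Hypotheses (p1 : 1 <= p) (q1 : 1 <= q).

Notation b := (tail_quantile X).
Notation xs := (x_std X psi).
Notation ys := (y_std X Y a m).

Lemma le_scaled_powR (z0 z : R) : 0 < z0 -> z0 <= z -> z <= z0 * z0^-1 `^ p * z `^ p.
Proof.
move=> z00 zz; have z1 : 1 <= z / z0 by rewrite ler_pdivlMr// mul1r.
have := le1r_powR z1 p1; rewrite ler_pdivrMr// => h.
apply: le_trans h _; rewrite powRM ?invr_ge0 ?(ltW z00)//; last first.
  by rewrite (le_trans _ zz)// ltW.
by rewrite le_eqVlt; apply/orP; left; apply/eqP; ring.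
Qed.

(** Pointwise form of the change of index: (x', y') is the standardization at the shifted index, and
    [be], [rh], [al], [ga] are the coefficients of the affine changes. From x > - dl one gets x' >=
    z0 > 0, and there x' is at most a multiple of its power [p]; likewise |y'| >= 1 lies below its
    power [q]. *)
Lemma shifted_moment_bound (x y x' y' be rh al ga z0 r0 r1 C M dl : R) :
  x' = be + rh * x -> y = al * y' + ga ->
  0 < z0 -> 2 * z0 <= be -> 0 < r0 -> r0 <= rh -> rh <= r1 -> r1 * dl <= z0 ->
  0 < C -> 0 <= al <= C -> `|ga| <= C -> 1 <= M -> 0 < dl ->
  - dl < x -> 2 * C * M <= `|y| ->
  [/\ 0 < x', M <= `|y'| & (1 + Num.max 0 x) * `|y| <=
    ((z0^-1 + r0^-1) * (z0 * z0^-1 `^ p) * (2 * C)) * (`|x'| `^ p * `|y'| `^ q)].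
Proof.
move=> xE yE z00 zb r00 r0rh rhr1 rd C0 /andP[al0 alC] gaC M1 d0 dx My.
have rh0 : 0 < rh by exact: lt_le_trans r0rh.
have rx : - z0 <= rh * x.
  have [x0|x0] := leP 0 x; first by have := mulr_ge0 (ltW rh0) x0; lra.
  have : rh * - x <= r1 * dl by apply: ler_pM => //; lra.
  by rewrite mulrN; lra.
have xz : z0 <= x' by rewrite xE; lra.
have x'0 : 0 < x' by exact: lt_le_trans xz.
have y1 : `|y| <= C * `|y'| + C.
  rewrite yE; apply: le_trans (ler_normD _ _) _; rewrite lerD// normrM ler_wpM2r//.
  by rewrite ger0_norm.
have CM : C * M <= C * `|y'|.
  have : C * 1 <= C * M by rewrite ler_pM2l.
  by lra.
have My' : M <= `|y'| by rewrite ler_pM2l in CM.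
have y'1 : 1 <= `|y'| by exact: le_trans My'.
have y2 : `|y| <= 2 * C * `|y'| `^ q.
  have h1 : C * 1 <= C * `|y'| by rewrite ler_pM2l.
  have h2 : C * `|y'| <= C * `|y'| `^ q by rewrite ler_pM2l// le1r_powR.
  by lra.
split=> //; rewrite (gtr0_norm x'0).
have x1 : 1 + Num.max 0 x <= (z0^-1 + r0^-1) * x'.
  have h1 : 1 <= z0^-1 * x' by rewrite mulrC ler_pdivlMr// mul1r.
  have h2 : Num.max 0 x <= r0^-1 * x'.
    rewrite ge_max mulr_ge0 ?invr_ge0 ?(ltW r00) ?(ltW x'0)//=.
    have [x0|x0] := leP 0 x; last first.
      by rewrite (le_trans (ltW x0))// mulr_ge0 ?invr_ge0 ?(ltW r00) ?(ltW x'0).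
    rewrite mulrC ler_pdivlMr// mulrC.
    have : r0 * x <= rh * x by rewrite ler_wpM2r.
    by rewrite xE; lra.
  by rewrite mulrDl lerD.
have x2 := le_scaled_powR z00 xz.
have zr : 0 <= z0^-1 + r0^-1 by rewrite addr_ge0 ?invr_ge0 ?ltW.
have x3 : 1 + Num.max 0 x <= (z0^-1 + r0^-1) * (z0 * z0^-1 `^ p * x' `^ p).
  by apply: le_trans x1 _; rewrite ler_wpM2l.
have m0 : 0 <= 1 + Num.max 0 x by rewrite addr_ge0// le_max lexx.
apply: le_trans (ler_pM m0 (normr_ge0 _) x3 y2) _.
by rewrite le_eqVlt; apply/orP; left; apply/eqP; ring.
Qed.

Let affine_change (x u v c c' : R) : c' != 0 ->
  (x - u) / c = (v - u) / c + c' / c * ((x - v) / c').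
Proof.
move=> c'0; rewrite [c' / c]mulrC -mulrA [c' * _]mulrC divfK// [c^-1 * _]mulrC -mulrDl.
by congr (_ / _); lra.
Qed.

Let Vm (M : R) (n : nat) (w : T) : R :=
  `|xs n w| `^ p * `|ys n w| `^ q * ((0 < xs n w) && (M <= `|ys n w|))%R%:R.

Let mb (c M : R) n : measurable [set w | (c < xs n w) && (M <= `|ys n w|)].
Proof.
rewrite (_ : [set w | _] = [set w | c < xs n w] `&` [set w | M <= `|ys n w|]).
  apply: measurableI; first by apply: measurable_set_lt => //; exact: measurable_x_std.
  apply: measurable_set_le => //.
  by apply: measurableT_comp => //; exact: measurable_y_std.
by apply/seteqP; split=> w /=; [move=> /andP[]|move=> [-> ->]].
Qed.

Let mVm M n : measurable_fun setT (Vm M n).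
Proof.
have h (r : R) (f : T -> R) : measurable_fun setT f ->
    measurable_fun setT (fun w => `|f w| `^ r).
  move=> mf; apply: (@measurableT_comp _ _ _ _ _ _ (fun x : R => x `^ r)).
    exact: measurable_powR.
  exact: measurableT_comp.
apply: measurable_funM; last exact: measurable_bool_fun.
by apply: measurable_funM; apply: h; [exact: measurable_x_std|exact: measurable_y_std].
Qed.

(** The weight [1 + Num.max 0 x] dominates the positive part of x - tau as soon as |tau| <= 1. *)
Definition tail_y_fun (dl M : R) (n : nat) (w : T) : R :=
  (1 + Num.max 0 (xs n w)) * `|ys n w| * ((- dl < xs n w) && (M <= `|ys n w|))%R%:R.

Lemma measurable_tail_y_fun dl M n : measurable_fun setT (tail_y_fun dl M n).
Proof.
apply: measurable_funM; last exact: measurable_bool_fun.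
apply: measurable_funM.
  apply: measurable_funD => //; apply: measurable_maxr => //; exact: measurable_x_std.
by apply: measurableT_comp => //; exact: measurable_y_std.
Qed.

Lemma tail_y_fun_ge0 dl M n w : 0 <= tail_y_fun dl M n w.
Proof. by rewrite /tail_y_fun !mulr_ge0// addr_ge0// le_max lexx. Qed.

(** By [shifted_moment_bound] the integrand at index [n] is at most a constant times the integrand
    of [tail_moment] at index [shift n]. The strip - dl < x <= 0, where the joint moment
    degenerates, is thereby covered. *)
Lemma tail_y (e : R) : 0 < e -> exists dl M : R, [/\ 0 < dl, dl <= 1, g * dl < 1, 0 < M &
  \forall n \near \oo, (n%:R%:E * uexp P (tail_y_fun dl M n) <= e%:E)%E].
Proof.
move=> e0; have g0 := index_ge0 H1.
have [C [C0 hC]] := shift_bounds H1.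
have [tp tb] := shift_types H1.
pose q0 := gpd_quantile g (10 / 9).
have q00 : 0 < q0 by rewrite -(gpd_quantile1 g) gpd_quantile_lt//; lra.
pose rho := (10 / 9 : R) `^ g.
have rho0 : 0 < rho by rewrite powR_gt0//; lra.
have [dl0 [d00 gd0 _ _]] := gpd_near0 g0 ltr01.
(* Then 2 z0 lies below the limit [q0] of the location increment, and the last term in the choice of
   [dl] ensures that x > - dl costs at most [z0] in the new variable. *)
pose z0 := q0 / 4; have z00 : 0 < z0 by rewrite divr_gt0.
pose dl := Num.min (Num.min dl0 1) (z0 / (2 * rho)).
have d0 : 0 < dl by rewrite !lt_min d00 ltr01 divr_gt0// mulr_gt0.
have d1 : dl <= 1 by rewrite !ge_min lexx orbT.
have gd : g * dl < 1.
  by apply: le_lt_trans gd0; rewrite ler_wpM2l// !ge_min lexx.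
have rd : (2 * rho) * dl <= z0.
  by rewrite mulrC -ler_pdivlMr ?mulr_gt0// ge_min lexx orbT.
pose K := (z0^-1 + (rho / 2)^-1) * (z0 * z0^-1 `^ p) * (2 * C).
have K0 : 0 < K.
  rewrite !mulr_gt0// ?powR_gt0 ?invr_gt0// addr_gt0// invr_gt0// divr_gt0//.
(* [K] comes from the pointwise bound and 2 bounds n / shift n. *)
have e'0 : 0 < e / (2 * K) by rewrite divr_gt0// mulr_gt0.
have [M0 [M00 hM]] := tail_moment H1 H2 p1 q1 e'0.
pose M := Num.max 1 M0.
have M1 : 1 <= M by rewrite le_max lexx.
exists dl, (2 * C * M); split=> //; first by rewrite !mulr_gt0// (lt_le_trans ltr01).
have F1 : \forall n \near \oo, psi (b n%:R) / psi (b (shift n)%:R) < 2 * rho.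
  by apply: (cvgr_lt _ tp); rewrite ltr_pMl// ltr1n.
have F2 : \forall n \near \oo, rho / 2 < psi (b n%:R) / psi (b (shift n)%:R).
  by apply: (cvgr_gt _ tp); rewrite ltr_pdivrMr// ltr_pMr// ltr1n.
have F3 : \forall n \near \oo, 2 * z0 < (b n%:R - b (shift n)%:R) / psi (b (shift n)%:R).
  by apply: (cvgr_gt _ tb); rewrite /z0 -/q0; lra.
have F4 : \forall n \near \oo, n%:R / (shift n)%:R < 2 :> R.
  by apply: (cvgr_lt _ (@shift_ratio_cvg R)); lra.
have F5 := near_shift (scales_gt0 H1).
have F6 := near_shift hM.
have F7 := near_shift (nbhs_infty_gt 0).
have [N0 _ HN] := filterI F1 (filterI F2 (filterI F3 (filterI F4 (filterI F5 (filterI F6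
  (filterI F7 (filterI hC (scales_gt0 H1)))))))).
exists N0 => // n /HN [f1 [f2 [f3 [f4 [[f5 f5'] [f6 [f7 [[f8 f8'] [f9 f9']]]]]]]]].
have k0 : 0 < (shift n)%:R :> R by rewrite ltr0n.
have gaC : `|(m (b (shift n)%:R) - m (b n%:R)) / a (b n%:R)| <= C.
  rewrite normrM distrC (gtr0_norm (x := (a (b n%:R))^-1)) ?invr_gt0//.
  by rewrite ler_pdivrMr.
have alC : 0 <= a (b (shift n)%:R) / a (b n%:R) <= C.
  by rewrite ler_pdivrMr// f8 andbT; apply: divr_ge0; exact: ltW.
have V0 w : 0 <= Vm M0 (shift n) w by rewrite /Vm !mulr_ge0 ?powR_ge0.
have bound : (uexp P (tail_y_fun dl (2 * C * M) n) <=
    uexp P (fun w => K * Vm M0 (shift n) w)%R)%E.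
  apply: le_uexp; [exact: measurable_tail_y_fun|by apply: measurable_funM|].
  move=> w; rewrite tail_y_fun_ge0/= /tail_y_fun.
  case: andP => [[dx My]|_]; last by rewrite mulr0 mulr_ge0// ltW.
  rewrite mulr1.
  have [x'0 My' h] := @shifted_moment_bound (xs n w) (ys n w) (xs (shift n) w)
    (ys (shift n) w) ((b n%:R - b (shift n)%:R) / psi (b (shift n)%:R))
    (psi (b n%:R) / psi (b (shift n)%:R)) (a (b (shift n)%:R) / a (b n%:R))
    ((m (b (shift n)%:R) - m (b n%:R)) / a (b n%:R)) z0 (rho / 2) (2 * rho) C M dl
    ltac:(by apply: affine_change; rewrite gt_eqF)
    ltac:(by rewrite addrC; apply: affine_change; rewrite gt_eqF)
    z00 (ltW f3) ltac:(by rewrite divr_gt0) (ltW f2) (ltW f1) rd C0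
    alC
    gaC M1 d0 dx My.
  apply: le_trans h _; rewrite /Vm x'0 (le_trans _ My') ?mulr1//.
  by rewrite le_max lexx orbT.
apply: le_trans (lee_wpmul2l _ bound) _; first by rewrite lee_fin.
rewrite uexpZ//; last exact: ltW.
apply: (@le_trans _ _ ((2 * K)%:E * ((shift n)%:R%:E * uexp P (Vm M0 (shift n))))%E).
  rewrite !muleA -!EFinM lee_wpmul2r ?uexp_ge0// lee_fin.
  rewrite ltr_pdivrMr// in f4.
  by rewrite mulrAC ler_pM2r// ltW.
apply: le_trans (lee_wpmul2l _ f6) _; first by rewrite lee_fin mulr_ge0// ltW.
by rewrite -EFinM lee_fin mulrC divfK// gt_eqF// mulr_gt0.
Qed.

End tail_y.

(** * Weak law of large numbers *)

Section iid_sums.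
Context d (T : measurableType d) (R : realType) (P : probability T R).
Variables (X Y : {RV P >-> R}) (X_ Y_ : nat -> {RV P >-> R}).
Hypothesis Hiid : iid_copies X Y X_ Y_.

Definition rv_pair (U V : {RV P >-> R}) (w : T) : R * R := (U w, V w).

Lemma measurable_rv_pair U V : measurable_fun setT (rv_pair U V).
Proof. exact: measurable_fun_pair. Qed.

HB.instance Definition _ U V :=
  @isMeasurableFun.Build _ _ _ _ (rv_pair U V) (measurable_rv_pair U V).

Definition rv_pair2 (U V U' V' : {RV P >-> R}) (w : T) : (R * R) * (R * R) :=
  (rv_pair U V w, rv_pair U' V' w).

Lemma measurable_rv_pair2 U V U' V' : measurable_fun setT (rv_pair2 U V U' V').
Proof. by apply: measurable_fun_pair; exact: measurable_rv_pair. Qed.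

HB.instance Definition _ U V U' V' :=
  @isMeasurableFun.Build _ _ _ _ (rv_pair2 U V U' V') (measurable_rv_pair2 U V U' V').

Let law := distribution P (rv_pair X Y).

Let uexp_law (U V : {RV P >-> R}) (u : R * R -> R) :
  measurable_fun setT u -> (forall z, 0 <= u z) ->
  (forall B, measurable B -> distribution P (rv_pair U V) B = law B) ->
  uexp P (fun w => u (rv_pair U V w)) = (\int[law]_z (u z)%:E)%E.
Proof.
move=> mu u0 h.
rewrite (@eq_measure_integral _ _ _ setT (distribution P (rv_pair U V))); last first.
  by move=> A mA _; symmetry; exact: h.
rewrite ge0_integral_pushforward//; first exact/measurable_EFinP.
by move=> z _; rewrite lee_fin.
Qed.

Lemma uexp_copy (u : R * R -> R) (i : nat) : measurable_fun setT u -> (forall z, 0 <= u z) ->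
  uexp P (fun w => u (X_ i w, Y_ i w)) = uexp P (fun w => u (X w, Y w)).
Proof.
move=> mu u0; have [h1 _] := Hiid.
rewrite -[LHS]/(uexp P (fun w => u (rv_pair (X_ i) (Y_ i) w))).
rewrite -[RHS]/(uexp P (fun w => u (rv_pair X Y w))).
by rewrite !uexp_law// => B mB; exact: h1.
Qed.

(** The joint law of the two pairs agrees with the product law on rectangles, hence everywhere, and
    Tonelli's theorem factors the integral. *)
Lemma uexp_indep (u v : R * R -> R) (i j : nat) : i != j ->
  measurable_fun setT u -> measurable_fun setT v ->
  (forall z, 0 <= u z) -> (forall z, 0 <= v z) ->
  uexp P (fun w => u (X_ i w, Y_ i w) * v (X_ j w, Y_ j w)) =
  (uexp P (fun w => u (X w, Y w)) * uexp P (fun w => v (X w, Y w)))%E.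
Proof.
move=> ij mu mv u0 v0; have [h1 h2] := Hiid.
pose W := rv_pair2 (X_ i) (Y_ i) (X_ j) (Y_ j).
have rect (A B : set (R * R)) : measurable A -> measurable B ->
    distribution P W (A `*` B) = (law A * law B)%E.
  move=> mA mB.
  pose C n : set (R * R) := if n == i then A else B.
  have uij : uniq [:: i; j] by rewrite /= inE ij.
  have mC n : measurable (C n) by rewrite /C; case: ifP.
  have := h2 [:: i; j] C uij mC.
  rewrite big_cons big_cons big_nil mule1 /C eqxx eq_sym (negbTE ij).
  have e1 : P [set w | A (X_ i w, Y_ i w)] = law A by exact: h1.
  have e2 : P [set w | B (X_ j w, Y_ j w)] = law B by exact: h1.
  rewrite e1 e2 => <-; congr (P _); apply/seteqP; split=> w /=.
    move=> [Aw Bw] n /=; rewrite !inE => /orP[|] /eqP ->; first by rewrite eqxx.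
    by rewrite eq_sym (negbTE ij).
  move=> h; split; first by have := h i; rewrite /= inE eqxx; apply.
  have := h j; rewrite /= !inE eqxx orbT eq_sym (negbTE ij); exact.
have prodE (A : set ((R * R) * (R * R))) : measurable A ->
    distribution P W A = (law \x law)%E A.
  by move=> mA; symmetry; apply: (product_measure_unique (m' := distribution P W)).
pose f (z : (R * R) * (R * R)) : \bar R := (u z.1 * v z.2)%:E.
have mf : measurable_fun setT f.
  by apply/measurable_EFinP; apply: measurable_funM; exact: measurableT_comp.
have f0 z : (0 <= f z)%E by rewrite lee_fin mulr_ge0.
have -> : uexp P (fun w => u (X_ i w, Y_ i w) * v (X_ j w, Y_ j w)) =
    (\int[distribution P W]_z f z)%E.
  by rewrite ge0_integral_pushforward.
rewrite (@eq_measure_integral _ _ _ setT (law \x law)%E); last first.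
  by move=> A mA _; exact: prodE.
rewrite fubini_tonelli1//.
have hu : uexp P (fun w => u (X w, Y w)) = (\int[law]_z (u z)%:E)%E.
  by rewrite -[LHS]/(uexp P (fun w => u (rv_pair X Y w))) uexp_law.
have hv : uexp P (fun w => v (X w, Y w)) = (\int[law]_z (v z)%:E)%E.
  by rewrite -[LHS]/(uexp P (fun w => v (rv_pair X Y w))) uexp_law.
have hv0 : (0 <= \int[law]_z (v z)%:E)%E by apply: integral_ge0 => z _; rewrite lee_fin.
have muE : measurable_fun setT (EFin \o u) by exact/measurable_EFinP.
have mvE : measurable_fun setT (EFin \o v) by exact/measurable_EFinP.
have uE0 z : setT z -> (0 <= (EFin \o u) z)%E by move=> _; rewrite /= lee_fin.
have vE0 z : setT z -> (0 <= (EFin \o v) z)%E by move=> _; rewrite /= lee_fin.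
rewrite hu hv -(ge0_integralZr law measurableT muE uE0 hv0).
apply: eq_integral => z _; rewrite /fubini_F /f /=.
under eq_integral do rewrite EFinM.
by rewrite (ge0_integralZl law measurableT mvE vE0)//= lee_fin.
Qed.

Lemma bmf_comp (U V : {RV P >-> R}) (u : R * R -> R) (B : R) :
  measurable_fun setT u -> (forall z, `|u z| <= B) -> bmf (fun w => u (U w, V w)).
Proof.
move=> mu uB; split; last by exists B.
by apply: (measurableT_comp mu); exact: measurable_rv_pair.
Qed.

Section chebyshev.
Variables (u : R * R -> R) (B : R).
Hypotheses (mu : measurable_fun setT u) (uB : forall z, `|u z| <= B).

Let uc i w := u (X_ i w, Y_ i w).
Let u1 w := u (X w, Y w).
Let buc i : bmf (uc i). Proof. exact: bmf_comp uB. Qed.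
Let bu1 : bmf u1. Proof. exact: bmf_comp uB. Qed.
Let B0 : 0 <= B. Proof. exact: le_trans (uB (0, 0)). Qed.

(** Adding [B] makes the signed function [u] nonnegative, as [uexp_copy] and [uexp_indep] require;
    linearity removes the shift afterwards. *)
Let uBp z : 0 <= u z + B.
Proof. by have := uB z; rewrite ler_norml => /andP[h _]; lra. Qed.

Let mup : measurable_fun setT (fun z => u z + B).
Proof. exact: measurable_funD. Qed.

Let mean_ucp i : mean P (fun w => uc i w + B) = mean P (fun w => u1 w + B).
Proof.
apply: EFin_inj; rewrite -!uexp_bmf; [|by apply: bmfD => //; exact: bmf_cst|by apply: bmfD => //; exact: bmf_cst].
exact: (uexp_copy i mup uBp).
Qed.

Let mean_uc i : mean P (uc i) = mean P u1.
Proof.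
have := mean_ucp i; rewrite !meanD//; try exact: bmf_cst.
by move/addIr.
Qed.

Let mean_ucM i j : i != j -> mean P (fun w => uc i w * uc j w) = mean P u1 * mean P u1.
Proof.
move=> ij.
have bp l : bmf (fun w => uc l w + B) by apply: bmfD => //; exact: bmf_cst.
have h : mean P (fun w => (uc i w + B) * (uc j w + B)) =
    mean P (fun w => u1 w + B) * mean P (fun w => u1 w + B).
  apply: EFin_inj; rewrite EFinM -!uexp_bmf.
  - exact: (uexp_indep ij mup mup uBp uBp).
  - by apply: bmfD => //; exact: bmf_cst.
  - exact: bmfM.
have E : mean P (fun w => (uc i w + B) * (uc j w + B)) =
    mean P (fun w => uc i w * uc j w) + (B * mean P (uc i) + (B * mean P (uc j) + B * B)).
  rewrite -(mean_cst P (B * B)) -(meanZ P B (buc i)) -(meanZ P B (buc j)) -!meanD//.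
  - by congr mean; apply/funext => w; ring.
  - exact: bmfM.
  - by apply: bmfD; [exact: bmfZ|apply: bmfD; [exact: bmfZ|exact: bmf_cst]].
  - exact: bmfZ.
  - by apply: bmfD; [exact: bmfZ|exact: bmf_cst].
  - exact: bmfZ.
  - exact: bmf_cst.
rewrite E !mean_uc meanD// in h; last exact: bmf_cst.
by rewrite mean_cst in h; lra.
Qed.

Let v i w := uc i w - mean P u1.
Let bv i : bmf (v i). Proof. by apply: bmfB => //; exact: bmf_cst. Qed.

Let mean_vM i j : i != j -> mean P (fun w => v i w * v j w) = 0.
Proof.
move=> ij; set c := mean P u1.
have -> : mean P (fun w => v i w * v j w) =
    mean P (fun w => uc i w * uc j w) - (c * mean P (uc i) + (c * mean P (uc j) - c * c)).
  rewrite -(mean_cst P (c * c)) -(meanZ P c (buc i)) -(meanZ P c (buc j)) -meanB//; last 2 first.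
  - exact: bmfZ.
  - exact: bmf_cst.
  rewrite -meanD//; last 2 first.
  - exact: bmfZ.
  - by apply: bmfB; [exact: bmfZ|exact: bmf_cst].
  rewrite -meanB; last 2 first.
  - exact: bmfM.
  - by apply: bmfD; [exact: bmfZ|apply: bmfB; [exact: bmfZ|exact: bmf_cst]].
  by congr mean; apply/funext => w; rewrite /v -/c; ring.
by rewrite mean_ucM// !mean_uc -/c; ring.
Qed.

Let mean_v2 i : mean P (fun w => v i w * v i w) <= B * mean P (fun w => `|u1 w|).
Proof.
set c := mean P u1.
have bM : bmf (fun w => uc i w * uc i w) by exact: bmfM.
have -> : mean P (fun w => v i w * v i w) = mean P (fun w => uc i w * uc i w) - c * c.
  have -> : mean P (fun w => v i w * v i w) =
      mean P (fun w => uc i w * uc i w) - (2 * c * mean P (uc i) - c * c).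
    rewrite -(mean_cst P (c * c)) -(meanZ P (2 * c) (buc i)) -meanB//; last 2 first.
    - exact: bmfZ.
    - exact: bmf_cst.
    rewrite -meanB//; last by apply: bmfB; [exact: bmfZ|exact: bmf_cst].
    by congr mean; apply/funext => w; rewrite /v -/c; ring.
  by rewrite mean_uc -/c; ring.
have c2 : 0 <= c * c by rewrite -expr2 sqr_ge0.
apply: (@le_trans _ _ (mean P (fun w => uc i w * uc i w))); first by rewrite gerBl.
have abs_copy : mean P (fun w => `|uc i w|) = mean P (fun w => `|u1 w|).
  have mn : measurable_fun setT (fun z => `|u z|) by exact: measurableT_comp.
  apply: EFin_inj; rewrite -!uexp_bmf.
  - by apply: (uexp_copy i mn) => z.
  - by apply: (@bmf_comp X Y (fun z => `|u z|) B) => // z; rewrite normr_id.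
  - by apply: (@bmf_comp (X_ i) (Y_ i) (fun z => `|u z|) B) => // z; rewrite normr_id.
have bn : bmf (fun w => `|uc i w|).
  apply: (@bmf_comp (X_ i) (Y_ i) (fun z => `|u z|) B) => //; last by move=> z; rewrite normr_id.
  exact: measurableT_comp.
rewrite -abs_copy -meanZ//; apply: le_mean => //; first exact: bmfZ.
move=> w; apply: (@le_trans _ _ `|uc i w * uc i w|); first exact: ler_norm.
by rewrite normrM; apply: ler_wpM2r => //; exact: uB.
Qed.

Let sum_v n w := \sum_(i < n) v i w.

Let bsum n : bmf (sum_v n). Proof. by apply: bmf_sum => i; exact: bv. Qed.

Let second_moment n :
  mean P (fun w => sum_v n w * sum_v n w) <= n%:R * (B * mean P (fun w => `|u1 w|)).
Proof.
elim: n => [|n IH].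
  rewrite mul0r -(mean_cst P 0) (_ : (fun w => sum_v 0 w * sum_v 0 w) = fun=> 0)//.
  by apply/funext => w; rewrite /sum_v big_ord0 mul0r.
have cross : mean P (fun w => sum_v n w * v n w) = 0.
  rewrite (_ : (fun w => sum_v n w * v n w) = fun w => \sum_(i < n) v i w * v n w).
    rewrite mean_sum => [|i]; last exact: bmfM.
    by apply: big1 => i _; apply: mean_vM; rewrite neq_ltn ltn_ord.
  by apply/funext => w; rewrite /sum_v mulr_suml.
have -> : mean P (fun w => sum_v n.+1 w * sum_v n.+1 w) =
    mean P (fun w => sum_v n w * sum_v n w) + (2 * mean P (fun w => sum_v n w * v n w) +
    mean P (fun w => v n w * v n w)).
  rewrite -meanZ; last exact: bmfM.
  rewrite -meanD; [|by apply: bmfZ; exact: bmfM|exact: bmfM].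
  rewrite -meanD; [|exact: bmfM|by apply: bmfD; [apply: bmfZ|]; exact: bmfM].
  by congr mean; apply/funext => w; rewrite /sum_v big_ord_recr /=; ring.
rewrite cross mulr0 add0r mulrSr mulrDl mul1r.
by apply: lerD => //; exact: mean_v2.
Qed.

(** Each variance is bounded by B E|u| instead of B^2. In the arrays considered E|u| is of order
    k/n, so the variance of the sum divided by k is of order 1/k. *)
Lemma sum_chebyshev (n : nat) (e : R) : 0 < e ->
  e ^+ 2 * pr P [set w | e <= `|\sum_(i < n) uc i w - n%:R * mean P u1|] <=
  n%:R * (B * mean P (fun w => `|u1 w|)).
Proof.
move=> e0; apply: le_trans (second_moment n).
have e2 : 0 < e ^+ 2 by rewrite exprn_gt0.
have sE w : \sum_(i < n) uc i w - n%:R * mean P u1 = sum_v n w.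
  by rewrite /sum_v /v sumrB sumr_const card_ord mulr_natl.
have bs : bmf (fun w => sum_v n w * sum_v n w) by exact: bmfM.
have sq0 w : 0 <= sum_v n w * sum_v n w by rewrite -expr2 sqr_ge0.
have := @uexp_markov _ _ _ P (fun w => sum_v n w * sum_v n w) (e ^+ 2) bs.1
  sq0 e2.
rewrite (uexp_bmf P bs).
rewrite (_ : [set w | e ^+ 2 <= sum_v n w * sum_v n w] =
    [set w | e <= `|\sum_(i < n) uc i w - n%:R * mean P u1|]).
  rewrite prE ?lee_fin//.
  apply: measurable_set_le => //; apply: measurableT_comp => //.
  by rewrite (_ : (fun w => _) = sum_v n); [have [] := bsum n|apply/funext].
have eqv (z : R) : (e ^+ 2 <= z * z) = (e <= `|z|).
  by rewrite -[z * z]expr2 -(real_normK (num_real z)) ler_pXn2r ?nnegrE ?(ltW e0).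
by apply/seteqP; split=> w /=; rewrite sE eqv.
Qed.

End chebyshev.
End iid_sums.

(** * Convergence in probability along a filter *)

Section convergence_in_probability.
Context d (T : measurableType d) (R : realType) (P : probability T R).

(* Z n w tends to l along this filter iff Z n tends to l in probability: the
   calculus of limits becomes available for convergence in probability. *)
Definition prob_filter : set_system (nat * T) := [set B | exists E : nat -> set T,
  [/\ forall n, measurable (E n), (fun n => pr P (E n)) @ \oo --> (0:R) &
      forall n w, ~ E n w -> B (n, w)]].

#[global] Instance prob_filter_filter : Filter prob_filter.
Proof.
split.
- exists (fun=> set0); split=> //.
  rewrite (_ : (fun n : nat => pr P set0) = fun=> 0); first exact: cvg_cst.
  by apply/funext => n; rewrite /pr measure0.
- move=> A B [E [mE E0 hE]] [F [mF F0 hF]]; exists (fun n => E n `|` F n); split.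
  + by move=> n; exact: measurableU.
  + have h : (fun n => pr P (E n) + pr P (F n)) @ \oo --> (0 + 0:R) by exact: cvgD.
    rewrite addr0 in h.
    have h0 : (fun _ : nat => 0:R) @ \oo --> (0:R) by exact: cvg_cst.
    apply: (squeeze_cvgr _ h0 h); apply: nearW => n.
    by rewrite pr_ge0 le_prU.
  + by move=> n w /not_orP[nE nF]; split; [exact: hE|exact: hF].
- move=> A B AB [E [mE E0 hE]]; exists E; split=> // n w /hE; exact: AB.
Qed.

Lemma fst_prob_filter : (fun nw : nat * T => nw.1) @ prob_filter --> \oo.
Proof.
move=> A [N _ hA]; exists (fun n => if (n < N)%N then setT else set0); split.
- by move=> n; case: ifP.
- have h0 : (fun _ : nat => 0:R) @ \oo --> (0:R) by exact: cvg_cst.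
  apply: cvg_trans h0; apply: near_eq_cvg; exists N => // n /= Nn.
  by rewrite ltnNge Nn /= /pr measure0.
- by move=> n w; case: ltnP => [_ /(_ I)//|Nn _]; exact: hA.
Qed.

Lemma near_prob_filter (A : nat -> Prop) : (\forall n \near \oo, A n) ->
  \forall nw \near prob_filter, A nw.1.
Proof. by move=> h; exact: (fst_prob_filter h). Qed.

Lemma cvg_in_probabilityP (Z : nat -> T -> R) (l : R) :
  (forall n, measurable_fun setT (Z n)) ->
  cvg_in_probability P Z l <-> (fun nw => Z nw.1 nw.2) @ prob_filter --> l.
Proof.
move=> mZ.
have mA e n : measurable [set w | e < `|Z n w - l|].
  apply: measurable_set_lt => //; apply: measurableT_comp => //.
  exact: measurable_funB.
split=> h.
- apply/cvgrPdist_lt => e e0; have e2 : 0 < e / 2 by rewrite divr_gt0.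
  exists (fun n => [set w | e / 2 < `|Z n w - l|]); split=> //.
    by have /fine_cvgP[_] := h _ e2.
  move=> n w /negP; rewrite -leNgt distrC => h2; apply: le_lt_trans h2 _.
  by rewrite ltr_pdivrMr// ltr_pMr// ltr1n.
- move=> e e0; have /cvgrPdist_lt/(_ _ e0) [E [mE E0 hE]] := h.
  rewrite (_ : (fun n => P _) = fun n => (pr P [set w | e < `|Z n w - l|])%:E); last first.
    by apply/funext => n; rewrite prE.
  apply: cvg_EFin; first exact: nearW.
  have h0 : (fun _ : nat => 0:R) @ \oo --> (0:R) by exact: cvg_cst.
  apply: (squeeze_cvgr _ h0 E0); apply: nearW => n /=.
  rewrite pr_ge0 le_pr// => w /=; apply: contraPP => /hE /=.
  by rewrite distrC => h1; apply/negP; rewrite -leNgt ltW.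
Qed.

(** Approximation principle for limits in probability: up to a quantity [S] tending to 0, the
    distance from [Z] to a convergent [W] is at most a nonnegative [Q] of small expectation, which
    Markov's inequality makes negligible. *)
Lemma prob_approx (Z : nat -> T -> R) (l : R) : (forall n, measurable_fun setT (Z n)) ->
  (forall h : R, 0 < h -> exists (W S : nat * T -> R) (Q : nat -> T -> R) (l' : R),
    [/\ `|l' - l| <= h, W @ prob_filter --> l', S @ prob_filter --> (0:R),
        (forall n, measurable_fun setT (Q n) /\ forall w, 0 <= Q n w) &
        (\forall n \near \oo, (uexp P (Q n) <= h%:E)%E) /\
        (\forall nw \near prob_filter, `|Z nw.1 nw.2 - W nw| <= S nw + Q nw.1 nw.2)]) ->
  (fun nw => Z nw.1 nw.2) @ prob_filter --> l.
Proof.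
move=> mZ H; apply/cvg_in_probabilityP => // e e0.
have mA n : measurable [set w | e < `|Z n w - l|].
  apply: measurable_set_lt => //; apply: measurableT_comp => //.
  exact: measurable_funB.
rewrite (_ : (fun n => P _) = fun n => (pr P [set w | e < `|Z n w - l|])%:E); last first.
  by apply/funext => n; rewrite prE.
apply: cvg_EFin; first exact: nearW.
apply/cvgr0Pnorm_lt => r r0.
(* The first bound controls the shift of the limit; the second makes Markov's inequality give
   probability at most r / 4 for [Q n >= e / 2]. *)
pose h := Num.min (e / 8) (r * e / 8).
have h0 : 0 < h by rewrite lt_min divr_gt0//= divr_gt0// mulr_gt0.
have he : h <= e / 8 by rewrite ge_min lexx.
have hr : h <= r * e / 8 by rewrite ge_min lexx orbT.
have [W [S [Q [l' [ll' Wl S0 mQ [uQ ZW]]]]]] := H h h0.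
have e8 : 0 < e / 8 by rewrite divr_gt0.
have good : \forall nw \near prob_filter, `|Z nw.1 nw.2 - l| <= e / 2 + Q nw.1 nw.2.
  have /cvgrPdist_lt/(_ _ e8) A := Wl.
  have /cvgr0Pnorm_lt/(_ _ e8) B := S0.
  near=> nw.
  have a1 : `|l' - W nw| < e / 8 by near: nw.
  have b1 : `|S nw| < e / 8 by near: nw.
  have c1 : `|Z nw.1 nw.2 - W nw| <= S nw + Q nw.1 nw.2 by near: nw.
  have -> : Z nw.1 nw.2 - l = (Z nw.1 nw.2 - W nw) + (- (l' - W nw) + (l' - l)) by ring.
  apply: le_trans (ler_normD _ _) _.
  have := ler_normD (- (l' - W nw)) (l' - l); rewrite normrN.
  have := ler_norm (S nw).
  lra.
have [E [mE E0 hE]] := good.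
have E1 : \forall n \near \oo, pr P (E n) < r / 2.
  by apply: (cvgr_lt _ E0); rewrite divr_gt0.
near=> n.
have en : pr P (E n) < r / 2 by near: n.
have un : (uexp P (Q n) <= h%:E)%E by near: n.
have [mQn Q0] := mQ n.
have mQe : measurable [set w | e / 2 <= Q n w] by exact: measurable_set_le.
have e2 : 0 < e / 2 by rewrite divr_gt0.
have mk : pr P [set w | e / 2 <= Q n w] <= r / 4.
  have := le_trans (uexp_markov P mQn Q0 e2) un.
  rewrite prE// -EFinM lee_fin => k1.
  have : e * pr P [set w | e / 2 <= Q n w] <= e * (r / 4) by lra.
  by rewrite ler_pM2l.
have sub : [set w | e < `|Z n w - l|] `<=` E n `|` [set w | e / 2 <= Q n w].
  move=> w /= hw; have [|nE] := pselect (E n w); [by left|right].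
  by have /= := hE n w nE; lra.
have := le_pr P (mA n) (measurableU _ _ (mE n) mQe) sub.
have := le_prU P (mE n) mQe.
rewrite /= ger0_norm ?pr_ge0//; lra.
Unshelve. all: by end_near. Qed.

End convergence_in_probability.

(** * Triangular arrays normalized by k *)

Section weak_law.
Context d (T : measurableType d) (R : realType) (P : probability T R).
Variables (X Y : {RV P >-> R}) (X_ Y_ : nat -> {RV P >-> R}).
Hypothesis Hiid : iid_copies X Y X_ Y_.
Variable k : nat -> nat.
Hypothesis k_cvg : k @ \oo --> \oo.

Definition array_mean (f : nat -> R * R -> R) (n : nat) (w : T) : R :=
  (k n)%:R^-1 * \sum_(i < n) f n (X_ i w, Y_ i w).

Lemma measurable_array_mean (f : nat -> R * R -> R) n : measurable_fun setT (f n) ->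
  measurable_fun setT (array_mean f n).
Proof.
move=> mf; apply: measurable_funM => //.
apply: measurable_sum => i; apply: (measurableT_comp mf).
exact: measurable_rv_pair.
Qed.

Lemma uexp_array_mean (f : nat -> R * R -> R) n : measurable_fun setT (f n) -> (forall z, 0 <= f n z) ->
  uexp P (array_mean f n) = ((n%:R / (k n)%:R)%:E * uexp P (fun w => f n (X w, Y w)))%E.
Proof.
move=> mf f0.
have mfi i : measurable_fun setT (fun w => f n (X_ i w, Y_ i w)).
  by apply: (measurableT_comp mf); exact: measurable_rv_pair.
rewrite uexpZ ?invr_ge0//; last 2 first.
- exact: measurable_sum.
- by move=> w; exact: sumr_ge0.
rewrite mulrC EFinM -muleA; congr (_ * _)%E.
rewrite /uexp; under eq_integral do rewrite -sumEFin.
rewrite ge0_integral_sum//; last 2 first.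
- by move=> i; apply/measurable_EFinP.
- by move=> i w _; rewrite lee_fin.
under eq_bigr => i _ do rewrite -/(uexp P (fun w => f n (X_ i w, Y_ i w)))
  (uexp_copy Hiid i mf f0).
rewrite -/(uexp P (fun w => f n (X w, Y w))).
have := uexp_ge0 P (fun w => f0 (X w, Y w)).
move: (uexp P _) => c c0; elim: n {mf f0 mfi} => [|n IH]; first by rewrite big_ord0 mul0e.
by rewrite big_ord_recr /= IH mulrSr EFinD ge0_muleDl ?lee_fin// mul1e.
Qed.

(** [sum_chebyshev] with deviation [e * k n] bounds the probability by B C / (e^2 k), where [C]
    bounds the normalized first absolute moment. *)
Lemma weak_lln (f : nat -> R * R -> R) (B C l : R) :
  (forall n, measurable_fun setT (f n)) -> (forall n z, `|f n z| <= B) ->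
  (fun n => n%:R / (k n)%:R * mean P (fun w => f n (X w, Y w))) @ \oo --> l ->
  (\forall n \near \oo, n%:R / (k n)%:R * mean P (fun w => `|f n (X w, Y w)|) <= C) ->
  (fun nw => array_mean f nw.1 nw.2) @ prob_filter P --> l.
Proof.
move=> mf fB fl fC.
pose mu n := mean P (fun w => f n (X w, Y w)).
have mdev n : measurable_fun setT (fun w => array_mean f n w - n%:R / (k n)%:R * mu n).
  by apply: measurable_funB => //; exact: measurable_array_mean.
have dev : (fun nw => array_mean f nw.1 nw.2 - nw.1%:R / (k nw.1)%:R * mu nw.1)
    @ prob_filter P --> (0:R).
  apply/(@cvg_in_probabilityP _ _ _ P
    (fun n w => array_mean f n w - n%:R / (k n)%:R * mu n)) => // e e0.
  rewrite (_ : (fun n => P _) = fun n =>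
      (pr P [set w | e < `|array_mean f n w - n%:R / (k n)%:R * mu n - 0|])%:E); last first.
    apply/funext => n; rewrite prE//; apply: measurable_set_lt => //.
    by apply: measurableT_comp => //; apply: measurable_funB.
  apply: cvg_EFin; first exact: nearW.
  have kinv : (fun n => (k n)%:R^-1 : R) @ \oo --> (0:R).
    exact: (cvg_comp _ _ k_cvg (@cvg_invn R)).
  have up : (fun n => B * C / e ^+ 2 * (k n)%:R^-1) @ \oo --> (B * C / e ^+ 2 * 0 : R).
    by apply: cvgM => //; exact: cvg_cst.
  rewrite mulr0 in up.
  have h0 : (fun _ : nat => 0:R) @ \oo --> (0:R) by exact: cvg_cst.
  apply: (squeeze_cvgr _ h0 up); near=> n; rewrite pr_ge0/=.
  have k0 : 0 < (k n)%:R :> R.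
    by rewrite ltr0n; near: n; exact: (k_cvg (nbhs_infty_gt 0)).
  have cn : n%:R / (k n)%:R * mean P (fun w => `|f n (X w, Y w)|) <= C by near: n.
  have ek : 0 < e * (k n)%:R by rewrite mulr_gt0.
  have B0 : 0 <= B by apply: le_trans (fB 0%N (0, 0)).
  have := sum_chebyshev Hiid (mf n) (fB n) n ek; rewrite -/(mu n).
  set A := [set w | _] => ch.
  have mA : measurable A.
    apply: measurable_set_le => //; apply: measurableT_comp => //.
    apply: measurable_funB => //; apply: measurable_sum => i.
    by apply: (measurableT_comp (mf n)); exact: measurable_rv_pair.
  apply: (@le_trans _ _ (pr P A)).
    apply: le_pr => //.
      apply: measurable_set_lt => //; apply: measurableT_comp => //.
      by apply: measurable_funB.
    move=> w /=; rewrite subr0 /A /array_mean /= => h.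
    have -> : \sum_(i < n) f n (X_ i w, Y_ i w) - n%:R * mu n =
        (k n)%:R * ((k n)%:R^-1 * \sum_(i < n) f n (X_ i w, Y_ i w) - n%:R / (k n)%:R * mu n).
      by rewrite mulrBr mulVKf ?gt_eqF// mulrA [_ * (n%:R / _)]mulrC divfK// gt_eqF.
    by rewrite normrM (gtr0_norm k0) [e * _]mulrC ler_pM2l// ltW.
  have e2 : 0 < (e * (k n)%:R) ^+ 2 by rewrite exprn_gt0.
  rewrite -(ler_pM2l e2); apply: le_trans ch _.
  have -> : (e * (k n)%:R) ^+ 2 * (B * C / e ^+ 2 / (k n)%:R) = B * (C * (k n)%:R).
    by field; rewrite !gt_eqF.
  rewrite mulrCA ler_wpM2l//.
  by move: cn; rewrite mulrAC ler_pdivrMr.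
have main : (fun nw => (array_mean f nw.1 nw.2 - nw.1%:R / (k nw.1)%:R * mu nw.1) +
    nw.1%:R / (k nw.1)%:R * mu nw.1) @ prob_filter P --> (0 + l : R).
  by apply: cvgD => //; exact: (cvg_comp _ _ (@fst_prob_filter _ _ _ P) fl).
rewrite add0r in main; apply: cvg_trans main; apply: near_eq_cvg.
by near=> nw; rewrite subrK.
Unshelve. all: by end_near. Qed.

End weak_law.

(** * Order statistics *)

Section order_statistics.
Variable R : realType.
Implicit Types (x y : nat -> R) (n k i l : nat) (t : R).

(** One sorted list of which order statistics and concomitants are the two projections, so that they
    share one permutation of the sample. *)
Let pairs x y n := sort (fun u v : R * R => u.1 <= v.1) [seq (x j, y j) | j <- iota 0 n].

Let size_pairs x y n : size (pairs x y n) = n.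
Proof. by rewrite size_sort size_map size_iota. Qed.

Let fst_pairs x y n : sort <=%R [seq x j | j <- iota 0 n] = map fst (pairs x y n).
Proof. by rewrite /pairs -sort_map -map_comp. Qed.

Let order_stat_pairs x y n i : (0 < i <= n)%N ->
  order_stat x n i = (nth (0, 0) (pairs x y n) i.-1).1.
Proof.
case: i => // i /andP[_ i_n].
by rewrite /order_stat (fst_pairs x y) (nth_map (0, 0))// size_pairs.
Qed.

Let pairs_sorted x y n i l : (i <= l)%N -> (l < n)%N ->
  (nth (0, 0) (pairs x y n) i).1 <= (nth (0, 0) (pairs x y n) l).1.
Proof.
move=> il ln; apply: (@sorted_leq_nth _ (fun u v : R * R => u.1 <= v.1)) => //.
- by move=> u v z; exact: le_trans.
- by apply: sort_sorted => u v; exact: le_total.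
- by rewrite inE size_pairs (leq_ltn_trans il).
- by rewrite inE size_pairs.
Qed.

Let sum_pairs (V : nmodType) (G : R * R -> V) x y n :
  \sum_(0 <= l < n) G (nth (0, 0) (pairs x y n) l) = \sum_(i < n) G (x i, y i).
Proof.
have -> : \sum_(0 <= l < n) G (nth (0, 0) (pairs x y n) l) = \sum_(u <- pairs x y n) G u.
  by rewrite (big_nth (0, 0)) size_pairs.
have /permPl E : perm_eq (pairs x y n) [seq (x j, y j) | j <- iota 0 n] by rewrite perm_sort.
rewrite (perm_big [seq (x j, y j) | j <- iota 0 n]) ?perm_sort//= big_map.
by rewrite -(big_mkord xpredT (fun j => G (x j, y j))) /index_iota subn0.
Qed.

Let sum_rev (V : nmodType) (F : nat -> V) n k : (k <= n)%N ->
  \sum_(1 <= i < k.+1) F (n - i)%N = \sum_(n - k <= l < n) F l.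
Proof.
elim: k => [|k IH] kn; first by rewrite big_geq// subn0 big_geq.
rewrite big_nat_recr//= IH; last exact: ltnW.
rewrite [RHS]big_ltn; last by rewrite ltn_subrL/= (leq_ltn_trans _ kn).
by rewrite subnSK// addrC.
Qed.

(** The n - k lowest ranks contribute 0, because [H] vanishes when its second argument is
    nonpositive. The sum over top ranks thus becomes a sum over the whole sample, where the order no
    longer matters. *)
Lemma top_sum (H : R -> R -> R) x y n k : (k < n)%N ->
  (forall v z, z <= 0 -> H v z = 0) ->
  \sum_(1 <= i < k.+1) H (concomitant x y n (n - i + 1)%N)
     (order_stat x n (n - i + 1)%N - order_stat x n (n - k)%N) =
  \sum_(i < n) H (y i) (x i - order_stat x n (n - k)%N).
Proof.
move=> kn H0; set V := order_stat x n (n - k)%N.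
have VE : V = (nth (0, 0) (pairs x y n) (n - k).-1).1.
  by apply: order_stat_pairs; rewrite subn_gt0 kn leq_subr.
pose G (u : R * R) := H u.2 (u.1 - V).
rewrite -[RHS]/(\sum_(i < n) G (x i, y i)) -(sum_pairs G x y n).
rewrite (@big_cat_nat _ _ _ (n - k)%N 0 n)//= ?leq_subr//.
rewrite [X in _ = X + _](_ : _ = 0) ?add0r; last first.
  rewrite big_nat big1// => l /andP[_ lk]; apply: H0; rewrite subr_le0 VE.
  apply: pairs_sorted; first by rewrite -ltnS prednK// subn_gt0.
  by rewrite prednK ?subn_gt0// leq_subr.
rewrite -(sum_rev (fun l => G (nth (0, 0) (pairs x y n) l)) (ltnW kn)).
rewrite big_nat [RHS]big_nat; apply: eq_bigr => i /andP[i1 ik].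
have ik' : (i <= n)%N by rewrite (leq_trans _ (ltnW kn)).
rewrite /G (@order_stat_pairs _ y) ?addn1//=.
by move: i1 ik'; lia.
Qed.

Lemma m_hatE x y n k : (k < n)%N ->
  let V := order_stat x n (n - k)%N in
  m_hat x y n k = (\sum_(i < n) y i * Num.max 0 (x i - V)) /
                  (\sum_(i < n) Num.max 0 (x i - V)).
Proof.
move=> kn V; rewrite /m_hat.
have pos i : (1 <= i < k.+1)%N -> Num.max 0 (order_stat x n (n - i + 1)%N - V) =
    order_stat x n (n - i + 1)%N - V.
  move=> /andP[i1 ik]; have i_n : (i <= n)%N by rewrite (leq_trans _ (ltnW kn)).
  apply/max_r; rewrite subr_ge0 /V.
  rewrite (@order_stat_pairs _ y) ?subn_gt0 ?kn ?leq_subr//.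
  rewrite (@order_stat_pairs _ y); last first.
    by move: i1 i_n; lia.
  rewrite addn1 /=; apply: pairs_sorted.
    by move: ik kn; lia.
  by move: i1 kn; lia.
have z0 (z : R) : z <= 0 -> Num.max 0 z = 0 by move=> h; exact: max_l.
congr (_ / _).
- rewrite -(@top_sum (fun v z => v * Num.max 0 z) x y n k kn); last first.
    by move=> v z /z0 ->; rewrite mulr0.
  by rewrite big_nat [RHS]big_nat; apply: eq_bigr => i /pos ->.
- rewrite -(@top_sum (fun v z => Num.max 0 z) x y n k kn); last by move=> v z /z0.
  by rewrite big_nat [RHS]big_nat; apply: eq_bigr => i /pos ->.
Qed.

(** Reduces the threshold to a count of exceedances, from which both its measurability and its limit
    follow. *)
Lemma order_stat_count x n k t : (k < n)%N ->
  (t < order_stat x n (n - k)%N) = (k < \sum_(i < n) (t < x i)%R)%N.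
Proof.
move=> kn; have VE := @order_stat_pairs x x n (n - k)%N.
rewrite subn_gt0 kn leq_subr in VE; rewrite VE//.
rewrite -(sum_pairs (fun u => ((t < u.1)%R : nat)) x x n).
have [tV|Vt] := ltP t _; apply/esym.
- apply: (@leq_trans (\sum_((n - k).-1 <= l < n) ((t < (nth (0, 0) (pairs x x n) l).1)%R : nat))).
    rewrite big_nat (eq_bigr (fun=> 1%N)); last first.
      move=> l /andP[lk ln]; rewrite (lt_le_trans tV)//.
      exact: pairs_sorted.
    by rewrite -big_nat sum_nat_const_nat muln1; move: kn; lia.
  rewrite [X in (_ <= X)%N](@big_cat_nat _ _ _ (n - k).-1)//= ?leq_addl//.
  by rewrite (leq_trans (leq_pred _))// leq_subr.
- apply/negbTE; rewrite -leqNgt.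
  rewrite (@big_cat_nat _ _ _ (n - k)%N)//= ?leq_subr//.
  rewrite [X in (X + _ <= _)%N](_ : _ = 0%N) ?add0n; last first.
    rewrite big_nat big1// => l /andP[_ lk]; rewrite (_ : (t < _)%R = false)//; apply/negbTE; rewrite -leNgt.
    apply: le_trans Vt; apply: pairs_sorted.
      by rewrite -ltnS prednK// subn_gt0.
    by rewrite prednK ?subn_gt0// leq_subr.
  apply: (@leq_trans (\sum_(n - k <= l < n) 1)%N).
    by apply: leq_sum => l _; exact: leq_b1.
  by rewrite sum_nat_const_nat muln1 subKn// ltnW.
Qed.

End order_statistics.

Lemma measurable_order_stat d (T : measurableType d) (R : realType)
    (x : nat -> T -> R) (n k : nat) : (k < n)%N ->
  (forall i, measurable_fun setT (x i)) ->
  measurable_fun setT (fun w => order_stat (x ^~ w) n (n - k)%N).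
Proof.
move=> kn mx; apply: (measurability _ (RGenOInfty.measurableE R)) => // _ [_ [t ->] <-].
rewrite setTI (_ : _ @^-1` _ =
    [set w | k%:R < \sum_(i < n) ((t < x i w)%R%:R : R)]).
  apply: measurable_set_lt => //; apply: measurable_sum => i.
  apply: measurable_bool_fun; exact: measurable_set_lt.
apply/seteqP; split=> w /=; rewrite in_itv /= andbT order_stat_count// -(ltr_nat R) natr_sum//.
Qed.

(** * The limit integral *)

Section limit_integral.
Context d (T : measurableType d) (R : realType) (P : probability T R).
Variables (X Y : {RV P >-> R}) (g : R) (a m psi : R -> R).
Variable nu : {measure set (\bar R * \bar R) -> \bar R}.
Variables p q : R.
Hypothesis H1 : extreme_assumption X Y g a m psi nu.
Hypothesis H2 : moment_assumption X Y g a m psi nu p q.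
Hypotheses (p1 : 1 <= p) (q1 : 1 <= q).

Notation b := (tail_quantile X).
Notation xs := (x_std X psi).
Notation ys := (y_std X Y a m).
Notation E := (ev_space g : set (\bar R * \bar R)).
Notation F := (@finite_half R : set (\bar R * \bar R)).

Lemma index_lt1 : g < 1.
Proof.
have g0 := index_ge0 H1; have h := index_lt H2.
by apply: le_lt_trans h; rewrite ler_peMr.
Qed.

Lemma xs_excess_small (e : R) : 0 < e -> exists L : R, 0 < L /\
  \forall n \near \oo, (n%:R%:E * uexp P (fun w => Num.max 0 (xs n w - L))%R <= e%:E)%E.
Proof.
apply: (excess_small (index_ge0 H1) index_lt1 (X_attracted H1)).
  exact: b_homo_nat.
exact: endpoint_infinite H1.
Qed.

Lemma clamp0E (L x : R) : 0 < L -> clamp 0 L x = Num.min (Num.max 0 x) L.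
Proof.
move=> L0; rewrite /clamp /Num.max /Num.min.
case: (ltP L x) => h1; case: (ltP 0 x) => h2; repeat (case: ifPn; rewrite -?leNgt => ?); lra.
Qed.

Lemma xs_truncated_mean (L : R) : 0 < L ->
  (fun n => n%:R * mean P (fun w => clamp 0 L (xs n w))) @ \oo -->
  gpd_int g L - gpd_int g 0.
Proof.
move=> L0; have := cvg_truncated_mean (index_ge0 H1) (X_attracted H1) index_lt1 L0.
apply: cvg_trans; apply: near_eq_cvg; near=> n.
by congr (_ * mean P _); apply/funext => w; rewrite clamp0E.
Unshelve. all: by end_near. Qed.

Let mE : measurable E. Proof. exact: measurable_ev_space. Qed.
Let mF : measurable F. Proof. exact: measurable_finite_half. Qed.

(** The points x = 0 contribute nothing by hypothesis, and the infinite points of x >= 0 are null by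
    [nu_infinite_half]. *)
Lemma integral_finite_half (G : \bar R * \bar R -> R) : measurable_fun setT G ->
  (forall z, (z.1 <= 0)%E -> G z = 0) ->
  (\int[nu]_(z in E) (G z)%:E)%E = (\int[nu]_(z in F) (G z)%:E)%E.
Proof.
move=> mG G0.
have FE : E `&` F = F.
  by apply/setIidPr => z [/andP[z1 _] _]; apply: (half_sub_ev H1).
rewrite -[in RHS]FE integral_mkcondr.
have mGE : measurable_fun setT (fun z => (G z)%:E) by exact/measurable_EFinP.
apply: ae_eq_integral => //.
- exact: measurable_funTS.
- apply: measurable_funTS; apply/(measurable_restrictT _ mF).
  exact: measurable_funTS.
exists (@half_plane R `\` F); split.
- apply: measurableD => //; exact: measurable_half_plane.
- exact: (nu_infinite_half H1).
- move=> z /= /not_implyP[Ez]; rewrite /patch; case: ifPn => // zF h.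
  split; last by rewrite notin_setE in zF.
  rewrite /half_plane /= leNgt; apply/negP => /ltW /G0 Gz.
  by apply: h; rewrite Gz.
Qed.

Section signed_test.
Variables (L M : R).
Hypotheses (L0 : 0 < L) (M0 : 0 < M).

Let lM : - M <= M. Proof. by rewrite (@le_trans _ _ 0) ?oppr_le0 ?ltW. Qed.

Let uL (x : R) : 0 <= x <= L -> 0 <= x <= L. Proof. by []. Qed.
Let vM (x : R) : - M <= x <= M -> 0 <= x + M <= 2 * M.
Proof. by move=> /andP[h1 h2]; apply/andP; split; lra. Qed.
Let v1 (x : R) : - M <= x <= M -> 0 <= (1:R) <= 1. Proof. by rewrite ler01 lexx. Qed.

Let cu : continuous (fun x : R => x). Proof. by move=> x; exact: cvg_id. Qed.
Let cv : continuous (fun x : R => x + M).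
Proof. by move=> x; apply: cvgD; [exact: cvg_id|exact: cvg_cst]. Qed.
Let c1 : continuous (fun _ : R => 1 : R). Proof. by move=> x; exact: cvg_cst. Qed.

(** The test products are nonnegative, so the clamped [y] is written as (y + M) - M: two test
    functions whose limits are subtracted. *)
Lemma signed_cvg :
  (fun n => n%:R * mean P (fun w => clamp 0 L (xs n w) * clamp (- M) M (ys n w))) @ \oo -->
  (\int[nu]_(z in F) (eclamp 0 L z.1 * eclamp (- M) M z.2))%R.
Proof.
have [dl [d0 gd _ _]] := gpd_near0 (index_ge0 H1) ltr01.
have dl0 : - dl <= 0 by rewrite oppr_le0 ltW.
have h1 := product_cvg H1 gd dl0 (ltW L0) lM cu cv uL vM erefl.
have h2 := product_cvg H1 gd dl0 (ltW L0) lM cu c1 uL v1 erefl.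
have f1 := product_fun_fin H1 gd dl0 (ltW L0) lM cu cv uL vM erefl.
have f2 := product_fun_fin H1 gd dl0 (ltW L0) lM cu c1 uL v1 erefl.
have m1 : measurable_fun setT (product_fun (fun x : R => x) (fun x => x + M) 0 L (- M) M).
  exact: measurable_product_fun.
have m2 : measurable_fun setT (product_fun (fun x : R => x) (fun _ => 1) 0 L (- M) M).
  exact: measurable_product_fun.
have b1 n := bmf_product X Y a m psi (ltW L0) lM cu cv uL vM n.
have b2 n := bmf_product X Y a m psi (ltW L0) lM cu c1 uL v1 n.
have z1 (v : R -> R) z : (z.1 <= 0)%E -> product_fun (fun x : R => x) v 0 L (- M) M z = 0.
  by move=> h; rewrite /product_fun eclamp_lo ?mul0r// ltW.
rewrite integral_finite_half in h1 f1; [|exact: m1|exact: z1].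
rewrite integral_finite_half in h2 f2; [|exact: m2|exact: z1].
have pos (v : R -> R) K z : (forall x, - M <= x <= M -> 0 <= v x <= K) ->
    0 <= product_fun (fun x : R => x) v 0 L (- M) M z.
  by move=> hv; have /andP[] := product_fun_itv (ltW L0) lM uL hv z.
have i1 : nu.-integrable F (fun z => (product_fun (fun x : R => x) (fun x => x + M) 0 L (- M) M z)%:E).
  apply/integrableP; split; first by apply: measurable_funTS; apply/measurable_EFinP.
  move: f1; rewrite ge0_fin_numE; last by apply: integral_ge0 => z _; rewrite lee_fin (pos _ _ _ vM).
  apply: le_lt_trans; rewrite le_eqVlt; apply/orP; left; apply/eqP; apply: eq_integral => z _.
  by rewrite gee0_abs// lee_fin (pos _ _ _ vM).
have i2 : nu.-integrable F (fun z => (product_fun (fun x : R => x) (fun _ => 1) 0 L (- M) M z)%:E).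
  apply/integrableP; split; first by apply: measurable_funTS; apply/measurable_EFinP.
  move: f2; rewrite ge0_fin_numE; last by apply: integral_ge0 => z _; rewrite lee_fin (pos _ _ _ v1).
  apply: le_lt_trans; rewrite le_eqVlt; apply/orP; left; apply/eqP; apply: eq_integral => z _.
  by rewrite gee0_abs// lee_fin (pos _ _ _ v1).
have lim : (fun n =>
    n%:R * mean P (fun w => clamp 0 L (xs n w) * (clamp (- M) M (ys n w) + M)) -
    M * (n%:R * mean P (fun w => clamp 0 L (xs n w) * 1))) @ \oo -->
  (\int[nu]_(z in F) (product_fun (fun x : R => x) (fun x => x + M) 0 L (- M) M z) -
   M * \int[nu]_(z in F) (product_fun (fun x : R => x) (fun _ => 1) 0 L (- M) M z))%R.
  by apply: cvgB; [exact: h1|apply: cvgM; [exact: cvg_cst|exact: h2]].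
rewrite -RintegralZl// -RintegralB// in lim; last first.
  by have := integrableZl mF M i2; apply: eq_integrable.
rewrite (_ : (\int[nu]_(z in F) (eclamp 0 L z.1 * eclamp (- M) M z.2))%R =
  (\int[nu]_(z in F) (product_fun (fun x : R => x) (fun x => x + M) 0 L (- M) M z -
   M * product_fun (fun x : R => x) (fun _ => 1) 0 L (- M) M z))%R); last first.
  by apply: eq_Rintegral => z _; rewrite /product_fun; ring.
apply: cvg_trans lim; apply: near_eq_cvg; near=> n.
have E1 := meanZ P M (b2 n); have E2 := meanB P (b1 n) (bmfZ M (b2 n)).
rewrite /= in E1 E2; rewrite mulrCA -mulrBr -E1 -E2.
by congr (_ * mean P _); apply/funext => w; ring.
Unshelve. all: by end_near. Qed.

End signed_test.

(** A bound uniform in the truncation level [j]. Where |y| >= M, [tail_y] applies; where |y| < M,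
    the product is at most M times the positive part of x, whose mean is bounded. *)
Lemma xy_bounded : exists C : R, 0 <= C /\ forall j : nat, (0 < j)%N ->
  \forall n \near \oo,
  n%:R * mean P (fun w => clamp 0 j%:R (xs n w) * `|clamp (- j%:R) j%:R (ys n w)|) <= C.
Proof.
have [dl [M [d0 _ gd M0 hM]]] := tail_y H1 H2 p1 q1 ltr01.
have [L [L0 hL]] := xs_excess_small ltr01.
have hT := xs_truncated_mean L0.
set l := gpd_int g L - gpd_int g 0 in hT.
have hT' : \forall n \near \oo, n%:R * mean P (fun w => clamp 0 L (xs n w)) < `|l| + 1.
  by apply: (cvgr_lt _ hT); rewrite ltr_pwDr// ler_norm.
(* The terms bound, in order, the tail in [y], the truncated mean of [x] and the excess of [x] over
   [L]. *)
exists (1 + M * (`|l| + 1 + 1)); split.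
  by rewrite addr_ge0// mulr_ge0 ?(ltW M0)// !addr_ge0.
move=> j j0; have j0' : 0 < j%:R :> R by rewrite ltr0n.
have jj : (- j%:R : R) <= j%:R by rewrite (@le_trans _ _ 0)// oppr_le0.
near=> n.
have t1 : (n%:R%:E * uexp P (tail_y_fun X Y a m psi dl M n) <= 1%:E)%E by near: n.
have t2 : (n%:R%:E * uexp P (fun w => Num.max 0 (xs n w - L))%R <= 1%:E)%E by near: n.
have t3 : n%:R * mean P (fun w => clamp 0 L (xs n w)) < `|l| + 1 by near: n.
set G := fun w => clamp 0 j%:R (xs n w) * `|clamp (- j%:R) j%:R (ys n w)|.
have mx := measurable_x_std X psi n.
have my := measurable_y_std X Y a m n.
have mcl (lo hi : R) (f : T -> R) : measurable_fun setT f ->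
    measurable_fun setT (fun w => clamp lo hi (f w)).
  by move=> mf; apply: (measurableT_comp (continuous_measurable_fun (@clamp_continuous R lo hi))).
have bG : bmf G.
  split.
    apply: measurable_funM; first exact: mcl.
    by apply: measurableT_comp => //; exact: mcl.
  exists (j%:R * j%:R) => w; have /andP[c1 c2] := clamp_itv (xs n w) (ltW j0').
  rewrite /G normrM normr_id ger0_norm// ler_pM//.
  exact: norm_clamp_bound.
have G0 w : 0 <= G w.
  by have /andP[c1 c2] := clamp_itv (xs n w) (ltW j0'); rewrite mulr_ge0.
have bL : bmf (fun w => clamp 0 L (xs n w)).
  split; first exact: mcl.
  by exists L => w; have /andP[c1 c2] := clamp_itv (xs n w) (ltW L0); rewrite ger0_norm.
have L00 w : 0 <= clamp 0 L (xs n w) by have /andP[] := clamp_itv (xs n w) (ltW L0).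
have mex : measurable_fun setT (fun w => Num.max 0 (xs n w - L)).
  by apply: measurable_maxr => //; exact: measurable_funB.
have ex0 w : 0 <= Num.max 0 (xs n w - L) by rewrite le_max lexx.
have mty := measurable_tail_y_fun X Y a m psi dl M n.
have ty0 := tail_y_fun_ge0 X Y a m psi dl M n.
have pw w : G w <= tail_y_fun X Y a m psi dl M n w +
    M * (clamp 0 L (xs n w) + Num.max 0 (xs n w - L)).
  have [x0|x0] := leP (xs n w) 0.
    rewrite /G clamp_neg// mul0r addr_ge0// mulr_ge0 ?(ltW M0)// addr_ge0//.
  have xle : xs n w <= clamp 0 L (xs n w) + Num.max 0 (xs n w - L).
    rewrite clamp0E// /Num.min /Num.max; repeat (case: ifPn; rewrite -?leNgt => ?); lra.
  have Gx : G w <= xs n w * `|ys n w|.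
    apply: ler_pM => //; first by have /andP[] := clamp_itv (xs n w) (ltW j0').
      have := @norm_clamp_le R 0 j%:R (xs n w) (lexx _) (ltW j0').
      rewrite (gtr0_norm x0); apply: le_trans; exact: ler_norm.
    by apply: norm_clamp_le => //; rewrite oppr_le0.
  apply: le_trans Gx _; rewrite /tail_y_fun.
  have -> : - dl < xs n w by rewrite (lt_trans _ x0)// oppr_lt0.
  rewrite (max_r (ltW x0)) /=; have [My|yM] := leP M `|ys n w|.
    rewrite mulr1 -[X in X <= _]addr0; apply: lerD.
      by rewrite ler_wpM2r// lerDr.
    by rewrite mulr_ge0 ?(ltW M0)// addr_ge0.
  rewrite mulr0 add0r.
  apply: (@le_trans _ _ (xs n w * M)); first by rewrite ler_pM2l// ltW.
  by rewrite mulrC ler_pM2l.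
have n0 : (0 <= n%:R%:E :> \bar R)%E by rewrite lee_fin.
have mLe : measurable_fun setT (fun w => clamp 0 L (xs n w) + Num.max 0 (xs n w - L)).
  by apply: measurable_funD => //; have [] := bL.
rewrite -lee_fin EFinM -(uexp_bmf P bG).
apply: (@le_trans _ _ (n%:R%:E * (uexp P (tail_y_fun X Y a m psi dl M n) +
    uexp P (fun w => M * (clamp 0 L (xs n w) + Num.max 0 (xs n w - L))))%R)%E).
  apply: lee_wpmul2l => //; rewrite -uexpD//; last 2 first.
  - exact: measurable_funM.
  - by move=> w; rewrite mulr_ge0 ?(ltW M0)// addr_ge0.
  apply: le_uexp; first by have [] := bG.
    by apply: measurable_funD => //; exact: measurable_funM.
  by move=> w; rewrite G0 pw.
rewrite ge0_muleDr ?uexp_ge0//; last by move=> w; rewrite mulr_ge0 ?(ltW M0)// addr_ge0.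
rewrite EFinD leeD// uexpZ ?(ltW M0)//; last by move=> w; rewrite addr_ge0.
rewrite muleCA EFinM lee_wpmul2l ?lee_fin ?(ltW M0)//.
rewrite uexpD//; last by have [] := bL.
rewrite (uexp_bmf P bL) ge0_muleDr ?uexp_ge0//; last by rewrite lee_fin mean_ge0.
by rewrite EFinD leeD// -EFinM lee_fin ltW.
Unshelve. all: by end_near. Qed.

End limit_integral.

Section iterated_limit.
Context d (T : measurableType d) (R : realType) (P : probability T R).
Variables (X Y : {RV P >-> R}) (g : R) (a m psi : R -> R).
Variable nu : {measure set (\bar R * \bar R) -> \bar R}.
Variables p q : R.
Hypothesis H1 : extreme_assumption X Y g a m psi nu.
Hypothesis H2 : moment_assumption X Y g a m psi nu p q.
Hypotheses (p1 : 1 <= p) (q1 : 1 <= q).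

Notation xs := (x_std X psi).
Notation ys := (y_std X Y a m).
Notation E := (ev_space g : set (\bar R * \bar R)).
Notation F := (@finite_half R : set (\bar R * \bar R)).

Let mF : measurable F. Proof. exact: measurable_finite_half. Qed.

Lemma clamp_ge0E (j x : R) : 0 <= x -> 0 <= j -> clamp 0 j x = Num.min j x.
Proof. by move=> x0 j0; rewrite /clamp max_r// le_min j0. Qed.

Lemma norm_clampE (j y : R) : 0 <= j -> `|clamp (- j) j y| = Num.min j `|y|.
Proof.
move=> j0; have [y0|y0] := leP 0 y.
  have m0 : 0 <= Num.min j y by rewrite le_min j0.
  by rewrite /clamp max_r ?ger0_norm// (le_trans _ m0)// oppr_le0.
have yj : Num.min j y = y by apply/min_r; rewrite (le_trans (ltW y0)).
rewrite /clamp yj (ltr0_norm y0) /Num.max /Num.min.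
case: (ltP (- j) y) => h1; case: (ltP j (- y)) => h2; rewrite ?normrN ?(ltr0_norm y0) ?(ger0_norm j0);
  lra.
Qed.

Lemma finite_halfP z : F z -> exists x y : R, z = (x%:E, y%:E) /\ 0 <= x.
Proof.
move: z => [[x| |] [y| |]] [/=]; rewrite ?ltxx ?andbF ?leeNy_eq// => /andP[h1 _] _.
by exists x, y.
Qed.

Let G (j : nat) (z : \bar R * \bar R) : R :=
  eclamp 0 j%:R z.1 * `|eclamp (- j%:R) j%:R z.2|.

Let mG j : measurable_fun setT (G j).
Proof.
apply: measurable_funM; first exact: (measurableT_comp (@measurable_eclamp R 0 j%:R)).
apply: measurableT_comp => //.
exact: (measurableT_comp (@measurable_eclamp R (- j%:R) j%:R)).
Qed.

Let GE (j : nat) (x y : R) : 0 <= x ->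
  G j (x%:E, y%:E) = Num.min j%:R x * Num.min j%:R `|y|.
Proof. by move=> x0; rewrite /G !eclampE clamp_ge0E// norm_clampE. Qed.

Let xy (z : \bar R * \bar R) : R := fine z.1 * fine z.2.

Let mxy : measurable_fun setT xy.
Proof.
apply: measurable_funM.
  exact: (measurableT_comp (fine_measurable measurableT)).
exact: (measurableT_comp (fine_measurable measurableT)).
Qed.

(** The truncated products increase to |x y| on finite points; their integrals are limits of the
    means in [xy_bounded], hence at most [C], and monotone convergence concludes. *)
Lemma xy_integrable : nu.-integrable F (fun z => (xy z)%:E).
Proof.
have [C [C0 hC]] := xy_bounded H1 H2 p1 q1.
apply/integrableP; split; first by apply: measurable_funTS; apply/measurable_EFinP.
have ev z : F z -> \forall j \near \oo, (G j z)%:E = `|(xy z)%:E|%E.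
  move=> /finite_halfP [x [y [-> x0]]]; near=> j.
  rewrite GE// /xy /= normrM (ger0_norm x0) !min_r//; near: j; exact: nbhs_infty_ger.
have G0 j z : F z -> (0 <= (G j z)%:E)%E.
  move=> /finite_halfP [x [y [-> x0]]]; rewrite GE// lee_fin mulr_ge0// le_min ?x0 ?normr_ge0 ?ler0n//.
have bound j : (0 < j)%N -> (\int[nu]_(z in F) (G j z)%:E <= C%:E)%E.
  move=> j0; have j0' : 0 < j%:R :> R by rewrite ltr0n.
  have jj : (- j%:R : R) <= j%:R by rewrite (@le_trans _ _ 0)// oppr_le0.
  have [dl [d0 gd _ _]] := gpd_near0 (index_ge0 H1) ltr01.
  have dl0 : - dl <= 0 by rewrite oppr_le0 ltW.
  have cu : continuous (fun x : R => x) by move=> x; exact: cvg_id.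
  have uj (x : R) : 0 <= x <= j%:R -> 0 <= x <= j%:R by [].
  have vj (x : R) : - j%:R <= x <= j%:R -> 0 <= `|x| <= j%:R.
    by move=> h; rewrite normr_ge0 ler_norml.
  have h1 := product_cvg H1 gd dl0 (ltW j0') jj cu (@norm_continuous R R) uj vj erefl.
  have f1 := product_fun_fin H1 gd dl0 (ltW j0') jj cu (@norm_continuous R R) uj vj erefl.
  have z1 z : (z.1 <= 0)%E -> product_fun (fun x : R => x) (fun x => `|x|) 0 j%:R (- j%:R) j%:R z = 0.
    by move=> h; rewrite /product_fun eclamp_lo ?mul0r// ltW.
  rewrite (integral_finite_half H1) in h1 f1; [|exact: mG|exact: z1].
  rewrite -[X in (X <= _)%E](fineK f1) lee_fin.
  apply: (cvgr_to_le h1); exact: hC.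
have mono : (\int[nu]_(z in F) (G j z)%:E)%E @[j --> \oo] -->
    (\int[nu]_(z in F) `|(xy z)%:E|)%E.
  have -> : (\int[nu]_(z in F) `|(xy z)%:E|)%E =
      (\int[nu]_(z in F) limn (fun j => (G j z)%:E))%E.
    apply: eq_integral => z; rewrite inE => /ev h.
    apply/esym/cvg_lim => //.
    have hc : (fun _ : nat => `|(xy z)%:E|%E) @ \oo --> `|(xy z)%:E|%E by exact: cvg_cst.
    by apply: cvg_trans hc; apply: near_eq_cvg; apply: filterS h => j.
  apply: (@cvg_monotone_convergence _ _ _ nu _ mF (fun j z => (G j z)%:E)) => //.
  - by move=> j; apply: measurable_funTS; apply/measurable_EFinP.
  - move=> z /finite_halfP [x [y [-> x0]]] i j ij; rewrite !GE// lee_fin.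
    have ijR : (i%:R : R) <= j%:R by rewrite ler_nat.
    by apply: ler_pM; rewrite ?le_min ?x0 ?normr_ge0 ?ler0n//; rewrite !ge_min ?ijR ?lexx ?orbT.
apply: (@le_lt_trans _ _ C%:E); last exact: ltry.
apply: (cvge_to_le mono).
by exists 1%N => // j /= j0; exact: bound.
Unshelve. all: by end_near. Qed.

Let dominated (f_ : nat -> \bar R * \bar R -> R) (f : \bar R * \bar R -> R) :
  (forall n, measurable_fun setT (f_ n)) -> measurable_fun setT f ->
  (forall z, F z -> \forall n \near \oo, f_ n z = f z) ->
  (forall n z, F z -> `|f_ n z| <= `|xy z|) ->
  (fun n => \int[nu]_(z in F) f_ n z)%R @ \oo --> (\int[nu]_(z in F) f z)%R.
Proof.
move=> mf_ mf ff fb.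
have m1 n : measurable_fun F (fun z => (f_ n z)%:E).
  by apply: measurable_funTS; apply/measurable_EFinP.
have m2 : measurable_fun F (fun z => (f z)%:E).
  by apply: measurable_funTS; apply/measurable_EFinP.
have a1 : \forall z \ae nu, F z -> (fun n => (f_ n z)%:E) @ \oo --> (f z)%:E.
  apply: aeW => z /ff h.
  have hc : (fun _ : nat => (f z)%:E) @ \oo --> (f z)%:E by exact: cvg_cst.
  by apply: cvg_trans hc; apply: near_eq_cvg; apply: filterS h => n ->.
have int := integrable_abse xy_integrable.
have a2 : \forall z \ae nu, forall n, F z -> (`|(f_ n z)%:E| <= (abse \o (fun z => (xy z)%:E)) z)%E.
  by apply: aeW => z n /fb; rewrite /= lee_fin.
have [ifin _ DC] := dominated_convergence mF m1 m2 a1 int a2.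
have fin := integrable_fin_num mF ifin.
move: DC; rewrite -(fineK fin) => /fine_cvgP[_].
exact.
Qed.

Let A (L M : nat) := (\int[nu]_(z in F) (eclamp 0 L%:R z.1 * eclamp (- M%:R) M%:R z.2))%R.
Let A1 (M : nat) := (\int[nu]_(z in F) (fine z.1 * eclamp (- M%:R) M%:R z.2))%R.

Let m_eclamp (lo hi : R) (h : \bar R * \bar R -> \bar R) : measurable_fun setT h ->
  measurable_fun setT (fun z => eclamp lo hi (h z)).
Proof. exact: (measurableT_comp (@measurable_eclamp R lo hi)). Qed.

Let m_fine1 : measurable_fun setT (fun z : \bar R * \bar R => fine z.1).
Proof. exact: (measurableT_comp (fine_measurable measurableT)). Qed.

Let A_cvg M : (fun L => A L M) @ \oo --> A1 M.
Proof.
apply: dominated.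
- by move=> L; apply: measurable_funM; exact: m_eclamp.
- by apply: measurable_funM => //; exact: m_eclamp.
- move=> z /finite_halfP [x [y [-> x0]]]; near=> L; rewrite !eclampE clamp_ge0E// min_r//.
  by near: L; exact: nbhs_infty_ger.
- move=> L z /finite_halfP [x [y [-> x0]]]; rewrite !eclampE /xy /= !normrM.
  by apply: ler_pM => //; apply: norm_clamp_le => //; rewrite oppr_le0.
Unshelve. all: by end_near. Qed.

Let A1_cvg : A1 @ \oo --> (\int[nu]_(z in F) xy z)%R.
Proof.
apply: dominated => //.
- by move=> M; apply: measurable_funM => //; exact: m_eclamp.
- move=> z /finite_halfP [x [y [-> x0]]]; near=> M; rewrite !eclampE /xy /=.
  have : `|y| <= M%:R by near: M; exact: nbhs_infty_ger.
  by rewrite ler_norml /clamp => /andP[h1 h2]; rewrite min_r// max_r.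
- move=> M z /finite_halfP [x [y [-> x0]]]; rewrite !eclampE /xy /= !normrM.
  by apply: ler_pM => //; apply: norm_clamp_le => //; rewrite oppr_le0.
Unshelve. all: by end_near. Qed.

(** The order of quantifiers matters: [L] is chosen after [M], arbitrarily large, because in the
    numerator the excess of [x] over [L] is multiplied by [M]. *)
Lemma truncated_integral (h M0 : R) : 0 < h -> exists M : nat,
  [/\ (0 < M)%N, M0 <= M%:R & forall L0 : R, exists L : nat, [/\ (0 < L)%N, L0 <= L%:R &
  `|(\int[nu]_(z in F) (eclamp 0 L%:R z.1 * eclamp (- M%:R) M%:R z.2))%R -
    (\int[nu]_(z in F) (fine z.1 * fine z.2))%R| <= h]].
Proof.
move=> h0; have h2 : 0 < h / 2 by rewrite divr_gt0.
have /cvgrPdist_lt/(_ _ h2) B := A1_cvg.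
near \oo => M; exists M; split.
- by near: M; exact: nbhs_infty_gt.
- by near: M; exact: nbhs_infty_ger.
have b1 : `|(\int[nu]_(z in F) xy z)%R - A1 M| < h / 2 by near: M.
move=> L0; have /cvgrPdist_lt/(_ _ h2) B' := @A_cvg M.
near \oo => L; exists L; split.
- by near: L; exact: nbhs_infty_gt.
- by near: L; exact: nbhs_infty_ger.
have b2 : `|A1 M - A L M| < h / 2 by near: L.
rewrite -/(A L M) distrC.
have -> : (\int[nu]_(z in F) (fine z.1 * fine z.2))%R - A L M =
  ((\int[nu]_(z in F) xy z)%R - A1 M) + (A1 M - A L M) by rewrite /xy; ring.
by apply: le_trans (ler_normD _ _) _; lra.
Unshelve. all: by end_near. Qed.

End iterated_limit.

(** * The sample *)

Section sample.
Context d (T : measurableType d) (R : realType) (P : probability T R).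
Variables (X Y : {RV P >-> R}) (X_ Y_ : nat -> {RV P >-> R}).
Variables (g : R) (a m psi : R -> R).
Variable nu : {measure set (\bar R * \bar R) -> \bar R}.
Hypothesis Hiid : iid_copies X Y X_ Y_.
Hypothesis H1 : extreme_assumption X Y g a m psi nu.
Variable k : nat -> nat.
Hypothesis Hk : intermediate R k.

Notation b := (tail_quantile X).
Notation xs := (x_std X psi).
Notation ys := (y_std X Y a m).

Definition level (n : nat) : nat := Num.truncn (n%:R / (k n)%:R : R).

Lemma level_cvg : level @ \oo --> \oo.
Proof.
have [_ ty] := Hk; apply/cvgnyPge => A; have /cvgryPge/(_ A%:R) := ty.
by apply: filterS => n h; rewrite /level truncn_ge_nat// (le_trans _ h).
Qed.

Lemma near_level (A : nat -> Prop) :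
  (\forall n \near \oo, A n) -> \forall n \near \oo, A (level n).
Proof. by move=> h; exact: (level_cvg h). Qed.

Lemma level_ratio_cvg : (fun n => n%:R / (k n)%:R / (level n)%:R : R) @ \oo --> (1:R).
Proof.
have [_ ty] := Hk.
have h0 : (fun _ : nat => 1:R) @ \oo --> (1:R) by exact: cvg_cst.
have h1 := cvg_comp _ _ level_cvg (@succ_ratio_cvg R).
apply: (squeeze_cvgr _ h0 h1).
have l0 := near_level (nbhs_infty_gt 0).
near=> n.
have l0' : 0 < (level n)%:R :> R by rewrite ltr0n; near: n; exact: l0.
have t0 : 0 <= n%:R / (k n)%:R :> R by rewrite divr_ge0.
rewrite /= ler_pdivlMr// mul1r ler_pM2r ?invr_gt0//.
by apply/andP; split; [rewrite /level truncn_le|apply/ltW; exact: truncnS_gt].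
Unshelve. all: by end_near. Qed.

Lemma near_k_lt : \forall n \near \oo, (0 < k n)%N /\ (k n < n)%N.
Proof.
have [ky ty] := Hk; have /cvgryPgt/(_ 1) h := ty.
near=> n.
have k0 : (0 < k n)%N by near: n; exact: (ky _ (nbhs_infty_gt 0)).
split=> //; have : 1 < n%:R / (k n)%:R :> R by near: n.
by rewrite ltr_pdivlMr ?ltr0n// mul1r ltr_nat.
Unshelve. all: by end_near. Qed.

Definition xz (n : nat) (z : R * R) : R := (z.1 - b (level n)%:R) / psi (b (level n)%:R).
Definition yz (n : nat) (z : R * R) : R := (z.2 - m (b (level n)%:R)) / a (b (level n)%:R).

Lemma measurable_xz n : measurable_fun setT (xz n).
Proof. by apply: measurable_funM => //; apply: measurable_funB. Qed.

Lemma measurable_yz n : measurable_fun setT (yz n).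
Proof. by apply: measurable_funM => //; apply: measurable_funB. Qed.

(** [F] is bounded and vanishes left of - dl, so its normalized first absolute moment is at most B
    times the mass of x > - dl, which converges. This is the moment bound required by [weak_lln]. *)
Lemma lln_std (F : R -> R -> R) (B dl l : R) :
  measurable_fun setT (fun z : R * R => F z.1 z.2) -> (forall x y, `|F x y| <= B) ->
  g * dl < 1 -> (forall x y, x <= - dl -> F x y = 0) ->
  (fun n => n%:R * mean P (fun w => F (xs n w) (ys n w))) @ \oo --> l ->
  (fun nw => array_mean X_ Y_ k (fun n z => F (xz n z) (yz n z)) nw.1 nw.2)
    @ prob_filter P --> l.
Proof.
move=> mFF FB gd F0 Fl; have [ky ty] := Hk.
have mf n : measurable_fun setT (fun z => F (xz n z) (yz n z)).
  apply: (measurableT_comp mFF (g := fun z => (xz n z, yz n z))).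
  by apply: measurable_fun_pair; [exact: measurable_xz|exact: measurable_yz].
(* The factor 2 bounds the ratio of n/k to its integer part, and gpd g (- dl) + 1 bounds the mass of
   x > - dl. *)
apply: (@weak_lln _ _ _ P X Y X_ Y_ Hiid k ky (fun n z => F (xz n z) (yz n z)) B
  (2 * (B * (gpd g (- dl) + 1))) l); [exact: mf|by move=> *; exact: FB| |].
  have h : (fun n => n%:R / (k n)%:R / (level n)%:R *
      ((level n)%:R * mean P (fun w => F (xs (level n) w) (ys (level n) w)))) @ \oo --> (1 * l : R).
    by apply: cvgM; [exact: level_ratio_cvg|exact: (cvg_comp _ _ level_cvg Fl)].
  rewrite mul1r in h; apply: cvg_trans h; apply: near_eq_cvg.
  have l0 := near_level (nbhs_infty_gt 0).
  near=> n; rewrite mulrA divfK// pnatr_eq0 -lt0n; near: n; exact: l0.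
have dom : 0 < 1 + g * (- dl) by lra.
have T1 : \forall n \near \oo, n%:R * pr P [set w | - dl < xs n w] < gpd g (- dl) + 1.
  by apply: (cvgr_lt _ (x_std_cvg H1 dom)); rewrite ltrDl.
have T2 := near_level T1.
have T3 : \forall n \near \oo, n%:R / (k n)%:R / (level n)%:R < 2 :> R.
  by apply: (cvgr_lt _ level_ratio_cvg); rewrite ltr1n.
have l0 := near_level (nbhs_infty_gt 0).
near=> n.
have t2 : (level n)%:R * pr P [set w | - dl < xs (level n) w] < gpd g (- dl) + 1.
  by near: n; exact: T2.
have t3 : n%:R / (k n)%:R / (level n)%:R < 2 :> R by near: n.
have l0' : 0 < (level n)%:R :> R by rewrite ltr0n; near: n; exact: l0.
have B0 : 0 <= B by apply: le_trans (FB 0 0).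
have mA : measurable [set w | - dl < xs (level n) w].
  by apply: measurable_set_lt => //; exact: measurable_x_std.
have mean_le : mean P (fun w => `|F (xz n (X w, Y w)) (yz n (X w, Y w))|) <=
    B * pr P [set w | - dl < xs (level n) w].
  rewrite -mean_bool// -meanZ; last exact: bmf_bool.
  apply: le_mean.
  - split; last by exists B => w; rewrite normr_id.
    by apply: measurableT_comp => //; apply: (measurableT_comp (mf n)); exact: measurable_rv_pair.
  - by apply: bmfZ; exact: bmf_bool.
  - move=> w; have [h|h] := ltP (- dl) (xs (level n) w); first by rewrite mulr1 FB.
    by rewrite (F0 _ _ h) normr0 mulr0.
apply: (@le_trans _ _ (n%:R / (k n)%:R * (B * pr P [set w | - dl < xs (level n) w]))).
  by rewrite ler_wpM2l// divr_ge0.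
have -> : n%:R / (k n)%:R * (B * pr P [set w | - dl < xs (level n) w]) =
  (n%:R / (k n)%:R / (level n)%:R) * (B * ((level n)%:R * pr P [set w | - dl < xs (level n) w])).
  by move: (n%:R / (k n)%:R) (pr P _) => x z; field; rewrite gt_eqF.
apply: ler_pM.
- by rewrite !divr_ge0.
- by rewrite mulr_ge0// mulr_ge0// pr_ge0.
- exact: ltW.
- by rewrite ler_wpM2l// ltW.
Unshelve. all: by end_near. Qed.

Lemma count_cvg (c : R) : 0 < 1 + g * c ->
  (fun nw => array_mean X_ Y_ k (fun n z => (c < xz n z)%R%:R) nw.1 nw.2)
    @ prob_filter P --> gpd g c.
Proof.
move=> dom; apply: (@lln_std (fun x _ => (c < x)%R%:R) 1 (- c)).
- apply: measurable_bool_fun; exact: measurable_set_lt.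
- by move=> x _; case: (c < x); rewrite ?normr1 ?normr0.
- by rewrite mulrN; lra.
- by move=> x _; rewrite opprK leNgt => /negbTE ->.
- have := x_std_cvg H1 dom; apply: cvg_trans; apply: near_eq_cvg; near=> n.
  rewrite mean_bool//; apply: measurable_set_lt => //; exact: measurable_x_std.
Unshelve. all: by end_near. Qed.

(* V is replaced by a constant when k n >= n, so as to be measurable for all n. *)
Definition V (n : nat) (w : T) : R :=
  if (k n < n)%N then order_stat (X_ ^~ w) n (n - k n)%N else 0.

Lemma measurable_V n : measurable_fun setT (V n).
Proof.
rewrite (_ : V n = if (k n < n)%N then (fun w => order_stat (X_ ^~ w) n (n - k n)%N)
    else fun=> 0); last by apply/funext => w; rewrite /V; case: ifP.
by case: ifP => // kn; exact: measurable_order_stat.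
Qed.

Definition tau (n : nat) (w : T) : R := (V n w - b (level n)%:R) / psi (b (level n)%:R).

Lemma measurable_tau n : measurable_fun setT (tau n).
Proof. by apply: measurable_funM => //; apply: measurable_funB => //; exact: measurable_V. Qed.

Lemma lt_V n w (c : R) : (0 < k n)%N -> (k n < n)%N -> 0 < psi (b (level n)%:R) ->
  (c < tau n w) = (1 < array_mean X_ Y_ k (fun n z => (c < xz n z)%R%:R) n w).
Proof.
move=> k0 kn p0; rewrite /tau ltr_pdivlMr// ltrBrDr /V kn order_stat_count//.
rewrite /array_mean [_^-1 * _]mulrC ltr_pdivlMr ?ltr0n// mul1r -(ltr_nat R) natr_sum.
congr (_ < _); apply: eq_bigr => i _.
by rewrite /xz /= ltr_pdivlMr// ltrBrDr.
Qed.

(** By [lt_V], tau > c means that the normalized count of exceedances of c is above 1, and the limit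
    [gpd g c] crosses 1 strictly at c = 0. *)
Lemma tau_cvg : (fun nw => tau nw.1 nw.2) @ prob_filter P --> (0:R).
Proof.
apply/cvgr0Pnorm_lt => e e0.
have [dl [d0 gd _ _]] := gpd_near0 (index_ge0 H1) ltr01.
have g0 := index_ge0 H1.
pose c := Num.min dl (e / 2).
have c0 : 0 < c by rewrite lt_min d0 divr_gt0.
have ce : c < e.
  apply: (@le_lt_trans _ _ (e / 2)); first by rewrite ge_min lexx orbT.
  by rewrite ltr_pdivrMr// ltr_pMr// ltr1n.
have gc : g * c < 1 by apply: le_lt_trans gd; rewrite ler_wpM2l// ge_min lexx.
have dom1 : 0 < 1 + g * c by have := mulr_ge0 g0 (ltW c0); lra.
have dom2 : 0 < 1 + g * (- c) by lra.
have dom0 : 0 < 1 + g * 0 by rewrite mulr0 addr0.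
have v1 : gpd g c < 1 by rewrite -(gpd0 g); exact: gpd_lt.
have v2 : 1 < gpd g (- c) by rewrite -(gpd0 g); apply: gpd_lt => //; rewrite oppr_lt0.
have A1 : \forall nw \near prob_filter P,
    array_mean X_ Y_ k (fun n z => (c < xz n z)%R%:R) nw.1 nw.2 < 1.
  exact: (cvgr_lt _ (count_cvg dom1)).
have A2 : \forall nw \near prob_filter P,
    1 < array_mean X_ Y_ k (fun n z => (- c < xz n z)%R%:R) nw.1 nw.2.
  exact: (cvgr_gt _ (count_cvg dom2)).
have A3 := near_prob_filter P near_k_lt.
have A4 := near_prob_filter P (near_level (scales_gt0 H1)).
near=> nw.
have [k0 kn] : (0 < k nw.1)%N /\ (k nw.1 < nw.1)%N by near: nw.
have [p0 _] : 0 < psi (b (level nw.1)%:R) /\ 0 < a (b (level nw.1)%:R) by near: nw.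
have a1 : array_mean X_ Y_ k (fun n z => (c < xz n z)%R%:R) nw.1 nw.2 < 1 by near: nw.
have a2 : 1 < array_mean X_ Y_ k (fun n z => (- c < xz n z)%R%:R) nw.1 nw.2 by near: nw.
apply: le_lt_trans ce; rewrite ler_norml; apply/andP; split.
  by apply: ltW; rewrite lt_V.
by rewrite leNgt lt_V// -leNgt ltW.
Unshelve. all: by end_near. Qed.

End sample.

(** * Limits of the numerator and of the denominator *)

Section weighted_sums.
Context d (T : measurableType d) (R : realType) (P : probability T R).
Variables (X Y : {RV P >-> R}) (X_ Y_ : nat -> {RV P >-> R}).
Variables (g : R) (a m psi : R -> R).
Variable nu : {measure set (\bar R * \bar R) -> \bar R}.
Variables p q : R.
Hypothesis Hiid : iid_copies X Y X_ Y_.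
Hypothesis H1 : extreme_assumption X Y g a m psi nu.
Hypothesis H2 : moment_assumption X Y g a m psi nu p q.
Hypotheses (p1 : 1 <= p) (q1 : 1 <= q).
Variable k : nat -> nat.
Hypothesis Hk : intermediate R k.

Notation b := (tail_quantile X).
Notation xs := (x_std X psi).
Notation ys := (y_std X Y a m).
Notation xz := (xz X psi k).
Notation yz := (yz X a m k).
Notation tau := (tau X X_ psi k).
Notation level := (level R k).
Notation F := (@finite_half R : set (\bar R * \bar R)).

Lemma excess_bound_pw (x t L dl : R) : 0 < L -> `|t| <= dl ->
  `|Num.max 0 (x - t) - clamp 0 L x| <= `|t| * (- dl < x)%R%:R + Num.max 0 (x - L).
Proof.
move=> L0 td; rewrite clamp0E//.
have := ler_norm t; have := ler_norm (- t); rewrite normrN => h1 h2.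
have [dx|xd] := ltP (- dl) x; rewrite /= ?mulr1 ?mulr0 ler_norml /Num.max /Num.min;
  case: (ltP 0 x) => h4; apply/andP; repeat (case: ifPn; rewrite -?leNgt => ?); split; lra.
Qed.

(** With c the clamped y, the difference splits into (y - c)(x - t)^+, which vanishes unless |y| > M
    and x > - dl, and c times the error made on x, which [excess_bound_pw] bounds by a shift term
    and an excess term. *)
Lemma weighted_bound_pw (x y t L M M0 dl : R) : 0 < L -> 0 < M -> M0 <= M -> dl <= 1 ->
  `|t| <= dl ->
  `|y * Num.max 0 (x - t) - clamp 0 L x * clamp (- M) M y| <=
  M * (`|t| * (- dl < x)%R%:R) +
  ((1 + Num.max 0 x) * `|y| * ((- dl < x) && (M0 <= `|y|))%R%:R + M * Num.max 0 (x - L)).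
Proof.
move=> L0 M0' M0M d1 td; set c := clamp (- M) M y.
have lM : - M <= M by lra.
have cM : `|c| <= M by apply: norm_clamp_bound => //; exact: ltW.
have h := @excess_bound_pw x t L dl L0 td.
have -> : y * Num.max 0 (x - t) - clamp 0 L x * c =
  (y - c) * Num.max 0 (x - t) + c * (Num.max 0 (x - t) - clamp 0 L x) by ring.
apply: le_trans (ler_normD _ _) _.
have h1 : `|c * (Num.max 0 (x - t) - clamp 0 L x)| <=
    M * (`|t| * (- dl < x)%R%:R) + M * Num.max 0 (x - L).
  by rewrite normrM -mulrDr ler_pM.
suff h2 : `|(y - c) * Num.max 0 (x - t)| <=
    (1 + Num.max 0 x) * `|y| * ((- dl < x) && (M0 <= `|y|))%R%:R by lra.
have m0 : 0 <= Num.max 0 (x - t) by rewrite le_max lexx.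
rewrite normrM (ger0_norm m0).
have [yM|My] := leP `|y| M.
  have cy : c = y.
    by move: yM; rewrite ler_norml /c /clamp => /andP[y1 y2]; rewrite min_r// max_r.
  by rewrite cy subrr normr0 mul0r !mulr_ge0// addr_ge0// le_max lexx.
rewrite (le_trans M0M (ltW My)) andbT.
have [dx|xd] := ltP (- dl) x; rewrite /= ?mulr1 ?mulr0; last first.
  rewrite (_ : Num.max 0 (x - t) = 0) ?mulr0//; apply: max_l.
  by move: td; rewrite ler_norml => /andP[t1 t2]; lra.
rewrite mulrC; apply: ler_pM => //.
  rewrite ge_max addr_ge0 ?le_max ?lexx//=.
  have x0 : x <= Num.max 0 x by rewrite le_max lexx orbT.
  by move: td; rewrite ler_norml => /andP[t1 t2]; lra.
have := ler_norm y; have := ler_norm (- y); rewrite normrN => n1 n2.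
rewrite ler_norml /c /clamp /Num.max /Num.min; case: (ltP M y) => h4; apply/andP;
  repeat (case: ifPn; rewrite -?leNgt => ?); split; lra.
Qed.

Definition num_mean (n : nat) (w : T) : R := (k n)%:R^-1 * \sum_(i < n) yz n (X_ i w, Y_ i w) *
    Num.max 0 (xz n (X_ i w, Y_ i w) - tau n w).

Definition den_mean (n : nat) (w : T) : R := (k n)%:R^-1 * \sum_(i < n)
    Num.max 0 (xz n (X_ i w, Y_ i w) - tau n w).

Let mxi n i : measurable_fun setT (fun w => xz n (X_ i w, Y_ i w)).
Proof. by apply: (measurableT_comp (measurable_xz X psi k n)); exact: measurable_rv_pair. Qed.

Let myi n i : measurable_fun setT (fun w => yz n (X_ i w, Y_ i w)).
Proof. by apply: (measurableT_comp (measurable_yz X a m k n)); exact: measurable_rv_pair. Qed.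

Let mmax n i : measurable_fun setT (fun w => Num.max 0 (xz n (X_ i w, Y_ i w) - tau n w)).
Proof.
by apply: measurable_maxr => //; apply: measurable_funB => //; exact: measurable_tau.
Qed.

Lemma measurable_num_mean n : measurable_fun setT (num_mean n).
Proof.
by apply: measurable_funM => //; apply: measurable_sum => i; exact: measurable_funM.
Qed.

Lemma measurable_den_mean n : measurable_fun setT (den_mean n).
Proof. by apply: measurable_funM => //; apply: measurable_sum. Qed.

Let le_mean_diff (n : nat) (K : R) (s t c : 'I_n -> R) : 0 <= K ->
  (forall i, `|s i - t i| <= c i) ->
  `|K * (\sum_i s i) - K * (\sum_i t i)| <= K * \sum_i c i.
Proof.
move=> K0 h; rewrite -mulrBr normrM (ger0_norm K0) ler_wpM2l// -sumrB.
by apply: le_trans (ler_norm_sum _ _ _) _; exact: ler_sum.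
Qed.

Let mcl (lo hi : R) (f : R * R -> R) :
  measurable_fun setT f -> measurable_fun setT (fun w => clamp lo hi (f w)).
Proof. exact: (measurableT_comp (continuous_measurable_fun (@clamp_continuous R lo hi))). Qed.

Let scale_le (t N : R) (u : \bar R) (h : R) : 0 <= t -> 0 < N -> t / N < 2 -> (0 <= u)%E ->
  (N%:E * u <= h%:E)%E -> (t%:E * u <= (2 * h)%:E)%E.
Proof.
move=> t0 N0 tN u0 Nu.
apply: (@le_trans _ _ (2%:E * (N%:E * u))%E).
  by rewrite muleA -EFinM lee_wpmul2r// lee_fin; rewrite ltr_pdivrMr// in tN; exact: ltW.
by rewrite EFinM lee_wpmul2l// lee_fin.
Qed.

Let near_scale : \forall n \near \oo,
  0 < (level n)%:R :> R /\ n%:R / (k n)%:R / (level n)%:R < 2 :> R.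
Proof.
have A : \forall n \near \oo, n%:R / (k n)%:R / (level n)%:R < 2 :> R.
  by apply: (cvgr_lt _ (level_ratio_cvg Hk)); rewrite ltr1n.
have l0 := near_level Hk (nbhs_infty_gt 0).
by near=> n; split; [rewrite ltr0n; near: n; exact: l0|near: n].
Unshelve. all: by end_near. Qed.

Lemma num_mean_cvg : (fun nw => num_mean nw.1 nw.2) @ prob_filter P -->
  (\int[nu]_(z in F) (fine z.1 * fine z.2))%R.
Proof.
apply: prob_approx; first exact: measurable_num_mean.
move=> h h0; have h4 : 0 < h / 4 by rewrite divr_gt0.
have [dl [M0 [d0 d1 gd M00 hty]]] := tail_y H1 H2 p1 q1 h4.
have [M [M0' MM hL]] := truncated_integral H1 H2 p1 q1 M0 h0.
have M0R : 0 < M%:R :> R by rewrite ltr0n.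
(* The excess of [x] enters the bound with the factor [M]. *)
have hM : 0 < h / 4 / M%:R by rewrite divr_gt0.
have [L0 [L00 hex]] := xs_excess_small H1 H2 p1 hM.
have [L [L1 LL hl]] := hL L0.
have L0R : 0 < L%:R :> R by rewrite ltr0n.
pose ty n z : R := (1 + Num.max 0 (xz n z)) * `|yz n z| *
  ((- dl < xz n z) && (M0 <= `|yz n z|))%R%:R.
pose ex n z : R := Num.max 0 (xz n z - L%:R).
pose f n z := ty n z + M%:R * ex n z.
have mx n := measurable_xz X psi k n.
have my n := measurable_yz X a m k n.
have mmx n : measurable_fun setT (fun z => Num.max 0 (xz n z)) by exact: measurable_maxr.
have mex n : measurable_fun setT (ex n).
  by apply: measurable_maxr => //; exact: measurable_funB.
have mty n : measurable_fun setT (ty n).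
  have myn : measurable_fun setT (fun z => `|yz n z|) by exact: measurableT_comp.
  apply: measurable_funM.
    by apply: measurable_funM => //; exact: measurable_funD.
  apply: measurable_bool_fun; apply: measurable_set_bool.
  by apply: measurable_and; [exact: measurable_fun_ltr|exact: measurable_fun_ler].
have ty0 n z : 0 <= ty n z by rewrite /ty !mulr_ge0// addr_ge0// le_max lexx.
have ex0 n z : 0 <= ex n z by rewrite le_max lexx.
have mf n : measurable_fun setT (f n) by apply: measurable_funD => //; exact: measurable_funM.
have f0 n z : 0 <= f n z by rewrite addr_ge0// mulr_ge0.
exists (fun nw => array_mean X_ Y_ k
    (fun n z => clamp 0 L%:R (xz n z) * clamp (- M%:R) M%:R (yz n z)) nw.1 nw.2).
exists (fun nw => M%:R * (`|tau nw.1 nw.2| *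
    array_mean X_ Y_ k (fun n z => (- dl < xz n z)%R%:R) nw.1 nw.2)).
exists (array_mean X_ Y_ k f).
exists (\int[nu]_(z in F) (eclamp 0 L%:R z.1 * eclamp (- M%:R) M%:R z.2))%R.
have dom : 0 < 1 + g * (- dl) by lra.
split.
- exact: hl.
- apply: (@lln_std _ _ _ P X Y X_ Y_ g a m psi nu Hiid H1 k Hk
    (fun x y => clamp 0 L%:R x * clamp (- M%:R) M%:R y) (L%:R * M%:R) dl) => //.
  + apply: measurable_funM; apply: mcl; [exact: measurable_fst|exact: measurable_snd].
  + move=> x y; rewrite normrM; apply: ler_pM => //; last exact: norm_clamp_bound.
    by have /andP[c1 c2] := clamp_itv x (ltW L0R); rewrite ger0_norm.
  + by move=> x y xd; rewrite clamp_neg ?mul0r//; lra.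
  + exact: (signed_cvg H1 L0R M0R).
- have h1 : (fun nw => M%:R * (`|tau nw.1 nw.2| *
      array_mean X_ Y_ k (fun n z => (- dl < xz n z)%R%:R) nw.1 nw.2)) @ prob_filter P -->
      (M%:R * (`|0 : R| * gpd g (- dl)) : R).
    have t1 := count_cvg Hiid H1 Hk dom.
    have t2 : (fun nw => `|tau nw.1 nw.2|) @ prob_filter P --> `|0 : R|.
      by apply: cvg_norm; exact: (tau_cvg Hiid H1 Hk).
    by apply: cvgM; [exact: cvg_cst|exact: cvgM].
  by rewrite normr0 mul0r mulr0 in h1.
- move=> n; split; first exact: measurable_array_mean.
  by move=> w; rewrite mulr_ge0 ?invr_ge0// sumr_ge0.
- split.
    have e1 := near_level Hk hty; have e2 := near_level Hk hex.
    have [N0 _ HN] := filterI near_scale (filterI e1 e2).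
    exists N0 => // n /HN [[l0 lr] [k1 k2]].
    rewrite (uexp_array_mean Hiid k (mf n) (f0 n)).
    (* One quarter for the tail in [y], one for the excess in [x]; the factor 2 bounds the ratio of
       n/k to its integer part. *)
    have -> : h = 2 * (h / 4 + h / 4) by lra.
    apply: (scale_le _ l0 lr); [by rewrite divr_ge0|by apply: uexp_ge0|].
    rewrite /f uexpD; last 4 first.
    + by apply: (measurableT_comp (mty n)); exact: measurable_rv_pair.
    + by apply: measurable_funM => //; apply: (measurableT_comp (mex n)); exact: measurable_rv_pair.
    + by [].
    + by move=> w; rewrite mulr_ge0.
    rewrite ge0_muleDr ?uexp_ge0//; last by move=> w; rewrite mulr_ge0.
    rewrite EFinD leeD//.
    rewrite uexpZ//; last first.
      by apply: (measurableT_comp (mex n)); exact: measurable_rv_pair.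
    rewrite muleCA; apply: (@le_trans _ _ (M%:R%:E * (h / 4 / M%:R)%:E)%E).
      apply: lee_wpmul2l; first by rewrite lee_fin.
      apply: le_trans k2; apply: lee_wpmul2l; first by rewrite lee_fin.
      apply: le_uexp.
      + by apply: (measurableT_comp (mex n)); exact: measurable_rv_pair.
      + by apply: measurable_maxr => //; apply: measurable_funB => //; exact: measurable_x_std.
      + move=> w; rewrite ex0/= /ex ge_max le_max lexx/= le_max.
        by apply/orP; right; rewrite lerB.
    by rewrite -EFinM lee_fin mulrC divfK// gt_eqF.
  have /cvgr0Pnorm_lt/(_ _ d0) T1 := tau_cvg Hiid H1 Hk.
  near=> nw; have td : `|tau nw.1 nw.2| < dl by near: nw.
  rewrite /num_mean /array_mean.
  apply: (@le_trans _ _ ((k nw.1)%:R^-1 * \sum_(i < nw.1)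
     (M%:R * (`|tau nw.1 nw.2| * (- dl < xz nw.1 (X_ i nw.2, Y_ i nw.2))%R%:R) +
      f nw.1 (X_ i nw.2, Y_ i nw.2)))).
    apply: le_mean_diff; first by rewrite invr_ge0.
    move=> i; apply: weighted_bound_pw => //; exact: ltW.
  rewrite big_split /= mulrDr lerD2r -!mulr_sumr.
  by rewrite le_eqVlt; apply/orP; left; apply/eqP; ring.
Unshelve. all: by end_near. Qed.

(** The mean truncated at L tends to gpd_int g L - gpd_int g 0, which differs from [(1 - g)^-1] by
    [gpd_int g L], negligible for large L. *)
Lemma den_mean_cvg : (fun nw => den_mean nw.1 nw.2) @ prob_filter P --> (1 - g)^-1.
Proof.
have g0 := index_ge0 H1; have g1 := index_lt1 H1 H2 p1.
apply: prob_approx; first exact: measurable_den_mean.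
move=> h h0; have h2 : 0 < h / 2 by rewrite divr_gt0.
have [L0 [L00 hex]] := xs_excess_small H1 H2 p1 h2.
have [L1 [L10 hL]] := gpd_int_cvg0 g0 g1 h0.
have [dl [d0 gd _ _]] := gpd_near0 g0 ltr01.
pose L := Num.max L0 L1.
have Lp : 0 < L by rewrite lt_max L00.
have LL0 : L0 <= L by rewrite le_max lexx.
have LL1 : L1 <= L by rewrite le_max lexx orbT.
pose ex n z : R := Num.max 0 (xz n z - L).
have mx n := measurable_xz X psi k n.
have mex n : measurable_fun setT (ex n).
  by apply: measurable_maxr => //; exact: measurable_funB.
have ex0 n z : 0 <= ex n z by rewrite le_max lexx.
exists (fun nw => array_mean X_ Y_ k (fun n z => clamp 0 L (xz n z)) nw.1 nw.2).
exists (fun nw => `|tau nw.1 nw.2| *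
    array_mean X_ Y_ k (fun n z => (- dl < xz n z)%R%:R) nw.1 nw.2).
exists (array_mean X_ Y_ k ex).
exists (gpd_int g L - gpd_int g 0).
have dom : 0 < 1 + g * (- dl) by lra.
have domL : 0 < 1 + g * L by have := mulr_ge0 g0 (ltW Lp); lra.
split.
- rewrite gpd_int0 opprK addrK ler_norml hL//=.
  by rewrite (le_trans (gpd_int_le0 g0 g1 domL))// ltW.
- apply: (@lln_std _ _ _ P X Y X_ Y_ g a m psi nu Hiid H1 k Hk
    (fun x _ => clamp 0 L x) L dl) => //.
  + by apply: mcl; exact: measurable_fst.
  + by move=> x _; have /andP[c1 c2] := clamp_itv x (ltW Lp); rewrite ger0_norm.
  + by move=> x y xd; rewrite clamp_neg// ?ltW//; lra.
  + exact: (xs_truncated_mean H1 H2 p1 Lp).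
- have h1 : (fun nw => `|tau nw.1 nw.2| *
      array_mean X_ Y_ k (fun n z => (- dl < xz n z)%R%:R) nw.1 nw.2) @ prob_filter P -->
      (`|0 : R| * gpd g (- dl)).
    have t1 := count_cvg Hiid H1 Hk dom.
    have t2 : (fun nw => `|tau nw.1 nw.2|) @ prob_filter P --> `|0 : R|.
      by apply: cvg_norm; exact: (tau_cvg Hiid H1 Hk).
    exact: cvgM.
  by rewrite normr0 mul0r in h1.
- move=> n; split; first exact: measurable_array_mean.
  by move=> w; rewrite mulr_ge0 ?invr_ge0// sumr_ge0.
- split.
    have e2 := near_level Hk hex.
    have [N0 _ HN] := filterI near_scale e2.
    exists N0 => // n /HN [[l0 lr] k2].
    rewrite (uexp_array_mean Hiid k (mex n) (ex0 n)).
    have -> : h = 2 * (h / 2) by lra.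
    apply: (scale_le _ l0 lr); [by rewrite divr_ge0|by apply: uexp_ge0|].
    apply: le_trans k2; apply: lee_wpmul2l; first by rewrite lee_fin.
    apply: le_uexp.
    + by apply: (measurableT_comp (mex n)); exact: measurable_rv_pair.
    + by apply: measurable_maxr => //; apply: measurable_funB => //; exact: measurable_x_std.
    + move=> w; rewrite ex0/= /ex ge_max le_max lexx/= le_max.
      by apply/orP; right; rewrite lerB.
  have /cvgr0Pnorm_lt/(_ _ d0) T1 := tau_cvg Hiid H1 Hk.
  near=> nw; have td : `|tau nw.1 nw.2| < dl by near: nw.
  rewrite /den_mean /array_mean.
  apply: (@le_trans _ _ ((k nw.1)%:R^-1 * \sum_(i < nw.1)
     (`|tau nw.1 nw.2| * (- dl < xz nw.1 (X_ i nw.2, Y_ i nw.2))%R%:R +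
      ex nw.1 (X_ i nw.2, Y_ i nw.2)))).
    apply: le_mean_diff; first by rewrite invr_ge0.
    move=> i; apply: excess_bound_pw => //; exact: ltW.
  rewrite big_split /= mulrDr lerD2r -!mulr_sumr.
  by rewrite le_eqVlt; apply/orP; left; apply/eqP; ring.
Unshelve. all: by end_near. Qed.

End weighted_sums.

Lemma measurable_inv d (T : measurableType d) (R : realType) (f : T -> R) :
  measurable_fun setT f -> measurable_fun setT (fun w => (f w)^-1).
Proof.
(* Writing f^-1 as f (f^2)^(-1) reduces the claim to powers of a nonnegative function; both sides
   are 0 where f vanishes. *)
move=> mf; rewrite (_ : (fun w => _) = fun w => f w * (f w ^+ 2) `^ (-1)).
  apply: measurable_funM => //.
  by apply: (measurableT_comp (measurable_powR (-1))); exact: measurable_funX.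
apply/funext => w; rewrite powR_inv1 ?sqr_ge0//.
have [->|f0] := eqVneq (f w) 0; first by rewrite invr0 mul0r.
by rewrite expr2 invfM mulrA divff// mul1r.
Qed.

Lemma bounded_mul_cvg0 (R : realType) (U : Type) (F : set_system U) (FF : Filter F)
    (c z : U -> R) (C : R) :
  (\forall x \near F, `|c x| <= C) -> z @ F --> (0 : R) ->
  (fun x => c x * z x) @ F --> (0 : R).
Proof.
move=> cC z0; apply/norm_cvg0P.
have h0 : (fun _ : U => 0 : R) @ F --> (0 : R) by exact: cvg_cst.
have h1 : (fun x => C * `|z x|) @ F --> (0 : R).
  rewrite -(mulr0 C); apply: cvgM; first exact: cvg_cst.
  by rewrite -(normr0 R); exact: cvg_norm.
apply: (squeeze_cvgr _ h0 h1); apply: filterS cC => x cx.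
by rewrite normr_ge0/= normrM ler_wpM2r.
Qed.

(** * The estimators of m and of the slope *)

Section estimator.
Context d (T : measurableType d) (R : realType) (P : probability T R).
Variables (X Y : {RV P >-> R}) (X_ Y_ : nat -> {RV P >-> R}).
Variables (g : R) (a m psi : R -> R).
Variable nu : {measure set (\bar R * \bar R) -> \bar R}.
Variables p q : R.
Hypothesis Hiid : iid_copies X Y X_ Y_.
Hypothesis H1 : extreme_assumption X Y g a m psi nu.
Hypothesis H2 : moment_assumption X Y g a m psi nu p q.
Hypotheses (p1 : 1 <= p) (q1 : 1 <= q).
Variable k : nat -> nat.
Hypothesis Hk : intermediate R k.

Notation b := (tail_quantile X).
Notation bl n := (tail_quantile X (level R k n)%:R).
Notation xz_k := (xz X psi k).
Notation tau_k := (tau X X_ psi k).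
Notation num_mean_k := (num_mean X X_ Y_ a m psi k).
Notation den_mean_k := (den_mean X X_ Y_ psi k).
Notation V_k := (V X_ k).
Notation mu := (limit_mu g nu).

Definition ratio_mean (n : nat) (w : T) : R := num_mean_k n w / den_mean_k n w.

Lemma ratio_mean_cvg : (fun nw => ratio_mean nw.1 nw.2) @ prob_filter P --> mu.
Proof.
have g1 := index_lt1 H1 H2 p1.
have h1 := num_mean_cvg Hiid H1 H2 p1 q1 Hk.
have h2 := den_mean_cvg Hiid H1 H2 p1 Hk.
rewrite /limit_mu mulrC -[X in _ * X]invrK; apply: (cvgM h1); apply: cvgV => //.
by rewrite invr_eq0 gt_eqF// subr_gt0.
Qed.

Definition estimator (n : nat) (w : T) : R :=
  (\sum_(i < n) Y_ i w * Num.max 0 (X_ i w - V_k n w)) /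
  \sum_(i < n) Num.max 0 (X_ i w - V_k n w).

Lemma measurable_estimator n : measurable_fun setT (estimator n).
Proof.
have mx i : measurable_fun setT (fun w => Num.max 0 (X_ i w - V_k n w)).
  by apply: measurable_maxr => //; apply: measurable_funB => //; exact: measurable_V.
apply: measurable_funM; last by apply: measurable_inv; exact: measurable_sum.
by apply: measurable_sum => i; exact: measurable_funM.
Qed.

Lemma m_hat_estimator n w : (k n < n)%N ->
  m_hat (X_ ^~ w) (Y_ ^~ w) n (k n) = estimator n w.
Proof. by move=> kn; rewrite m_hatE// /estimator /V kn. Qed.

(** The estimator is a weighted average of the [Y_ i]: the scale of the weights cancels, and an
    affine change of [Y] passes through the average. *)
Lemma estimator_ratio n w : (0 < k n)%N -> 0 < psi (bl n) -> 0 < a (bl n) ->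
  0 < den_mean_k n w -> estimator n w = m (bl n) + a (bl n) * ratio_mean n w.
Proof.
move=> k0 s0 a0 D0; have k0' : 0 < (k n)%:R :> R by rewrite ltr0n.
have E i : Num.max 0 (X_ i w - V_k n w) =
    psi (bl n) * Num.max 0 (xz_k n (X_ i w, Y_ i w) - tau_k n w).
  rewrite maxr_pMr ?ltW// mulr0; congr Num.max.
  by rewrite /xz /tau /=; field; rewrite gt_eqF.
have ED : \sum_(i < n) Num.max 0 (X_ i w - V_k n w) = psi (bl n) * ((k n)%:R * den_mean_k n w).
  by rewrite /den_mean mulVKf ?gt_eqF// mulr_sumr; apply: eq_bigr => i _.
have EN : \sum_(i < n) Y_ i w * Num.max 0 (X_ i w - V_k n w) = psi (bl n) *
    ((k n)%:R * (m (bl n) * den_mean_k n w + a (bl n) * num_mean_k n w)).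
  rewrite mulrDr [X in X + _]mulrCA [X in _ + X]mulrCA.
  rewrite /den_mean /num_mean !mulVKf ?gt_eqF// !mulr_sumr -big_split /= mulr_sumr.
  apply: eq_bigr => i _; rewrite E.
  by rewrite /yz /=; field; rewrite gt_eqF.
rewrite /estimator /ratio_mean EN ED.
by field; rewrite !gt_eqF.
Qed.

Lemma near_estimator : \forall nw \near prob_filter P,
  estimator nw.1 nw.2 = m (bl nw.1) + a (bl nw.1) * ratio_mean nw.1 nw.2.
Proof.
have g1 := index_lt1 H1 H2 p1.
have h1 := near_prob_filter P (near_k_lt Hk).
have h2 := near_prob_filter P (near_level Hk (scales_gt0 H1)).
have h3 : \forall nw \near prob_filter P, 0 < den_mean_k nw.1 nw.2.
  apply: (cvgr_gt _ (den_mean_cvg Hiid H1 H2 p1 Hk)).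
  by rewrite invr_gt0 subr_gt0.
near=> nw; have [k0 _] : (0 < k nw.1)%N /\ (k nw.1 < nw.1)%N by near: nw.
have [s0 a0] : 0 < psi (bl nw.1) /\ 0 < a (bl nw.1) by near: nw.
by apply: estimator_ratio => //; near: nw.
Unshelve. all: by end_near. Qed.

Lemma cvg_in_probability_near (Z Z' : nat -> T -> R) (l : R) :
  (forall n, measurable_fun setT (Z' n)) ->
  (\forall n \near \oo, forall w, Z' n w = Z n w) ->
  (fun nw => Z' nw.1 nw.2) @ prob_filter P --> l -> cvg_in_probability P Z l.
Proof.
move=> mZ ZZ /(cvg_in_probabilityP P l mZ) h e e0.
apply: cvg_trans (h e e0); apply: near_eq_cvg; apply: filterS ZZ => n E.
by congr (P _); apply/seteqP; split => w /=; rewrite E.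
Qed.

Notation bt n := (tail_quantile X (n%:R / (k n)%:R)).

Lemma standardized_estimator_cvg : cvg_in_probability P
  (fun n w => (m_hat (X_ ^~ w) (Y_ ^~ w) n (k n) - m (bt n)) / a (bt n)) mu.
Proof.
apply: (@cvg_in_probability_near _ (fun n w => (estimator n w - m (bt n)) / a (bt n))).
- move=> n; apply: measurable_funM => //; apply: measurable_funB => //.
  exact: measurable_estimator.
- by apply: filterS (near_k_lt Hk) => n [_ kn] w; rewrite m_hat_estimator.
have [_ ty] := Hk; have [ra rm] := real_index_types H1 ty.
have ra' : (fun nw : nat * T => a (bt nw.1) / a (bl nw.1)) @ prob_filter P --> (1:R).
  exact: (cvg_comp _ _ (@fst_prob_filter _ _ _ P) ra).
have rm' : (fun nw : nat * T => (m (bt nw.1) - m (bl nw.1)) / a (bl nw.1)) @ prob_filter P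
    --> (0:R).
  exact: (cvg_comp _ _ (@fst_prob_filter _ _ _ P) rm).
(* The centring and scaling at n/k, expressed relative to those at its integer part. *)
have h : (fun nw : nat * T => (ratio_mean nw.1 nw.2 - (m (bt nw.1) - m (bl nw.1)) / a (bl nw.1)) /
    (a (bt nw.1) / a (bl nw.1))) @ prob_filter P --> (mu - 0) / 1.
  apply: cvgM; last by apply: cvgV => //; exact: oner_neq0.
  by apply: cvgB => //; exact: ratio_mean_cvg.
rewrite subr0 divr1 in h; apply: cvg_trans h; apply: near_eq_cvg.
have h1 := near_prob_filter P (near_level Hk (scales_gt0 H1)).
have h2 := near_estimator.
near=> nw; have [_ a0] : 0 < psi (bl nw.1) /\ 0 < a (bl nw.1) by near: nw.
rewrite (_ : estimator nw.1 nw.2 = m (bl nw.1) + a (bl nw.1) * ratio_mean nw.1 nw.2); last by near: nw.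
rewrite invf_div mulrA; congr (_ / _).
by field; rewrite gt_eqF.
Unshelve. all: by end_near. Qed.

(** Both b(n) and b(shift n) are eventually positive, so b(n) exceeds its increment b(n) - b(shift
    n), which is at least of the order of psi(b(shift n)), itself comparable to psi(b(n)). *)
Lemma near_psi_le : exists2 C : R, 0 <= C &
  \forall n \near \oo, 0 < b n%:R /\ psi (b n%:R) <= C * b n%:R.
Proof.
have g0 := index_ge0 H1; have [h1 h2] := shift_types H1.
pose q0 := gpd_quantile g (10 / 9).
have q00 : 0 < q0 by rewrite -(gpd_quantile1 g) gpd_quantile_lt//; lra.
pose r0 : R := (10 / 9) `^ g + 1.
have r00 : 0 < r0 by rewrite ltr_wpDl// powR_ge0.
exists (r0 * (2 / q0)); first by rewrite mulr_ge0 ?divr_ge0 ?ltW.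
have e1 : \forall n \near \oo, psi (b n%:R) / psi (b (shift n)%:R) < r0.
  by apply: (cvgr_lt _ h1); rewrite ltrDl.
have e2 : \forall n \near \oo, q0 / 2 < (b n%:R - b (shift n)%:R) / psi (b (shift n)%:R).
  by apply: (cvgr_gt _ h2); rewrite -/q0; lra.
have e3 : \forall n \near \oo, 0 < b n%:R by have /cvgryPgt/(_ 0) := b_cvg H1.
have e4 := near_shift e3; have e5 := near_shift (scales_gt0 H1).
have [N0 _ HN] := filterI e1 (filterI e2 (filterI e3 (filterI e4 e5))).
exists N0 => // n /HN [l1 [l2 [l3 [l4 [s0 _]]]]]; split=> //.
rewrite ltr_pdivrMr// in l1; rewrite ltr_pdivlMr// in l2.
apply: le_trans (ltW l1) _; rewrite -mulrA ler_pM2l//.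
rewrite -[2 / q0]invf_div mulrC ler_pdivlMr ?divr_gt0// mulrC.
by lra.
Qed.

Lemma scaled_tau_cvg :
  (fun nw => psi (bl nw.1) / bl nw.1 * tau_k nw.1 nw.2) @ prob_filter P --> (0:R).
Proof.
have [C C0 hC] := near_psi_le.
apply: (@bounded_mul_cvg0 _ _ _ _ _ _ C); last exact: (tau_cvg Hiid H1 Hk).
have h1 := near_prob_filter P (near_level Hk hC).
have h2 := near_prob_filter P (near_level Hk (scales_gt0 H1)).
near=> nw; have [b0 pb] : 0 < bl nw.1 /\ psi (bl nw.1) <= C * bl nw.1 by near: nw.
have [s0 _] : 0 < psi (bl nw.1) /\ 0 < a (bl nw.1) by near: nw.
have sb : 0 <= psi (bl nw.1) / bl nw.1 by rewrite divr_ge0 ?ltW.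
by rewrite ger0_norm// ler_pdivrMr.
Unshelve. all: by end_near. Qed.

Lemma near_bl (A : R -> Prop) : (\forall x \near +oo, A x) ->
  \forall nw \near prob_filter P, A (bl nw.1).
Proof.
move=> hA; have h : \forall n \near \oo, A (b n%:R) by exact: (b_cvg H1 hA).
exact: (near_prob_filter P (near_level Hk h)).
Qed.

Lemma scaled_ratio_cvg :
  (mu = 0 /\ a =O_ (pinfty_nbhs R) id) \/ a =o_ (pinfty_nbhs R) id ->
  (fun nw => a (bl nw.1) / bl nw.1 * ratio_mean nw.1 nw.2) @ prob_filter P --> (0:R).
Proof.
have b0 := near_bl (nbhs_pinfty_gt (num_real 0)).
case=> [[mu0 /eqO_exP[C C0 hC]]|/eqoP ho].
  have h := ratio_mean_cvg; rewrite mu0 in h.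
  apply: (@bounded_mul_cvg0 _ _ _ _ _ _ C) h.
  have h1 := near_bl hC.
  near=> nw; have bp : 0 < bl nw.1 by near: nw.
  have hb : `|a (bl nw.1)| <= C * `|bl nw.1| by near: nw.
  by rewrite normrM normfV ler_pdivrMr ?normr_gt0 ?gt_eqF.
have r0 : (fun nw : nat * T => a (bl nw.1) / bl nw.1) @ prob_filter P --> (0:R).
  apply/cvgr0Pnorm_le => e e0; have h1 := near_bl (ho e e0).
  near=> nw; have bp : 0 < bl nw.1 by near: nw.
  have hb : `|a (bl nw.1)| <= e * `|bl nw.1| by near: nw.
  by rewrite normrM normfV ler_pdivrMr ?normr_gt0 ?gt_eqF.
rewrite -(mul0r mu); apply: cvgM => //; exact: ratio_mean_cvg.
Unshelve. all: by end_near. Qed.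

Lemma slope_estimator_cvg (rho : R) : (forall x, m x = rho * x) ->
  (mu = 0 /\ a =O_ (pinfty_nbhs R) id) \/ a =o_ (pinfty_nbhs R) id ->
  cvg_in_probability P (fun n w => m_hat (X_ ^~ w) (Y_ ^~ w) n (k n) /
    order_stat (X_ ^~ w) n (n - k n)) rho.
Proof.
move=> mE ha.
apply: (@cvg_in_probability_near _ (fun n w => estimator n w / V_k n w)).
- move=> n; apply: measurable_funM; first exact: measurable_estimator.
  by apply: measurable_inv; exact: measurable_V.
- apply: filterS (near_k_lt Hk) => n [_ kn] w.
  by rewrite m_hat_estimator// /V kn.
(* Numerator and threshold are both divided by b at the integer part of n/k: the former becomes
   [rho] plus a vanishing term, the latter 1 plus a vanishing term. *)
have h : (fun nw => (rho + a (bl nw.1) / bl nw.1 * ratio_mean nw.1 nw.2) /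
    (1 + psi (bl nw.1) / bl nw.1 * tau_k nw.1 nw.2)) @ prob_filter P --> (rho + 0) / (1 + 0).
  apply: cvgM; first by apply: cvgD; [exact: cvg_cst|exact: scaled_ratio_cvg].
  apply: cvgV; first by rewrite addr0 oner_neq0.
  by apply: cvgD; [exact: cvg_cst|exact: scaled_tau_cvg].
rewrite !addr0 divr1 in h; apply: cvg_trans h; apply: near_eq_cvg.
have h1 := near_prob_filter P (near_level Hk (scales_gt0 H1)).
have h2 := near_estimator.
have h3 := near_bl (nbhs_pinfty_gt (num_real 0)).
near=> nw; have [s0 _] : 0 < psi (bl nw.1) /\ 0 < a (bl nw.1) by near: nw.
have b0 : 0 < bl nw.1 by near: nw.
rewrite (_ : estimator nw.1 nw.2 = m (bl nw.1) + a (bl nw.1) * ratio_mean nw.1 nw.2); last by near: nw.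
have -> : V_k nw.1 nw.2 = bl nw.1 * (1 + psi (bl nw.1) / bl nw.1 * tau_k nw.1 nw.2).
  by rewrite /tau; field; rewrite !gt_eqF.
by rewrite mE invfM [RHS]mulrA; congr (_ / _); field; rewrite gt_eqF.
Unshelve. all: by end_near. Qed.

End estimator.

Theorem proposition5 (R : realType) (d : measure_display)
  (T : measurableType d) (P : probability T R)
  (X Y : {RV P >-> R}) (X_ Y_ : nat -> {RV P >-> R})
  (g : R) (a m psi : R -> R)
  (nu : {measure set (\bar R * \bar R) -> \bar R}) (p q : R)
  (Hiid : iid_copies X Y X_ Y_)
  (H1 : extreme_assumption X Y g a m psi nu)
  (H2 : moment_assumption X Y g a m psi nu p q)
  (Hp : 1 <= p) (Hq : 1 <= q)
  (k : nat -> nat) (Hk : intermediate R k) :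
  let b := tail_quantile X in
  let mhat n w := m_hat (X_ ^~ w) (Y_ ^~ w) n (k n) in
  let bnk n := b (n%:R / (k n)%:R) in
  let mu := limit_mu g nu in
  cvg_in_probability P (fun n w => (mhat n w - m (bnk n)) / a (bnk n)) mu
  /\
  (forall rho : R,
    (forall x, m x = rho * x) ->
    (mu = 0 /\ a =O_ (pinfty_nbhs R) id) \/ a =o_ (pinfty_nbhs R) id ->
    cvg_in_probability P
      (fun n w => mhat n w / order_stat (X_ ^~ w) n (n - k n)) rho).
Proof.
split; first exact: (standardized_estimator_cvg Hiid H1 H2 Hp Hq Hk).
by move=> rho; exact: (slope_estimator_cvg Hiid H1 H2 Hp Hq Hk).
Qed.
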